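(* Let $\mathcal{A}$ be a unital $*$-subalgebra of a unital $C^*$-algebra $A$ such that $\mathcal{A}$ and all the matrix algebras $M_m(\mathcal{A})$, $m\ge2$, are closed under holomorphic functional calculus. Let $h=(h_{ij})\in\mathrm{GL}_m^+(\mathcal{A})$ be self-compatible. Then $$\det(h)=\sum_{\sigma\in\mathfrak{S}_m}\varepsilon(\sigma)\,h_{1\sigma(1)}\cdots h_{m\sigma(m)},$$ where $\mathfrak{S}_m$ is the permutation group of $\{1,\dots,m\}$ and $\varepsilon(\sigma)$ is the signature of $\sigma$.
   Context: $\mathrm{GL}_m^+(\mathcal{A})$ is the set of positive invertible elements of $M_m(\mathcal{A})$ (positivity in the $C^*$-algebra $M_m(A)$); $\mathcal{A}^{++}$ is the set of positive invertible elements of $\mathcal{A}$. The determinant $\det:\mathrm{GL}_m^+(\mathcal{A})\to\mathcal{A}^{++}$ is defined by $\det(h)=\exp(\mathrm{Tr}[\log h])$, where $\log h\in M_m(\mathcal{A})$ and $\exp$ are given by holomorphic functional calculus and $\mathrm{Tr}[a]=\sum_ia_{ii}\in\mathcal{A}$ for $a=(a_{ij})\in M_m(\mathcal{A})$. A matrix $a=(a_{ij})\in M_m(\mathcal{A})$ is self-compatible when all its entries commute with one another, i.e., $[a_{ij},a_{kl}]=0$ for all $i,j,k,l$. *)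

(* Defs.v *)
From HB Require Import structures.
From mathcomp Require Import all_boot all_order all_algebra all_fingroup.
From mathcomp Require Import all_classical all_reals all_analysis.
From mathcomp Require Import complex.

Set Implicit Arguments.
Unset Strict Implicit.
Unset Printing Implicit Defensive.

Import Order.TTheory GRing.Theory Num.Theory.
Import numFieldNormedType.Exports.

Local Open Scope classical_set_scope.
Local Open Scope ring_scope.
Local Open Scope complex_scope.

HB.mixin Record isStarAlgebra (R : realType) A of GRing.Algebra R[i] A := {
  star : A -> A;
  starK : involutive star;
  starD : {morph star : x y / x + y};
  starZ : forall (z : R[i]) (x : A), star (z *: x) = z^* *: star x;
  starM : forall x y : A, star (x * y) = star y * star x
}.

#[short(type="starAlgType")]
HB.structure Definition StarAlgebra (R : realType) :=
  {A of GRing.Algebra R[i] A & isStarAlgebra R A}.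

#[short(type="topStarAlgType")]
HB.structure Definition TopStarAlgebra (R : realType) :=
  {A of StarAlgebra R A & Topological A}.

(* The norm and its topology are spelled out because the hierarchy admits no
   structure that is both a ring and a normed module, numeric domains aside. *)
HB.mixin Record isCStarAlgebra (R : realType) A of TopStarAlgebra R A := {
  cnorm : A -> R;
  cnorm_eq0 : forall x : A, cnorm x = 0 -> x = 0;
  cnormD : forall x y : A, cnorm (x + y) <= cnorm x + cnorm y;
  cnormZ : forall (z : R[i]) (x : A), cnorm (z *: x) = Normc.normc z * cnorm x;
  cnormM : forall x y : A, cnorm (x * y) <= cnorm x * cnorm y;
  cnorm_star_mul : forall x : A, cnorm (star x * x) = cnorm x ^+ 2;
  cnorm_nbhs : forall x : A, nbhs x =
    filter_from [set e : R | 0 < e] (fun e => [set y | cnorm (x - y) < e]);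
  cnorm_complete : forall u : nat -> A,
    (forall e : R, 0 < e -> exists N : nat, forall p q : nat,
       (N <= p)%N -> (N <= q)%N -> cnorm (u p - u q) < e) ->
    exists l : A, u @ \oo --> l
}.

#[short(type="cstarAlgType")]
HB.structure Definition CStarAlgebra (R : realType) :=
  {A of TopStarAlgebra R A & isCStarAlgebra R A}.

(* [cmx A n] is M_n(A); the alias is needed because ['M[A]_n] is already a
   module over A.  As for ['M[A]_n], the ring structure is on [cmx A n.+1].
   Its topology is that of entrywise convergence, which is the norm topology of
   the C*-algebra M_n(A) because |a_ij| <= |a| <= \sum_(i, j) |a_ij| there. *)
Definition cmx (A : Type) (n : nat) : Type := 'M[A]_n.

Section MatrixStarAlgebra.
Variables (R : realType) (A : starAlgType R) (n : nat).

HB.instance Definition _ := GRing.NzRing.copy (cmx A n.+1) 'M[A]_n.+1.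

Definition cmx_scale (z : R[i]) (a : cmx A n.+1) : cmx A n.+1 :=
  \matrix_(i, j) (z *: a i j).

Fact cmx_scaleA z w a : cmx_scale z (cmx_scale w a) = cmx_scale (z * w) a.
Proof. by apply/matrixP => i j; rewrite !mxE scalerA. Qed.

Fact cmx_scale1 : left_id 1 cmx_scale.
Proof. by move=> a; apply/matrixP => i j; rewrite !mxE scale1r. Qed.

Fact cmx_scaleDr : right_distributive cmx_scale +%R.
Proof. by move=> z a b; apply/matrixP => i j; rewrite !mxE scalerDr. Qed.

Fact cmx_scaleDl a : {morph cmx_scale^~ a : z w / z + w}.
Proof. by move=> z w; apply/matrixP => i j; rewrite !mxE scalerDl. Qed.

HB.instance Definition _ := GRing.Zmodule_isLmodule.Build R[i] (cmx A n.+1)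
  cmx_scaleA cmx_scale1 cmx_scaleDr cmx_scaleDl.

Fact cmx_scale_mull (z : R[i]) (a b : cmx A n.+1) : z *: (a * b) = (z *: a) * b.
Proof.
apply/matrixP => i j; rewrite !mxE scaler_sumr.
by apply: eq_bigr => k _; rewrite !mxE scalerAl.
Qed.

Fact cmx_scale_mulr (z : R[i]) (a b : cmx A n.+1) : z *: (a * b) = a * (z *: b).
Proof.
apply/matrixP => i j; rewrite !mxE scaler_sumr.
by apply: eq_bigr => k _; rewrite !mxE scalerAr.
Qed.

HB.instance Definition _ :=
  GRing.LSemiModule_isLSemiAlgebra.Build R[i] (cmx A n.+1) cmx_scale_mull.
HB.instance Definition _ :=
  GRing.LSemiAlgebra_isSemiAlgebra.Build R[i] (cmx A n.+1) cmx_scale_mulr.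

Definition cmx_star (a : cmx A n.+1) : cmx A n.+1 :=
  \matrix_(i, j) star (a j i).

Fact cmx_starK : involutive cmx_star.
Proof. by move=> a; apply/matrixP => i j; rewrite !mxE starK. Qed.

Fact cmx_starD : {morph cmx_star : a b / a + b}.
Proof. by move=> a b; apply/matrixP => i j; rewrite !mxE starD. Qed.

Fact cmx_starZ (z : R[i]) (a : cmx A n.+1) :
  cmx_star (z *: a) = z^* *: cmx_star a.
Proof. by apply/matrixP => i j; rewrite !mxE starZ. Qed.

Fact cmx_starM (a b : cmx A n.+1) : cmx_star (a * b) = cmx_star b * cmx_star a.
Proof.
have star0 : star (0 : A) = 0.
  by apply: (addrI (star (0 : A))); rewrite -starD !addr0.
apply/matrixP => i j; rewrite !mxE (big_morph _ (@starD R A) star0).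
by apply: eq_bigr => k _; rewrite !mxE starM.
Qed.

HB.instance Definition _ := isStarAlgebra.Build R (cmx A n.+1)
  cmx_starK cmx_starD cmx_starZ cmx_starM.

End MatrixStarAlgebra.

HB.instance Definition _ (R : realType) (A : topStarAlgType R) (n : nat) :=
  Topological.copy (cmx A n.+1) 'M[A]_n.+1.

Section ContourIntegral.
Variable R : realType.
Local Notation C := ((R[i] : numFieldType)^o).

Definition closed_rectifiable (g : R -> C) : Prop :=
  [/\ {within `[0, 1], continuous g}, g 0 = g 1,
      bounded_variation 0 1 (fun t => complex.Re (g t))
    & bounded_variation 0 1 (fun t => complex.Im (g t))].

(* The list [:: (t1, x1); ...; (tk, xk)] stands for the partition
   x0 < x1 < ... < xk = 1 of [x0, 1] with tags x_(i-1) <= ti <= xi. *)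
Fixpoint tagged_partition (d x0 : R) (p : seq (R * R)) : Prop :=
  if p is (t, x) :: p' then
    [/\ x0 < x, x - x0 < d, x0 <= t <= x & tagged_partition d x p']
  else x0 = 1.

Definition mesh_to0 : set_system (seq (R * R)) :=
  filter_from [set d : R | 0 < d] (fun d => [set p | tagged_partition d 0 p]).

Variable V : preTopologicalLmodType R[i].

Fixpoint riemann_sum (g : R -> C) (F : C -> V) (x0 : R) (p : seq (R * R)) : V :=
  if p is (t, x) :: p' then
    ((g x - g x0) : R[i]) *: F (g t) + riemann_sum g F x p'
  else 0.

Definition line_integral (g : R -> C) (F : C -> V) : V :=
  xget 0 [set I | riemann_sum g F 0 @ mesh_to0 --> I].

Definition contour_integral (k : nat) (G : 'I_k -> R -> C) (F : C -> V) : V :=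
  \sum_(i < k) line_integral (G i) F.

End ContourIntegral.

Section FunctionalCalculus.
Variable R : realType.
Local Notation C := ((R[i] : numFieldType)^o).

Definition two_pi_i : R[i] := 0 +i* (2 * pi).

Definition winding_number (k : nat) (G : 'I_k -> R -> C) (w : C) : C :=
  two_pi_i^-1 * contour_integral G (fun z : C => (z - w)^-1 : C).

Definition holomorphic (U : set C) (f : C -> C) : Prop :=
  open U /\ forall z, U z -> derivable f z 1.

Definition surrounds_in (U K : set C) (k : nat) (G : 'I_k -> R -> C) : Prop :=
  [/\ forall i, closed_rectifiable (G i),
      forall i t, 0 <= t <= 1 -> (U `\` K) (G i t),
      forall w, K w -> winding_number G w = 1
    & forall w, ~ U w -> winding_number G w = 0].

Definition is_inverse (B : pzRingType) (x y : B) : Prop :=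
  x * y = 1 /\ y * x = 1.

Definition inverse (B : pzRingType) (x : B) : B :=
  xget 0 [set y | is_inverse x y].

Definition spectrum (B : starAlgType R) (a : B) : set C :=
  [set z | ~ exists b, is_inverse ((z : R[i])%:A - a) b].

Definition is_hfc (B : topStarAlgType R) (f : C -> C) (a b : B) : Prop :=
  exists U (k : nat) (G : 'I_k -> R -> C),
    [/\ spectrum a `<=` U, holomorphic U f,
    surrounds_in U (spectrum a) G
  & b = two_pi_i^-1 *: contour_integral G
          (fun z : C => (f z : R[i]) *: inverse ((z : R[i])%:A - a))].

(* f(a), for f holomorphic on a neighbourhood of the spectrum of a; it does not
   depend on the neighbourhood and the cycle by Cauchy's theorem. *)
Definition hfc (B : topStarAlgType R) (f : C -> C) (a : B) : B :=
  xget 0 [set b | is_hfc f a b].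

Definition hfc_closed (B : topStarAlgType R) (S : set B) : Prop :=
  forall a f U, S a -> spectrum a `<=` U -> holomorphic U f -> S (hfc f a).

Definition cexp (z : C) : C :=
  let: x +i* y := z in (expR x * cos y) +i* (expR x * sin y).

(* Principal branch, cut along the nonpositive reals. *)
Definition clog (z : C) : C :=
  let: x +i* y := z in
  let r := Num.sqrt (x ^+ 2 + y ^+ 2) in
  ln r +i* (if 0 <= y then acos (x / r) else - acos (x / r)).

Definition positive (B : starAlgType R) (a : B) : Prop :=
  star a = a /\ spectrum a `<=` [set z | 0 <= (z : R[i])].

End FunctionalCalculus.

Section Determinant.
Variables (R : realType) (A : cstarAlgType R).

Definition unital_star_subalgebra (S : set A) : Prop :=
  [/\ S 1, forall x y, S x -> S y -> S (x + y),
      forall (z : R[i]) x, S x -> S (z *: x),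
      forall x y, S x -> S y -> S (x * y)
    & forall x, S x -> S (star x)].

Definition mx_over (S : set A) (n : nat) : set (cmx A n) :=
  [set a | forall i j, S (a i j)].

Definition GLpos (S : set A) (n : nat) : set (cmx A n.+1) :=
  [set h | [/\ mx_over S h, positive h
             & exists2 k, mx_over S k & is_inverse h k]].

Definition self_compatible (n : nat) (a : cmx A n) : Prop :=
  forall i j k l, a i j * a k l = a k l * a i j.

Definition hfc_det (n : nat) (h : cmx A n.+1) : A :=
  hfc (@cexp R) (\tr (hfc (@clog R) h)).

End Determinant.

(* Main.v *)
Require Import Defs.
From HB Require Import structures.
From mathcomp Require Import all_boot all_order all_algebra all_fingroup.
From mathcomp Require Import all_classical all_reals all_analysis.
From mathcomp Require Import complex ring lra.

(** Idea of the proof.  The entries of [h] commute and, [h] being self-adjoint,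
    they are permuted by the involution of [A], so their bicommutant [S] is a
    commutative algebra closed under the involution, norm limits and inverses.
    Both sides of the formula lie in [S], and an element of [S] killed by all
    characters of [S] vanishes ([cstar_semisimple]).  It is thus enough to
    evaluate both sides at a character [chi].

    Applied to the entries of [h], the character [chi] gives a scalar matrix
    [H] whose determinant is the image of the right-hand side and whose
    eigenvalues [l i] lie in the spectrum of [h], hence are positive.  Being
    bounded, [chi] commutes with the contour integral that defines [log h], so
    that [chi (tr (log h))] is the contour integral of [log z / (2 pi i)] times
    the trace of [(z - H)^-1], which is the sum of the [1 / (z - l i)].
    Cauchy's formula turns it into the sum of the [log (l i)].  In the same way
    [chi (exp t) = exp (chi t)], and [exp] of the sum of the [log (l i)] is the
    product of the [l i], that is [\det H].  This reduction of the functional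
    calculus to scalars is [hfc_image].

    Three bodies of theory carry the argument.

    Line integrals.  Riemann sums of a continuous function with values in a
    Banach space converge along a rectifiable curve ([riemann_sum_cvg]).
    Pointwise estimates are turned into global ones by [real_induction], a form
    of the compactness of the interval; this gives the fundamental theorem of
    calculus along curves ([line_integral_ftc]) without smoothness.

    Cauchy's formula ([cauchy_star]) for the cycles that the functional calculus
    allows, which are arbitrary closed rectifiable curves with prescribed winding
    numbers.  The functions [exp] and [log] extend to a star-shaped domain, and
    contracting their argument towards the pole deforms the Cauchy integral into
    the winding integral.  For [log] one also needs that a domain on which it is
    holomorphic avoids the cut ([holomorphic_clog_slit]).  Explicit circles show
    that the functional calculus is not vacuous ([hfc_exists_log],
    [hfc_exists_exp]).

    Gelfand theory ([exists_character]).  Characters come from maximal ideals.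
    That a quotient by a maximal ideal is one-dimensional, and that a
    self-adjoint element with spectrum 0 vanishes, both follow from
    [powers_decay], which replaces Liouville's theorem by averages of resolvents
    over roots of unity of order a power of 2. *)

Set Implicit Arguments.
Unset Strict Implicit.
Unset Printing Implicit Defensive.

Import Order.TTheory GRing.Theory Num.Theory.
Import numFieldNormedType.Exports.

Local Open Scope classical_set_scope.
Local Open Scope ring_scope.
Local Open Scope complex_scope.

(** * The modulus, the exponential and the principal logarithm *)

Notation nc := Normc.normc.

Section Modulus.
Variable R : realType.
Implicit Types z w : R[i].

Lemma nc_ge0 z : 0 <= nc z.
Proof. by case: z => a b; apply: sqrtr_ge0. Qed.

Lemma nc0 : nc (0 : R[i]) = 0. Proof. exact: Normc.normc0. Qed.

Lemma ncN z : nc (- z) = nc z. Proof. exact: normcN. Qed.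

Lemma ncM z w : nc (z * w) = nc z * nc w. Proof. exact: Normc.normcM. Qed.

Lemma ncV z : nc z^-1 = (nc z)^-1. Proof. exact: Normc.normcV. Qed.

Lemma ncX z n : nc (z ^+ n) = nc z ^+ n.
Proof.
by elim: n => [|n IH]; rewrite ?expr0 ?Normc.normc1 // !exprS ncM IH.
Qed.

Lemma ncD z w : nc (z + w) <= nc z + nc w. Proof. exact: le_normcD. Qed.

Lemma ncB z w : nc (z - w) = nc (w - z). Proof. by rewrite -ncN opprB. Qed.

Lemma nc_tri z w u : nc (z - u) <= nc (z - w) + nc (w - u).
Proof. by rewrite (_ : z - u = (z - w) + (w - u)) ?ncD //; ring. Qed.

Lemma nc_gt0 z : (0 < nc z) = (z != 0).
Proof.
rewrite lt_def nc_ge0 andbT; apply/idP/idP; apply: contra => /eqP.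
  by move=> ->; rewrite nc0.
by move/Normc.eq0_normc => ->.
Qed.

Lemma ncR (x : R) : nc x%:C = `|x|.
Proof. by rewrite /= expr0n addr0 sqrtr_sqr. Qed.

Lemma norm_nc z : `|z| = (nc z)%:C. Proof. by []. Qed.

Lemma complex_ext z w :
  complex.Re z = complex.Re w -> complex.Im z = complex.Im w -> z = w.
Proof. by case: z w => [a b] [c d] /= -> ->. Qed.

Lemma realcD (x y : R) : (x + y)%:C = x%:C + y%:C :> R[i].
Proof. by apply: complex_ext => //=; rewrite addr0. Qed.

Lemma realcM (x y : R) : (x * y)%:C = x%:C * y%:C :> R[i].
Proof. by apply: complex_ext => //=; rewrite !(mulr0, mul0r) ?subr0 ?addr0. Qed.

Lemma realcB (x y : R) : (x - y)%:C = x%:C - y%:C :> R[i].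
Proof. by apply: complex_ext => //=; rewrite subrr. Qed.

Lemma ReD z w : complex.Re (z + w) = complex.Re z + complex.Re w.
Proof. by case: z w => [a b] [c d]. Qed.
Lemma ImD z w : complex.Im (z + w) = complex.Im z + complex.Im w.
Proof. by case: z w => [a b] [c d]. Qed.
Lemma ReN z : complex.Re (- z) = - complex.Re z. Proof. by case: z. Qed.
Lemma ImN z : complex.Im (- z) = - complex.Im z. Proof. by case: z. Qed.

Lemma Re_le_nc z : `|complex.Re z| <= nc z.
Proof. by case: z => a b /=; rewrite -sqrtr_sqr ler_sqrt ?lerDl ?sqr_ge0 ?addr_ge0 ?sqr_ge0. Qed.

Lemma Im_le_nc z : `|complex.Im z| <= nc z.
Proof. by case: z => a b /=; rewrite -sqrtr_sqr ler_sqrt ?lerDr ?sqr_ge0 ?addr_ge0 ?sqr_ge0. Qed.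

Lemma nc_le z : nc z <= `|complex.Re z| + `|complex.Im z|.
Proof.
case: z => a b /=.
rewrite -(ler_pXn2r (_ : 0 < 2)%N) ?nnegrE ?sqrtr_ge0 ?addr_ge0 //.
rewrite sqr_sqrtr ?addr_ge0 ?sqr_ge0 // sqrrD !real_normK ?num_real //.
by rewrite -addrA lerD2l lerDr mulrn_wge0 // mulr_ge0.
Qed.

End Modulus.

Section Exponential.
Variable R : realType.
Implicit Types z w : R[i].

Lemma cexpD z w : cexp (z + w) = cexp z * cexp w :> R[i].
Proof.
by case: z w => [a b] [c d]; apply: complex_ext => /=;
  rewrite expRD ?cosD ?sinD; ring.
Qed.

Lemma cexp0 : cexp 0 = 1 :> R[i].
Proof. by rewrite /cexp /= expR0 cos0 sin0 mulr0 mulr1. Qed.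

Lemma nc_cexp z : nc (cexp z) = expR (complex.Re z).
Proof.
case: z => a b /=; rewrite !exprMn -mulrDr cos2Dsin2 mulr1 sqrtr_sqr.
by rewrite ger0_norm // expR_ge0.
Qed.

Lemma cexp_neq0 z : cexp z != 0 :> R[i].
Proof. by rewrite -nc_gt0 nc_cexp expR_gt0. Qed.

Lemma cexp_sum (I : Type) (s : seq I) (f : I -> R[i]) :
  cexp (\sum_(i <- s) f i) = \prod_(i <- s) (cexp (f i) : R[i]).
Proof. exact: (big_morph (@cexp R : R[i] -> R[i]) cexpD cexp0). Qed.

Lemma sin_le_norm (y : R) : `|sin y| <= `|y|.
Proof.
wlog y0 : y / 0 < y.
  move=> H; case: (ltgtP y 0) => [y0|y0|->]; last by rewrite sin0 normr0.
    by rewrite -[leRHS]normrN -[leLHS]normrN -sinN; apply: H; rewrite oppr_gt0.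
  exact: H.
have [|c _] := @MVT R (@sin R) (@cos R) 0 y y0.
  by apply: continuous_subspaceT => x; apply: continuous_sin.
rewrite sin0 !subr0 => ->.
by rewrite normrM ler_piMl // cos_max.
Qed.

Lemma cos_sub1_le (y : R) : `|cos y - 1| <= y ^+ 2.
Proof.
have -> : cos y - 1 = - (2 * sin (y / 2) ^+ 2).
  rewrite {1}(_ : y = (y / 2) *+ 2); last by rewrite -[RHS]mulr_natr; field.
  by rewrite cos_mulr2n cos2sin2 -mulr_natr; ring.
have H : `|sin (y / 2)| ^+ 2 <= `|y / 2| ^+ 2.
  by rewrite lerXn2r ?nnegrE // sin_le_norm.
rewrite normrN normrM normrX ger0_norm //.
apply: (le_trans (ler_wpM2l _ H)) => //.
rewrite -normrX exprMn ger0_norm; last by rewrite mulr_ge0 ?sqr_ge0.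
have := sqr_ge0 y; lra.
Qed.

Lemma sin_sub_le (y : R) : `|y| <= 1 -> `|sin y - y| <= y ^+ 2.
Proof.
wlog y0 : y / 0 < y.
  move=> H; case: (ltgtP y 0) => [y0|y0|->]; last by rewrite sin0 subrr normr0 sqr_ge0.
    move=> y1; have -> : `|sin y - y| = `|sin (- y) - - y|.
      by rewrite -normrN sinN; congr `|_|; ring.
    by rewrite -sqrrN; apply: H; rewrite ?normrN // oppr_gt0.
  exact: H.
move=> y1.
have [|c] := @MVT R (fun x => sin x - x) (fun x => cos x - 1) 0 y y0.
  apply: continuous_subspaceT => x; apply: cvgB; last exact: cvg_id.
  exact: continuous_sin.
rewrite in_itv /= => /andP[c0 cy].
rewrite sin0 !subr0 => ->.
rewrite normrM (ger0_norm (ltW y0)) expr2 ler_wpM2r ?(ltW y0) //.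
apply: (le_trans (cos_sub1_le _)).
rewrite (ger0_norm (ltW y0)) in y1.
by rewrite expr2; nra.
Qed.

Lemma expR_sub1_le (x : R) : `|x| <= 2^-1 -> `|expR x - 1 - x| <= 2 * x ^+ 2.
Proof.
rewrite ler_norml => /andP[x1 x2].
have H1 := expR_ge1Dx x; have H2 := expR_ge1Dx (- x).
rewrite expRN in H2.
have E := expR_gt0 x.
have H3 : (1 - x) * expR x <= 1.
  by have := ler_wpM2r (ltW E) H2; rewrite mulVf // gt_eqF.
rewrite ger0_norm; last by lra.
have : (1 - x) * (expR x - 1 - x) <= x ^+ 2 by nra.
nra.
Qed.

(** The second-order remainder at 0, from elementary bounds on the real
    exponential, sine and cosine; the constant 10 is far from optimal. *)
Lemma cexp_sub1_le z : nc z <= 2^-1 -> nc (cexp z - 1 - z) <= 10 * nc z ^+ 2.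
Proof.
move=> z1; have a1 := le_trans (Re_le_nc z) z1.
have b1 := le_trans (Im_le_nc z) z1.
have a2 := Re_le_nc z; have b2 := Im_le_nc z.
apply: (le_trans (nc_le _)).
have -> : 10 * nc z ^+ 2 = 5 * nc z ^+ 2 + 5 * nc z ^+ 2 by ring.
case: z => x y /= in z1 a1 b1 a2 b2 *.
set n := Num.sqrt _ in z1 a2 b2 *.
have E1 := expR_sub1_le a1.
have hx : x ^+ 2 <= n ^+ 2.
  by rewrite -[x ^+ 2]real_normK ?num_real // lerXn2r ?nnegrE ?sqrtr_ge0.
have hy : y ^+ 2 <= n ^+ 2.
  by rewrite -[y ^+ 2]real_normK ?num_real // lerXn2r ?nnegrE ?sqrtr_ge0.
have n0 : 0 <= n by apply: sqrtr_ge0.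
have n2 : 0 <= n ^+ 2 by apply: sqr_ge0.
apply: lerD.
- have -> : expR x * cos y - 1 - x
    = (expR x - 1 - x) * cos y + (1 + x) * (cos y - 1) by ring.
  apply: (le_trans (ler_normD _ _)); rewrite !normrM.
  have : `|expR x - 1 - x| * `|cos y| <= 2 * x ^+ 2.
    by apply: (le_trans _ E1); rewrite ler_piMr // cos_max.
  have : `|1 + x| * `|cos y - 1| <= 3 / 2 * y ^+ 2.
    apply: ler_pM => //; last exact: cos_sub1_le.
    by apply: (le_trans (ler_normD _ _)); rewrite normr1; lra.
  by move=> h1 h2; apply: (le_trans (lerD h2 h1)); lra.
have -> : expR x * sin y + - 0 - y = (expR x - 1 - x) * sin y + x * sin y + (sin y - y) by ring.
apply: (le_trans (ler_normD _ _)).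
have s1 : `|sin y - y| <= y ^+ 2 by apply: sin_sub_le; lra.
have s2 := sin_le_norm y.
have t1 : `|(expR x - 1 - x) * sin y| <= 2 * x ^+ 2.
  by rewrite normrM; apply: (le_trans _ E1); rewrite ler_piMr // sin_max.
have t2 : `|x * sin y| <= n ^+ 2.
  rewrite normrM expr2 ler_pM //; exact: le_trans s2 b2.
have t3 := ler_normD ((expR x - 1 - x) * sin y) (x * sin y).
lra.
Qed.

End Exponential.

(** Complex differentiability, with real-valued moduli: the same estimate then
    serves along curves and along real segments. *)
Definition cdiff (R : realType) (f : R[i] -> R[i]) (z d : R[i]) : Prop :=
  forall e : R, 0 < e -> exists2 r : R, 0 < r &
    forall w, nc (w - z) < r -> nc (f w - f z - d * (w - z)) <= e * nc (w - z).

Section Differentiability.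
Variable R : realType.
Implicit Types (f g : R[i] -> R[i]) (z w d : R[i]).

Lemma cdiff_cexp z : cdiff (@cexp R) z (cexp z).
Proof.
move=> e e0.
have K0 : 0 < nc (cexp z) by rewrite nc_gt0 cexp_neq0.
have S0 : 0 < e / (10 * nc (cexp z)) by rewrite divr_gt0 // mulr_gt0.
exists (Num.min 2^-1 (e / (10 * nc (cexp z)))).
  by rewrite lt_min invr_gt0 ltr0n /= S0.
move=> w; rewrite lt_min => /andP[h1 h2].
have -> : cexp w = cexp z * cexp (w - z) :> R[i] by rewrite -cexpD; congr cexp; ring.
have -> : cexp z * cexp (w - z) - cexp z - cexp z * (w - z)
  = cexp z * (cexp (w - z) - 1 - (w - z)) :> R[i] by ring.
rewrite ncM; apply: (le_trans (ler_wpM2l (nc_ge0 _) (cexp_sub1_le (ltW h1)))).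
have n0 := nc_ge0 (w - z).
rewrite ltr_pdivlMr in h2; last by rewrite mulr_gt0.
have := ltW h2; set n := nc _ in n0 *; set k := nc _ in K0 *; nra.
Qed.

Lemma cdiff_continuous f z d : cdiff f z d -> forall e : R, 0 < e ->
  exists2 r : R, 0 < r & forall w, nc (w - z) < r -> nc (f w - f z) < e.
Proof.
move=> /(_ 1 ltr01) [r r0 H] e e0.
have K0 : 0 < 1 + nc d by rewrite ltr_pwDl // nc_ge0.
exists (Num.min r (e / (1 + nc d))); first by rewrite lt_min r0 divr_gt0.
move=> w; rewrite lt_min => /andP[/H h1]; rewrite ltr_pdivlMr // => h2.
have -> : f w - f z = (f w - f z - d * (w - z)) + d * (w - z) by ring.
apply: (le_lt_trans (ncD _ _)); rewrite ncM; move: h1 h2; lra.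
Qed.

Lemma cdiff_comp f g z d d' :
  cdiff g z d -> cdiff f (g z) d' -> cdiff (f \o g) z (d' * d).
Proof.
move=> dg df e e0.
have K0 : 0 < 1 + nc d by rewrite ltr_pwDl // nc_ge0.
have L0 : 0 < 1 + nc d' by rewrite ltr_pwDl // nc_ge0.
have K1 : 0 < e / (2 * (1 + nc d)) by rewrite divr_gt0 // mulr_gt0.
have L1 : 0 < e / (2 * (1 + nc d')) by rewrite divr_gt0 // mulr_gt0.
have [r1 r10 h1] := df _ K1.
have [r2 r20 h2] := cdiff_continuous dg r10.
have [r3 r30 h3] := dg 1 ltr01.
have [r4 r40 h4] := dg _ L1.
exists (Num.min r2 (Num.min r3 r4)); first by rewrite !lt_min r20 r30 r40.
move=> w; rewrite !lt_min => /and3P[/h2/h1 k1 /h3 k2 /h4 k3] /=.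
have -> : f (g w) - f (g z) - d' * d * (w - z) =
  (f (g w) - f (g z) - d' * (g w - g z)) + d' * (g w - g z - d * (w - z)) by ring.
apply: (le_trans (ncD _ _)); rewrite [nc (d' * _)]ncM.
have k4 : nc (g w - g z) <= (1 + nc d) * nc (w - z).
  have -> : g w - g z = (g w - g z - d * (w - z)) + d * (w - z) by ring.
  by apply: (le_trans (ncD _ _)); rewrite ncM mulrDl lerD2r.
have k5 : e / (2 * (1 + nc d)) * nc (g w - g z) <= e / 2 * nc (w - z).
  apply: (le_trans (ler_wpM2l _ k4)).
    by rewrite ltW // divr_gt0 // mulr_gt0.
  by rewrite le_eqVlt; apply/orP; left; apply/eqP; field; lra.
have k6 : nc d' * nc (g w - g z - d * (w - z)) <= e / 2 * nc (w - z).
  apply: (le_trans (ler_wpM2l (nc_ge0 _) k3)).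
  have -> : e / 2 * nc (w - z) = (1 + nc d') * (e / (2 * (1 + nc d')) * nc (w - z)).
    by field; lra.
  apply: ler_wpM2r; last by lra.
  by rewrite mulr_ge0 ?nc_ge0 // ltW // divr_gt0 // mulr_gt0.
apply: (le_trans (lerD k1 k6)); apply: (le_trans (lerD k5 (lexx _))).
by rewrite -mulrDl -splitr.
Qed.

Lemma cdiff_affine a b z : cdiff (fun w => a * w + b) z a.
Proof.
move=> e e0; exists 1 => // w _.
rewrite (_ : _ - _ - _ = 0); last by ring.
by rewrite nc0 mulr_ge0 ?nc_ge0 // ltW.
Qed.

Lemma cdiffD f g z d d' : cdiff f z d -> cdiff g z d' ->
  cdiff (fun w => f w + g w) z (d + d').
Proof.
move=> df dg e e0; have e2 : 0 < e / 2 by rewrite divr_gt0.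
have [r r0 h] := df _ e2; have [s s0 k] := dg _ e2.
exists (Num.min r s); first by rewrite lt_min r0.
move=> w; rewrite lt_min => /andP[/h h1 /k k1].
have -> : f w + g w - (f z + g z) - (d + d') * (w - z) =
  (f w - f z - d * (w - z)) + (g w - g z - d' * (w - z)) by ring.
by apply: (le_trans (ncD _ _)); lra.
Qed.

Lemma cdiffZ f c z d : cdiff f z d -> cdiff (fun w => c * f w) z (c * d).
Proof. move=> df; have := cdiff_comp df (cdiff_affine c 0 (f z)).
by move=> h e /h [r r0 k]; exists r => // w /k /=; rewrite !addr0. Qed.

Lemma cdiff_inv z : z != 0 -> cdiff (fun w => w^-1) z (- z^-2).
Proof.
move=> z0 e e0; have n0 : 0 < nc z by rewrite nc_gt0.
exists (Num.min (nc z / 2) (e * nc z ^+ 3 / 2)).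
  by rewrite lt_min !divr_gt0 // mulr_gt0 // exprn_gt0.
move=> w; rewrite lt_min => /andP[h1 h2].
have h3 : nc z <= nc w + nc (w - z).
  by have := ncD w (z - w); rewrite [in X in X -> _]addrC subrK (ncB z w).
have w0 : w != 0 by rewrite -nc_gt0; lra.
have -> : w^-1 - z^-1 - - z^-2 * (w - z) = (w - z) ^+ 2 / (w * z ^+ 2).
  by field; rewrite z0 w0.
rewrite ncM ncV (ncX (w - z)) (ncM w) (ncX z) expr2 mulrAC.
rewrite ler_wpM2r ?nc_ge0 // ler_pdivrMr; last first.
  by rewrite mulr_gt0 ?exprn_gt0 // nc_gt0.
apply: (le_trans (ltW h2)).
have -> : e * (nc w * nc z ^+ 2) = e * nc z ^+ 2 * nc w by ring.
have -> : e * nc z ^+ 3 / 2 = e * nc z ^+ 2 * (nc z / 2) by ring.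
by rewrite ler_wpM2l //; [rewrite ltW // mulr_gt0 // exprn_gt0 | lra].
Qed.

Lemma cdiff_shift w z : cdiff (fun x : R[i] => x - w) z 1.
Proof.
by move=> e /(cdiff_affine 1 (- w) z) [s s0 k]; exists s => // x /k; rewrite !mul1r.
Qed.

Lemma cdiff_inv_shift w z : z - w != 0 ->
  cdiff (fun x : R[i] => (x - w)^-1) z (- (z - w)^-2).
Proof. by move=> zw; have := cdiff_comp (cdiff_shift w z) (cdiff_inv zw); rewrite mulr1. Qed.

End Differentiability.

Section Logarithm.
Variable R : realType.
Implicit Types z w : R[i].

(** The domain of the principal logarithm. *)
Definition slit z : Prop := ~ (complex.Re z <= 0 /\ complex.Im z = 0).

Lemma slit_neq0 z : slit z -> z != 0.
Proof. by move=> sz; apply/eqP => z0; apply: sz; rewrite z0. Qed.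

Lemma slit_Re z : 0 < complex.Re z -> slit z.
Proof. by move=> h [h1 _]; move: (lt_le_trans h h1); rewrite ltxx. Qed.

Lemma clogK z : z != 0 -> cexp (clog z) = z.
Proof.
case: z => x y; rewrite -nc_gt0 /= => r0; set r := Num.sqrt _ in r0 *.
have r2 : r ^+ 2 = x ^+ 2 + y ^+ 2 by rewrite sqr_sqrtr // addr_ge0 ?sqr_ge0.
have xr : -1 <= x / r <= 1.
  rewrite -ler_norml normrM normfV (gtr0_norm r0) ler_pdivrMr // mul1r.
  exact: (Re_le_nc (x +i* y)).
have sq : Num.sqrt (1 - (x / r) ^+ 2) = `|y| / r.
  have -> : 1 - (x / r) ^+ 2 = (y / r) ^+ 2.
    have y2 : y ^+ 2 = r ^+ 2 - x ^+ 2 by lra.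
    by rewrite !exprMn exprVn y2; field; lra.
  by rewrite sqrtr_sqr normrM normfV (gtr0_norm r0).
have E : expR (ln r) = r by rewrite lnK // posrE.
apply: complex_ext => /=; rewrite E; case: ifP => y0.
- by rewrite acosK ?in_itv //; field; lra.
- by rewrite cosN acosK ?in_itv //; field; lra.
- by rewrite sin_acos // sq ger0_norm //; field; lra.
rewrite sinN sin_acos // sq ltr0_norm; last by rewrite ltNge y0.
by field; lra.
Qed.

Lemma slit_denom_gt0 z : slit z -> 0 < nc z + complex.Re z.
Proof.
move=> sz; have := Re_le_nc z; rewrite ler_norml => /andP[h1 _].
rewrite lt_def; apply/andP; split; last by lra.
apply/eqP => h; apply: sz.
have h2 : nc z = - complex.Re z by lra.
have n0 := nc_ge0 z; split; first by lra.
case: z h1 h h2 n0 => x y /= h1 h h2 n0.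
have : Num.sqrt (x ^+ 2 + y ^+ 2) ^+ 2 = x ^+ 2 by rewrite h2 sqrrN.
rewrite sqr_sqrtr ?addr_ge0 ?sqr_ge0 // => E.
by apply/eqP; rewrite -sqrf_eq0; apply/eqP; lra.
Qed.

(** The half-angle formula for the argument: unlike [acos], it needs no case
    distinction on the sign of the imaginary part. *)
Lemma clog_atan z : slit z -> clog z =
  ln (nc z) +i* (2 * atan (complex.Im z / (nc z + complex.Re z))).
Proof.
move=> sz; have d0 := slit_denom_gt0 sz.
have := slit_neq0 sz; rewrite -nc_gt0.
case: z {sz} d0 => x y /=; set r := Num.sqrt _ => d0 r0.
have r2 : r ^+ 2 = x ^+ 2 + y ^+ 2 by rewrite sqr_sqrtr // addr_ge0 ?sqr_ge0.
congr (_ +i* _).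
set u := y / (r + x); set t := 2 * atan u.
have p0 := pi_gt0 R.
have [t1 t2] : - pi < t /\ t < pi.
  by have := atan_gtNpi2 u; have := atan_ltpi2 u; rewrite /t; split; lra.
have ct : cos t = x / r.
  rewrite /t mulrC -[2]/(2%:R) mulr_natr cos_mulr2n cos_atan.
  rewrite exprVn sqr_sqrtr; last by rewrite addr_ge0 ?sqr_ge0.
  have y2 : y ^+ 2 = r ^+ 2 - x ^+ 2 by lra.
  have -> : 1 + u ^+ 2 = (2 * r) / (r + x).
    by rewrite /u exprMn exprVn y2; field; lra.
  by rewrite -mulr_natr; field; lra.
case: ifP => y0.
  have u0 : 0 <= u by rewrite divr_ge0 // ltW.
  have t0 : 0 <= t by rewrite mulr_ge0 // -atan0 le_atan.
  by rewrite -ct cosK // in_itv /= t0 ltW.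
have u0 : u <= 0.
  rewrite /u -[_ / _]opprK oppr_le0 -mulNr divr_ge0 ?(ltW d0) //.
  by rewrite oppr_ge0 ltW // ltNge y0.
have t0 : t <= 0 by rewrite mulr_ge0_le0 // -atan0 le_atan.
by rewrite -ct cosKN ?opprK // t0 ltW.
Qed.

(** Continuity in the two real coordinates, from [clog_atan]. *)
Lemma clog_continuous z : slit z -> forall e : R, 0 < e ->
  exists2 r : R, 0 < r &
    forall w, nc (w - z) < r -> slit w /\ nc (clog w - clog z) < e.
Proof.
move=> sz e e0; have d0 := slit_denom_gt0 sz.
have n0 : 0 < nc z by rewrite nc_gt0 slit_neq0.
pose N (p : R * R) : R := Num.sqrt (p.1 * p.1 + p.2 * p.2).
pose p0 := (complex.Re z, complex.Im z).
have zE : z = p0.1 +i* p0.2 by rewrite /p0; case: (z).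
have cN : N @ p0 --> N p0.
  apply: continuous_comp; last exact: sqrt_continuous.
  by apply: cvgD; apply: cvgM; (exact: cvg_fst || exact: cvg_snd).
have NE : N p0 = nc z by rewrite zE /= !expr2.
have cL : (fun p => ln (N p)) @ p0 --> ln (N p0).
  by apply: (continuous_comp cN); apply: continuous_ln; rewrite NE.
have cD : (fun p => N p + p.1) @ p0 --> N p0 + p0.1.
  by apply: cvgD => //; exact: cvg_fst.
have cU : (fun p => p.2 / (N p + p.1)) @ p0 --> p0.2 / (N p0 + p0.1).
  apply: cvgM; first exact: cvg_snd.
  by apply: cvgV => //; rewrite NE gt_eqF.
have cA : (fun p => 2 * atan (p.2 / (N p + p.1))) @ p0
    --> 2 * atan (p0.2 / (N p0 + p0.1)).
  apply: cvgM; first exact: cvg_cst.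
  by apply: (continuous_comp cU); exact: continuous_atan.
have e2 : 0 < e / 2 by rewrite divr_gt0.
have h1 : \forall p \near p0, `|ln (N p0) - ln (N p)| < e / 2.
  by move/cvgr_dist_lt: cL; apply.
have h2 : \forall p \near p0, `|2 * atan (p0.2 / (N p0 + p0.1)) - 2 * atan (p.2 / (N p + p.1))| < e / 2.
  by move/cvgr_dist_lt: cA; apply.
have h3 : \forall p \near p0, 0 < N p + p.1.
  by apply: (cvgr_gt _ cD); rewrite NE.
have /nbhs_ballP [r /= r0 H] : nbhs p0 [set p | [/\
   `|ln (N p0) - ln (N p)| < e / 2,
   `|2 * atan (p0.2 / (N p0 + p0.1)) - 2 * atan (p.2 / (N p + p.1))| < e / 2
   & 0 < N p + p.1]].
  by near=> p; split; near: p.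
exists r => // w wz.
have [|k1 k2 k3] := H (complex.Re w, complex.Im w).
  split; rewrite /ball /=; (apply: le_lt_trans wz; rewrite ncB).
    by rewrite -ReN -ReD Re_le_nc.
  by rewrite -ImN -ImD Im_le_nc.
have wE : N (complex.Re w, complex.Im w) = nc w by case: (w) => x y; rewrite /N /= !expr2.
rewrite wE in k1 k2 k3; rewrite NE in k1 k2.
have sw : slit w.
  move=> [w1 w2]; move: k3 => /=; suff -> : nc w = - complex.Re w by rewrite addNr ltxx.
  case: (w) w1 w2 => x y /= x0 ->; rewrite expr0n addr0 sqrtr_sqr ler0_norm //.
split => //.
rewrite (clog_atan sw) (clog_atan sz).
apply: le_lt_trans (nc_le _) _ => /=.
rewrite distrC in k1; rewrite distrC in k2; move: k1 k2 => /=; lra.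
Unshelve. all: by end_near. Qed.

(** The derivative of an inverse function: [cexp] is differentiable with
    nonzero derivative at [clog z], and [clog] is continuous at [z]. *)
Lemma cdiff_clog z : slit z -> cdiff (@clog R) z z^-1.
Proof.
move=> sz e e0; have z0 := slit_neq0 sz.
have n0 : 0 < nc z by rewrite nc_gt0.
have a0 : 0 < nc z / 2 by rewrite divr_gt0.
have b0 : 0 < e * nc z ^+ 2 / 2 by rewrite divr_gt0 // mulr_gt0 ?exprn_gt0.
have m0 : 0 < Num.min (nc z / 2) (e * nc z ^+ 2 / 2) by rewrite lt_min a0.
have [r r0 H] := cdiff_cexp (clog z) m0.
have [s s0 K] := clog_continuous sz r0.
exists s => // w /K [sw /H]; rewrite !clogK ?slit_neq0 //.
set l := clog w - clog z => h.
have h1 : nc (w - z - z * l) <= nc z / 2 * nc l.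
  by apply: (le_trans h); rewrite ler_wpM2r ?nc_ge0 // ge_min lexx.
have h2 : nc (w - z - z * l) <= e * nc z ^+ 2 / 2 * nc l.
  by apply: (le_trans h); rewrite ler_wpM2r ?nc_ge0 // ge_min lexx orbT.
have h3 : nc z * nc l <= 2 * nc (w - z).
  have : nc (z * l) <= nc (w - z) + nc (w - z - z * l).
    rewrite (ncB (w - z) (z * l)); apply: le_trans (ncD _ _).
    by rewrite [X in _ <= nc X](_ : _ = z * l) //; ring.
  by rewrite ncM; lra.
have -> : clog w - clog z - z^-1 * (w - z) = - z^-1 * (w - z - z * l).
  by rewrite /l; field.
rewrite ncM ncN ncV ler_pdivrMl //; apply: (le_trans h2).
have -> : e * nc z ^+ 2 / 2 * nc l = (e * nc z / 2) * (nc z * nc l) by ring.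
have -> : nc z * (e * nc (w - z)) = (e * nc z / 2) * (2 * nc (w - z)) by field.
by rewrite ler_wpM2l // ltW // divr_gt0 // mulr_gt0.
Qed.

End Logarithm.

(** * Real induction and fine partitions *)

(** Induction along [0, 1] from right to left: the compactness of the interval,
    used for uniform continuity and for Cousin's lemma on gauges. *)
Lemma real_induction (R : realType) (P : R -> Prop) :
  (forall t, 0 <= t <= 1 -> exists2 r : R, 0 < r & forall x y,
     0 <= x -> x <= t -> t <= y -> y <= 1 -> t - r < x -> y < t + r ->
     P y -> P x) ->
  P 1 -> P 0.
Proof.
move=> H P1; pose S := [set x | 0 <= x <= 1 /\ P x].
have S1 : S 1 by split; rewrite ?lexx ?ler01.
have Slb : has_lbound S by exists 0 => x [/andP[]].
have Sinf : has_inf S by split => //; exists 1.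
pose s := inf S.
have s0 : 0 <= s by apply: lb_le_inf; [exists 1 | move=> x [/andP[]]].
have s1 : s <= 1 by apply: ge_inf.
have [|r r0 K] := H s; first by rewrite s0 s1.
have [y [/andP[y0 y1] Py] ys] := inf_adherent r0 Sinf.
have sy : s <= y by apply: ge_inf => //; split => //; rewrite y0 y1.
have step x : 0 <= x -> x <= s -> s - r < x -> P x.
  by move=> x0 xs xr; exact: (K x y).
have [s00|sn0] := eqVneq s 0; first by apply: step; rewrite ?s00 //; lra.
have sp : 0 < s by rewrite lt_def sn0.
pose x := Num.max 0 (s - r / 2).
have x0 : 0 <= x by rewrite le_max lexx.
have xs : x < s by rewrite gt_max sp /=; lra.
have xr : s - r < x by rewrite lt_max; apply/orP; right; lra.
have : s <= x.
  apply: ge_inf => //; split; last by apply: step => //; exact: ltW.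
  by rewrite x0 (le_trans (ltW xs)).
by rewrite leNgt xs.
Qed.

(** * Norms and Riemann sums *)

(** A complete norm that defines the topology.  Both the C*-norm of an algebra
    and the sum of the norms of the entries of a matrix are of this kind. *)
Record banach_norm (R : realType) (V : preTopologicalLmodType R[i])
    (N : V -> R) : Prop := BanachNorm {
  bn_eq0 : forall x, N x = 0 -> x = 0;
  bnD : forall x y, N (x + y) <= N x + N y;
  bnZ : forall (z : R[i]) x, N (z *: x) = nc z * N x;
  bn_nbhs : forall x, nbhs x =
    filter_from [set e : R | 0 < e] (fun e => [set y | N (x - y) < e]);
  bn_complete : forall u : nat -> V,
    (forall e : R, 0 < e -> exists M : nat, forall p q : nat,
       (M <= p)%N -> (M <= q)%N -> N (u p - u q) < e) ->
    exists l : V, u @ \oo --> l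
}.

Section NormTheory.
Variables (R : realType) (V : preTopologicalLmodType R[i]) (N : V -> R).
Hypothesis BN : banach_norm N.
Implicit Types x y : V.

Lemma bn0 : N 0 = 0.
Proof. by have := bnZ BN 0 0; rewrite scale0r nc0 mul0r. Qed.

Lemma bnN x : N (- x) = N x.
Proof. by rewrite -scaleN1r (bnZ BN) ncN Normc.normc1 mul1r. Qed.

Lemma bn_ge0 x : 0 <= N x.
Proof.
have := bnD BN x (- x); rewrite subrr bn0 bnN => h.
by rewrite -(pmulrn_lge0 _ (ltn0Sn 1)) mulr2n.
Qed.

Lemma bnB x y : N (x - y) = N (y - x).
Proof. by rewrite -bnN opprB. Qed.

Lemma bn_tri x y z : N (x - z) <= N (x - y) + N (y - z).
Proof. by rewrite (_ : x - z = (x - y) + (y - z)) ?(bnD BN) // subrKA. Qed.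

Lemma bn_sub_le x y : N x <= N y + N (x - y).
Proof. by have := bnD BN y (x - y); rewrite addrC subrK addrC. Qed.

Lemma bn_sum (I : Type) (s : seq I) (F : I -> V) :
  N (\sum_(i <- s) F i) <= \sum_(i <- s) N (F i).
Proof.
elim: s => [|i s IH]; first by rewrite !big_nil bn0.
by rewrite !big_cons (le_trans (bnD BN _ _)) // lerD2l.
Qed.

Lemma bn_cvgP (T : Type) (F : set_system T) (FF : Filter F) (f : T -> V) (l : V) :
  f @ F --> l <-> forall e : R, 0 < e -> \forall t \near F, N (l - f t) < e.
Proof.
split=> [h e e0|h A].
  by apply: (h [set y | N (l - y) < e]); rewrite (bn_nbhs BN); exists e.
rewrite (bn_nbhs BN) => -[e /= e0 eA].
by apply: filterS (h e e0) => t /eA.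
Qed.

Lemma bn_unique (T : Type) (F : set_system T) (FF : ProperFilter F)
  (f : T -> V) (l l' : V) : f @ F --> l -> f @ F --> l' -> l = l'.
Proof.
move=> /bn_cvgP h /bn_cvgP h'; apply/eqP; rewrite -subr_eq0; apply/eqP.
apply: (bn_eq0 BN); apply/eqP; rewrite eq_le bn_ge0 andbT.
apply/ler_addgt0Pr => e e0; rewrite add0r.
have e2 : 0 < e / 2 by rewrite divr_gt0.
have [t [h1 h2]] := filter_ex (filterI (h _ e2) (h' _ e2)).
by have := bn_tri l (f t) l'; move: h1 h2; rewrite (bnB (f t)) /=; lra.
Qed.

End NormTheory.

Section RiemannSums.
Variables (R : realType) (V : preTopologicalLmodType R[i]) (N : V -> R).
Hypothesis BN : banach_norm N.
Local Notation C := ((R[i] : numFieldType)^o).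
Implicit Types (g : R -> C) (F : C -> V) (v : R -> R) (p q : seq (R * R)).

(** For a rectifiable curve, [v t] is the variation of [g] over [0, t]. *)
Definition dominated g v := forall x y : R, 0 <= x -> x <= y -> y <= 1 ->
  nc (g y - g x : R[i]) <= v y - v x.

Definition continuous01 (K : R -> V) := forall t e : R, 0 <= t <= 1 -> 0 < e ->
  exists2 r : R, 0 < r & forall s, 0 <= s <= 1 -> `|s - t| < r -> N (K s - K t) < e.

Lemma uniform_continuous01 K : continuous01 K -> forall e : R, 0 < e ->
  exists2 d : R, 0 < d & forall s t, 0 <= s <= 1 -> 0 <= t <= 1 ->
    `|s - t| < d -> N (K s - K t) <= e.
Proof.
move=> cK e e0.
pose P x := exists2 d : R, 0 < d & forall s t, x <= s -> s <= t -> t <= 1 ->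
  t - s < d -> N (K s - K t) <= e.
have [||d d0 H] := @real_induction R P; first last.
- exists d => // s t /andP[s0 s1] /andP[t0 t1].
  rewrite ltr_norml => /andP[h1 h2].
  case: (leP s t) => st; first by apply: H => //; lra.
  by rewrite (bnB BN); apply: H; [| exact: ltW | |]; lra.
- exists 1 => // s t s1 st t1 _.
  have -> : s = t by apply/eqP; rewrite eq_le st (le_trans t1).
  by rewrite subrr (bn0 BN) ltW.
move=> t0 t01; have e2 : 0 < e / 2 by rewrite divr_gt0.
have [r r0 H] := cK t0 (e / 2) t01 e2.
exists r => // x y x0 xt ty y1 xr yr [d d0 Hy].
exists (Num.min d (t0 + r - y)); first by rewrite lt_min d0 /=; lra.
move=> s t xs st t1; rewrite lt_min => /andP[h1 h2].
have [ys|sy] := leP y s; first exact: Hy.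
have Hs : N (K s - K t0) < e / 2.
  apply: H; first by apply/andP; split; lra.
  by rewrite ltr_norml; apply/andP; split; lra.
have Ht : N (K t - K t0) < e / 2.
  apply: H; first by apply/andP; split; lra.
  by rewrite ltr_norml; apply/andP; split; lra.
by have := bn_tri BN (K s) (K t0) (K t); rewrite (bnB BN (K t0)); lra.
Qed.

Lemma tagged_partition_le1 d x p : tagged_partition d x p -> x <= 1.
Proof.
elim: p x => [|[t y] p IH] x /=; first by move=> ->.
by move=> [xy _ _ /IH]; apply: le_trans; exact: ltW.
Qed.

Lemma tagged_partition_mesh d d' x p : d <= d' ->
  tagged_partition d x p -> tagged_partition d' x p.
Proof.
move=> dd; elim: p x => [|[t y] p IH] x //=.
by move=> [xy h ht /IH h']; split => //; exact: lt_le_trans h dd.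
Qed.

(** Partitions whose tags may lie outside of their interval, but not far.
    Unlike tagged partitions these may be refined without moving the tags. *)
Fixpoint near_partition (d x0 : R) p : Prop :=
  if p is (t, x) :: p' then
    [/\ x0 < x, t - d < x0, x < t + d, 0 <= t <= 1 & near_partition d x p']
  else x0 = 1.

Lemma near_partition_le1 d x p : near_partition d x p -> x <= 1.
Proof.
elim: p x => [|[t y] p IH] x /=; first by move=> ->.
by move=> [xy _ _ _ /IH]; apply: le_trans; exact: ltW.
Qed.

Lemma tagged_near_partition d x p : 0 <= x ->
  tagged_partition d x p -> near_partition d x p.
Proof.
elim: p x => [|[t y] p IH] x //= x0 [xy h /andP[ht1 ht2] h'].
have y1 := tagged_partition_le1 h'.
split; [done | lra | lra | by apply/andP; split; lra | ].
by apply: IH => //; lra.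
Qed.

(** Cutting the first interval of the coarser partition at the end of the
    first interval of the other one compares the two sums term by term. *)
Lemma riemann_sum_compare g F v (d e : R) : dominated g v ->
  (forall s t, 0 <= s <= 1 -> 0 <= t <= 1 -> `|s - t| < 2 * d ->
     N (F (g s) - F (g t)) <= e) ->
  forall x p q, 0 <= x -> near_partition d x p -> near_partition d x q ->
  N (riemann_sum g F x p - riemann_sum g F x q) <= e * (v 1 - v x).
Proof.
move=> gv HF.
have close x y t s : x < y -> t - d < x -> y < t + d -> 0 <= t <= 1 ->
    s - d < x -> y < s + d -> 0 <= s <= 1 -> 0 <= x -> y <= 1 ->
    N ((g y - g x : R[i]) *: F (g t) - (g y - g x : R[i]) *: F (g s))
      <= e * (v y - v x).
  move=> xy t1 t2 t01 s1 s2 s01 x0 y1.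
  rewrite -scalerBr (bnZ BN) mulrC ler_pM ?nc_ge0 ?(bn_ge0 BN) //.
    by apply: HF => //; rewrite ltr_norml; apply/andP; split; lra.
  by apply: gv => //; exact: ltW.
move=> x p q; move: {2}(size p + size q)%N (leqnn (size p + size q)) => n.
elim: n x p q => [|n IH] x [|[t y] p] [|[s z] q] //=.
- by move=> _ _ -> _; rewrite !subrr (bn0 BN) mulr0.
- by move=> _ _ -> _; rewrite !subrr (bn0 BN) mulr0.
- move=> _ _ -> [h _ _ _ h']; have := near_partition_le1 h'.
  by move=> /(lt_le_trans h); rewrite ltxx.
- move=> _ _ [h _ _ _ h'] x1; have := near_partition_le1 h'.
  by move: h; rewrite x1 => h /(lt_le_trans h); rewrite ltxx.
rewrite addSn addnS ltnS => sz x0 [xy t1 t2 t01 Hp] [xz s1 s2 s01 Hq].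
have y1 := near_partition_le1 Hp; have z1 := near_partition_le1 Hq.
case: (ltgtP y z) => yz; last 1 first.
- subst z; rewrite opprD addrACA.
  apply: (le_trans (bnD BN _ _)).
  have := IH y p q _ _ Hp Hq; have := close x y t s xy t1 t2 t01 s1 s2 s01 x0 y1.
  move=> h1 h2; rewrite (_ : v 1 - v x = (v y - v x) + (v 1 - v y)); last by ring.
  rewrite mulrDr; apply: lerD => //; apply: h2; last by lra.
  by rewrite ltnW.
- have -> : (g z - g x : R[i]) *: F (g s) + riemann_sum g F z q =
      (g y - g x : R[i]) *: F (g s) + riemann_sum g F y ((s, z) :: q).
    by rewrite /= addrA -scalerDl; congr (_ *: _ + _); rewrite [RHS]addrC subrKA.
  rewrite opprD addrACA; apply: (le_trans (bnD BN _ _)).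
  have h1 : N ((g y - g x : R[i]) *: F (g t) - (g y - g x : R[i]) *: F (g s))
      <= e * (v y - v x) by apply: close => //; lra.
  have h2 : N (riemann_sum g F y p - riemann_sum g F y ((s, z) :: q)) <= e * (v 1 - v y).
    apply: IH => //=; [by rewrite addnS | lra |].
    by split => //; lra.
  rewrite (_ : v 1 - v x = (v y - v x) + (v 1 - v y)); last by ring.
  by rewrite mulrDr; exact: lerD.
have -> : (g y - g x : R[i]) *: F (g t) + riemann_sum g F y p =
    (g z - g x : R[i]) *: F (g t) + riemann_sum g F z ((t, y) :: p).
  by rewrite /= addrA -scalerDl; congr (_ *: _ + _); rewrite [RHS]addrC subrKA.
rewrite opprD addrACA; apply: (le_trans (bnD BN _ _)).
have h1 : N ((g z - g x : R[i]) *: F (g t) - (g z - g x : R[i]) *: F (g s))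
    <= e * (v z - v x) by apply: close => //; lra.
have h2 : N (riemann_sum g F z ((t, y) :: p) - riemann_sum g F z q) <= e * (v 1 - v z).
  apply: IH => //=; first by lra.
  by split => //; lra.
rewrite (_ : v 1 - v x = (v z - v x) + (v 1 - v z)); last by ring.
by rewrite mulrDr; exact: lerD.
Qed.

(** Cousin's lemma: the radius [r] depends on [t], and real induction still
    produces a partition each of whose intervals is governed by its own tag.
    Summing the estimates compares the increment of [H] with a Riemann sum. *)
Lemma fine_partition g F v (H : R -> V) (e d : R) :
  dominated g v -> 0 < e -> 0 < d ->
  (forall t, 0 <= t <= 1 -> exists2 r : R, 0 < r & forall x y,
     0 <= x -> x <= t -> t <= y -> y <= 1 -> t - r < x -> y < t + r ->
     N (H y - H x - (g y - g x : R[i]) *: F (g t)) <= e * (v y - v x)) ->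
  exists2 p, tagged_partition d 0 p &
    N (H 1 - H 0 - riemann_sum g F 0 p) <= e * (v 1 - v 0).
Proof.
move=> gv e0 d0 HH.
pose P x := exists2 p, tagged_partition d x p &
    N (H 1 - H x - riemann_sum g F x p) <= e * (v 1 - v x).
apply: (@real_induction R P); last first.
  by exists [::] => //=; rewrite !subrr (bn0 BN) mulr0.
move=> t t01; have [r r0 Hr] := HH t t01.
exists (Num.min r (d / 2)); first by rewrite lt_min r0 divr_gt0.
move=> x y x0 xt ty y1 xr yr [p Hp1 Hp2].
move: xr; rewrite ltrBlDl -ltrBlDr lt_min => /andP[xr1 xr2].
move: yr; rewrite -ltrBlDl lt_min => /andP[yr1 yr2].
have [xy|yx] := ltP x y; last first.
  have -> : x = y by apply/eqP; rewrite eq_le yx (le_trans xt ty).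
  by exists p.
exists ((t, y) :: p) => /=.
  by split => //; [lra | rewrite xt ty].
have -> : H 1 - H x - ((g y - g x : R[i]) *: F (g t) + riemann_sum g F y p) =
  (H y - H x - (g y - g x : R[i]) *: F (g t)) + (H 1 - H y - riemann_sum g F y p).
  by rewrite [RHS]addrACA -opprD; congr (_ - _); rewrite [RHS]addrC subrKA.
apply: (le_trans (bnD BN _ _)).
rewrite (_ : v 1 - v x = (v y - v x) + (v 1 - v y)); last by ring.
by rewrite mulrDr; apply: lerD => //; apply: Hr => //; lra.
Qed.

Lemma dominated_mono g v x y : dominated g v -> 0 <= x -> x <= y -> y <= 1 -> v x <= v y.
Proof.
move=> gv x0 xy y1; rewrite -subr_ge0; exact: le_trans (nc_ge0 _) (gv _ _ x0 xy y1).
Qed.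

Lemma fine_tagged_partition (d : R) : 0 < d -> exists p, tagged_partition d 0 p.
Proof.
move=> d0.
have [||p Hp _] := @fine_partition (fun=> 0) (fun=> 0) id (fun=> 0) 1 d _ ltr01 d0.
- by move=> x y _ xy _; rewrite subrr nc0 subr_ge0.
- move=> t _; exists 1 => // x y x0 xt ty _ _ _.
  by rewrite !subrr scaler0 subr0 (bn0 BN) mul1r subr_ge0; exact: le_trans ty.
by exists p.
Qed.

End RiemannSums.

Lemma real_cauchy (R : realType) (u : nat -> R) :
  (forall e : R, 0 < e -> exists M : nat, forall p q : nat,
     (M <= p)%N -> (M <= q)%N -> `|u p - u q| < e) -> cvgn u.
Proof.
move=> H; apply/cauchy_cvgP/cauchy_exP => e e0; have [M HM] := H e e0.
exists (u M); exists M => // n /= Mn; exact: HM.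
Qed.

Lemma complex_banach (R : realType) :
  @banach_norm R ((R[i] : numFieldType)^o) (@Normc.normc R).
Proof.
split.
- by move=> x /Normc.eq0_normc.
- by move=> x y; exact: ncD.
- by move=> z x; exact: ncM.
- move=> x; apply/seteqP; split => P.
    move=> /nbhs_ballP [[e e'] /=]; rewrite ltcE /= => /andP[/eqP -> e0] H.
    exists e => //= y h; apply: H; rewrite /ball /= norm_nc ltcR //.
  move=> [e /= e0 H]; apply/nbhs_ballP; exists e%:C => /=; first by rewrite ltcR.
  by move=> y; rewrite /ball /= norm_nc ltcR => /H.
move=> u H.
have cR : cvgn (fun n => complex.Re (u n)).
  apply: real_cauchy => e /H [M HM]; exists M => p q Mp Mq.
  by apply: le_lt_trans (HM p q Mp Mq); rewrite -ReN -ReD Re_le_nc.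
have cI : cvgn (fun n => complex.Im (u n)).
  apply: real_cauchy => e /H [M HM]; exists M => p q Mp Mq.
  by apply: le_lt_trans (HM p q Mp Mq); rewrite -ImN -ImD Im_le_nc.
set a := lim _ in cR; set b := lim _ in cI.
exists (a +i* b) => P /nbhs_ballP [[e e'] /=]; rewrite ltcE /= => /andP[/eqP -> e0] HP.
have e2 : 0 < e / 2 by rewrite divr_gt0.
have h1 : \forall n \near \oo, `|a - complex.Re (u n)| < e / 2.
  by move/cvgr_dist_lt: cR; apply.
have h2 : \forall n \near \oo, `|b - complex.Im (u n)| < e / 2.
  by move/cvgr_dist_lt: cI; apply.
suff : \forall n \near \oo, P (u n) by [].
near=> n; apply: HP; rewrite /ball /= norm_nc ltcR.
have k1 : `|a - complex.Re (u n)| < e / 2 by near: n.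
have k2 : `|b - complex.Im (u n)| < e / 2 by near: n.
apply: le_lt_trans (nc_le _) _; rewrite ReD ReN ImD ImN /=; lra.
Unshelve. all: by end_near. Qed.

#[global] Instance mesh_to0_proper (R : realType) : ProperFilter (@mesh_to0 R).
Proof.
apply: filter_from_proper; last first.
  move=> d /= d0; exact: (fine_tagged_partition (complex_banach R) d0).
apply: filter_from_filter; first by exists 1 => /=.
move=> d d' /= d0 d0'; exists (Num.min d d') => /=; first by rewrite lt_min d0.
move=> p Hp; split; apply: tagged_partition_mesh Hp; rewrite ge_min lexx ?orbT //.
Qed.

Section LineIntegral.
Variables (R : realType) (V : preTopologicalLmodType R[i]) (N : V -> R).
Hypothesis BN : banach_norm N.
Local Notation C := ((R[i] : numFieldType)^o).
Implicit Types (g : R -> C) (F : C -> V) (v : R -> R) (p q : seq (R * R)).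

(** Sums over fine partitions form a Cauchy family, and a sequence of partitions
    of mesh tending to 0 provides the limit. *)
Lemma riemann_sum_cvg g F v : dominated g v -> continuous01 N (F \o g) ->
  exists I : V, riemann_sum g F 0 @ @mesh_to0 R --> I.
Proof.
move=> gv cF.
have close (e : R) : 0 < e -> exists2 d : R, 0 < d & forall p q,
    tagged_partition d 0 p -> tagged_partition d 0 q ->
    N (riemann_sum g F 0 p - riemann_sum g F 0 q) < e.
  move=> e0; have v0 := dominated_mono gv (lexx 0) ler01 (lexx 1).
  have w0 : 0 < v 1 - v 0 + 1 by lra.
  have [d d0 Hd] := uniform_continuous01 BN cF (divr_gt0 e0 w0).
  exists (d / 2); first by rewrite divr_gt0.
  move=> p q Hp Hq.
  have := @riemann_sum_compare R V N BN g F v (d / 2) (e / (v 1 - v 0 + 1)) gv _ 0 p q.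
  move=> /(_ _ (lexx 0) (tagged_near_partition (lexx 0) Hp) (tagged_near_partition (lexx 0) Hq)).
  move=> K; apply: (@le_lt_trans _ _ (e / (v 1 - v 0 + 1) * (v 1 - v 0))).
    apply: K => s t s01 t01 st; apply: Hd => //; lra.
  rewrite mulrAC ltr_pdivrMr //; nra.
have dn n : 0 < n.+1%:R^-1 :> R by rewrite invr_gt0 ltr0n.
have /choice [u Hu] : forall n : nat, exists p, tagged_partition (n.+1%:R^-1 : R) 0 p.
  by move=> n; exact: (fine_tagged_partition BN (dn n)).
have small (d : R) : 0 < d -> exists M : nat, forall n, (M <= n)%N -> n.+1%:R^-1 <= d.
  move=> d0; exists (Num.truncn d^-1) => n Mn.
  rewrite -[d]invrK lef_pV2 ?posrE ?ltr0n ?invr_gt0 //.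
  apply: ltW; apply: lt_le_trans (truncnS_gt _) _; rewrite ler_nat ltnS //.
have [e e0|I HI] := @bn_complete _ _ _ BN (fun n => riemann_sum g F 0 (u n)).
  have [d d0 Hd] := close e e0; have [M HM] := small d d0.
  by exists M => p q /HM Mp /HM Mq; apply: Hd;
    apply: tagged_partition_mesh (Hu _).
exists I; apply/(bn_cvgP BN) => e e0.
have e2 : 0 < e / 2 by rewrite divr_gt0.
have [d d0 Hd] := close _ e2; exists d => //= q Hq.
have [M HM] := small d d0.
have /(bn_cvgP BN)/(_ _ e2) [M' _ HM'] := HI.
pose n := maxn M M'.
have h1 := HM' n (leq_maxr _ _).
have h2 : N (riemann_sum g F 0 (u n) - riemann_sum g F 0 q) < e / 2.
  by apply: Hd => //; apply: tagged_partition_mesh (Hu _); apply: HM; exact: leq_maxl.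
have := bn_tri BN I (riemann_sum g F 0 (u n)) (riemann_sum g F 0 q).
by move: h1 => /=; lra.
Qed.

Lemma line_integral_eq g F (I : V) :
  riemann_sum g F 0 @ @mesh_to0 R --> I -> line_integral g F = I.
Proof.
move=> h; have hJ := xgetPex 0 (ex_intro [set J | riemann_sum g F 0 @ @mesh_to0 R --> J] I h).
exact: (@bn_unique _ _ _ BN _ _ (mesh_to0_proper R) _ _ _ hJ h).
Qed.

Lemma line_integralP g F v : dominated g v -> continuous01 N (F \o g) ->
  riemann_sum g F 0 @ @mesh_to0 R --> line_integral g F.
Proof.
by move=> gv /(riemann_sum_cvg gv) [I HI]; rewrite (line_integral_eq HI).
Qed.

(** The fundamental theorem of calculus, for a primitive [H] along the curve
    that is only known pointwise. *)
Lemma line_integral_ftc g F v (H : R -> V) : dominated g v ->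
  continuous01 N (F \o g) ->
  (forall e t, 0 < e -> 0 <= t <= 1 -> exists2 r : R, 0 < r & forall x y,
     0 <= x -> x <= t -> t <= y -> y <= 1 -> t - r < x -> y < t + r ->
     N (H y - H x - (g y - g x : R[i]) *: F (g t)) <= e * (v y - v x)) ->
  line_integral g F = H 1 - H 0.
Proof.
move=> gv cF HH; have /(bn_cvgP BN) cI := line_integralP gv cF.
apply/eqP; rewrite -subr_eq0; apply/eqP/(bn_eq0 BN)/eqP.
rewrite eq_le (bn_ge0 BN) andbT; apply/ler_addgt0Pr => e e0; rewrite add0r.
have e2 : 0 < e / 2 by rewrite divr_gt0.
have [d /= d0 Hd] := cI _ e2.
have v0 := dominated_mono gv (lexx 0) ler01 (lexx 1).
have w0 : 0 < v 1 - v 0 + 1 by lra.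
have [p Hp1 Hp2] := fine_partition BN gv (divr_gt0 e2 w0) d0 (fun t => HH _ t (divr_gt0 e2 w0)).
have h1 := Hd p Hp1.
have h2 : e / 2 / (v 1 - v 0 + 1) * (v 1 - v 0) <= e / 2.
  by rewrite mulrAC ler_pdivrMr //; nra.
have := bn_tri BN (line_integral g F) (riemann_sum g F 0 p) (H 1 - H 0).
by rewrite (bnB BN (riemann_sum g F 0 p)); move: h1 Hp2 => /=; lra.
Qed.

Lemma riemann_sum_le g F v (M : R) : dominated g v ->
  (forall t, 0 <= t <= 1 -> N (F (g t)) <= M) ->
  forall d x p, 0 <= x -> tagged_partition d x p ->
  N (riemann_sum g F x p) <= M * (v 1 - v x).
Proof.
move=> gv HM d x p; elim: p x => [|[t y] p IH] x x0 /=.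
  by move=> ->; rewrite (bn0 BN) subrr mulr0.
move=> [xy _ /andP[xt ty] Hp]; have y1 := tagged_partition_le1 Hp.
apply: (le_trans (bnD BN _ _)).
have -> : M * (v 1 - v x) = (v y - v x) * M + M * (v 1 - v y) by ring.
apply: lerD; last by apply: IH => //; lra.
rewrite (bnZ BN) ler_pM ?nc_ge0 ?(bn_ge0 BN) //; first by apply: gv => //; exact: ltW.
by apply: HM; apply/andP; split; lra.
Qed.

Lemma line_integral_le g F v (M : R) : dominated g v -> continuous01 N (F \o g) ->
  (forall t, 0 <= t <= 1 -> N (F (g t)) <= M) ->
  N (line_integral g F) <= M * (v 1 - v 0).
Proof.
move=> gv cF HM; have /(bn_cvgP BN) cI := line_integralP gv cF.
apply/ler_addgt0Pr => e e0; have [d /= d0 Hd] := cI _ e0.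
have [p Hp] := fine_tagged_partition BN d0.
have := riemann_sum_le gv HM (lexx 0) Hp; have := Hd p Hp => /=.
have := bn_sub_le BN (line_integral g F) (riemann_sum g F 0 p); lra.
Qed.

Lemma riemann_sumD g F G x p :
  riemann_sum g (fun z => F z + G z) x p = riemann_sum g F x p + riemann_sum g G x p.
Proof.
elim: p x => [|[t y] p IH] x /=; first by rewrite addr0.
by rewrite IH scalerDr addrACA.
Qed.

Lemma riemann_sumZ g F (c : R[i]) x p :
  riemann_sum g (fun z => c *: F z) x p = c *: riemann_sum g F x p.
Proof.
elim: p x => [|[t y] p IH] x /=; first by rewrite scaler0.
by rewrite IH scalerDr !scalerA mulrC.
Qed.

Lemma continuous01D (K L : R -> V) : continuous01 N K -> continuous01 N L ->
  continuous01 N (fun t => K t + L t).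
Proof.
move=> cK cL t e t01 e0; have e2 : 0 < e / 2 by rewrite divr_gt0.
have [r r0 Hr] := cK t _ t01 e2; have [s s0 Hs] := cL t _ t01 e2.
exists (Num.min r s); first by rewrite lt_min r0.
move=> u u01; rewrite lt_min => /andP[/Hr h1 /Hs h2].
rewrite opprD addrACA; apply: le_lt_trans (bnD BN _ _) _.
by have := h1 u01; have := h2 u01; lra.
Qed.

Lemma continuous01Z (K : R -> V) (c : R[i]) : continuous01 N K ->
  continuous01 N (fun t => c *: K t).
Proof.
move=> cK t e t01 e0; have n0 := nc_ge0 c.
have c0 : 0 < nc c + 1 by lra.
have [r r0 Hr] := cK t _ t01 (divr_gt0 e0 c0); exists r => // s s01 /(Hr _ s01).
rewrite -scalerBr (bnZ BN) ltr_pdivlMr // => h.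
by apply: le_lt_trans h; rewrite mulrC ler_wpM2l ?(bn_ge0 BN) // lerDl.
Qed.

Lemma continuous01M (K : R -> C) (L : R -> V) :
  continuous01 (@Normc.normc R : C -> R) K -> continuous01 N L ->
  continuous01 N (fun t => (K t : R[i]) *: L t).
Proof.
move=> cK cL t e t01 e0.
have A0 := nc_ge0 (K t); have B0 := bn_ge0 BN (L t).
have e1 : 0 < e / (2 * (N (L t) + 1)) by rewrite divr_gt0 // mulr_gt0 //; lra.
have e2 : 0 < e / (2 * (nc (K t) + 1)) by rewrite divr_gt0 // mulr_gt0 //; lra.
have [r1 r10 H1] := cK t _ t01 e1; have [r2 r20 H2] := cL t _ t01 e2.
have [r3 r30 H3] := cL t 1 t01 ltr01.
exists (Num.min r1 (Num.min r2 r3)); first by rewrite !lt_min r10 r20 r30.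
move=> s s01; rewrite !lt_min => /and3P[/(H1 _ s01) k1 /(H2 _ s01) k2 /(H3 _ s01) k3].
have -> : (K s : R[i]) *: L s - (K t : R[i]) *: L t =
    (K s - K t : R[i]) *: L s + (K t : R[i]) *: (L s - L t).
  by rewrite scalerBl scalerBr subrKA.
apply: le_lt_trans (bnD BN _ _) _; rewrite !(bnZ BN).
have k4 : N (L s) <= N (L t) + 1 by have := bn_sub_le BN (L s) (L t); lra.
have n1 := nc_ge0 (K s - K t).
have n3 := bn_ge0 BN (L s - L t).
rewrite ltr_pdivlMr in k1; last by rewrite mulr_gt0 //; lra.
rewrite ltr_pdivlMr in k2; last by rewrite mulr_gt0 //; lra.
have m1 := ler_wpM2l n1 k4.
move: k1 k2 m1; lra.
Qed.

Lemma line_integral_ext g F G v : dominated g v -> continuous01 N (F \o g) ->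
  (forall t, 0 <= t <= 1 -> F (g t) = G (g t)) ->
  line_integral g F = line_integral g G.
Proof.
move=> gv cF FG; apply/esym/line_integral_eq; apply/(bn_cvgP BN) => e e0.
have /(bn_cvgP BN)/(_ _ e0) [d /= d0 Hd] := line_integralP gv cF.
have eqS x p : 0 <= x -> tagged_partition d x p -> riemann_sum g F x p = riemann_sum g G x p.
  elim: p x => [|[t y] p IH] x x0 //= [xy _ /andP[xt ty] Hp].
  have y1 := tagged_partition_le1 Hp.
  by rewrite FG ?(IH y) //; [lra | apply/andP; split; lra].
by exists d => //= p Hp; rewrite -eqS //; exact: Hd.
Qed.

Lemma line_integral0 g : line_integral g (fun=> 0 : V) = 0.
Proof.
apply: line_integral_eq; apply/(bn_cvgP BN) => e e0; apply: nearW => p.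
suff -> x : riemann_sum g (fun=> 0 : V) x p = 0 by rewrite subrr (bn0 BN).
by elim: p x => [|[t y] p IH] x //=; rewrite IH scaler0 addr0.
Qed.

Lemma line_integralD g F G v : dominated g v ->
  continuous01 N (F \o g) -> continuous01 N (G \o g) ->
  line_integral g (fun z => F z + G z) = line_integral g F + line_integral g G.
Proof.
move=> gv cF cG; apply: line_integral_eq; apply/(bn_cvgP BN) => e e0.
have e2 : 0 < e / 2 by rewrite divr_gt0.
have /(bn_cvgP BN)/(_ _ e2) h1 := line_integralP gv cF.
have /(bn_cvgP BN)/(_ _ e2) h2 := line_integralP gv cG.
near=> p; rewrite riemann_sumD opprD addrACA.
apply: le_lt_trans (bnD BN _ _) _; rewrite [ltRHS]splitr.
by apply: ltrD; near: p.
Unshelve. all: by end_near. Qed.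

Lemma line_integralZ g F v (c : R[i]) : dominated g v ->
  continuous01 N (F \o g) ->
  line_integral g (fun z => c *: F z) = c *: line_integral g F.
Proof.
move=> gv cF; apply: line_integral_eq; apply/(bn_cvgP BN) => e e0.
have n0 := nc_ge0 c; have c0 : 0 < nc c + 1 by lra.
have /(bn_cvgP BN)/(_ _ (divr_gt0 e0 c0)) := line_integralP gv cF.
apply: filterS => p; rewrite riemann_sumZ -scalerBr (bnZ BN) ltr_pdivlMr // => h.
by apply: le_lt_trans h; rewrite mulrC ler_wpM2l ?(bn_ge0 BN) // lerDl.
Qed.

End LineIntegral.

(** A map that is linear and bounded on a subspace containing the values of the
    integrand commutes with the integral. *)
Lemma line_integral_map (R : realType) (V W : preTopologicalLmodType R[i])
    (N : V -> R) (M : W -> R) (BN : banach_norm N) (BM : banach_norm M)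
    (S : set V) (phi : V -> W) (k : R)
    (g : R -> (R[i] : numFieldType)^o) (F : (R[i] : numFieldType)^o -> V) v :
  S 0 -> (forall x y, S x -> S y -> S (x + y)) ->
  (forall (c : R[i]) x, S x -> S (c *: x)) ->
  (forall x y, S x -> S y -> phi (x + y) = phi x + phi y) ->
  (forall (c : R[i]) x, S x -> phi (c *: x) = c *: phi x) ->
  (forall x, S x -> M (phi x) <= k * N x) ->
  (forall x, (forall e : R, 0 < e -> exists2 y, S y & N (x - y) < e) -> S x) ->
  dominated g v -> continuous01 N (F \o g) ->
  (forall t, 0 <= t <= 1 -> S (F (g t))) ->
  S (line_integral g F) /\ line_integral g (phi \o F) = phi (line_integral g F).
Proof.
move=> S0 SD SZ phiD phiZ phib Scl gv cF SF.
have SN x : S x -> S (- x) by move=> /(SZ (-1)); rewrite scaleN1r.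
have phiB x y : S x -> S y -> phi (x - y) = phi x - phi y.
  by move=> Sx Sy; rewrite -scaleN1r phiD ?phiZ ?scaleN1r //; exact: SN.
have Sr d x p : 0 <= x -> tagged_partition d x p -> S (riemann_sum g F x p)
    /\ riemann_sum g (phi \o F) x p = phi (riemann_sum g F x p).
  elim: p x => [|[t y] p IH] x x0 /=.
    by move=> _; split => //; have := phiZ 0 0 S0; rewrite !scale0r.
  move=> [xy _ /andP[xt ty] Hp]; have y1 := tagged_partition_le1 Hp.
  have St : S (F (g t)) by apply: SF; apply/andP; split; lra.
  have [|h1 h2] := IH y _ Hp; first by lra.
  by split; [apply: SD => //; exact: SZ | rewrite h2 phiD ?phiZ //; exact: SZ].
have /(bn_cvgP BN) cI := line_integralP BN gv cF.
have SI : S (line_integral g F).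
  apply: Scl => e e0; have [d /= d0 Hd] := cI _ e0.
  have [p Hp] := fine_tagged_partition BN d0.
  by exists (riemann_sum g F 0 p); [exact: (Sr _ _ _ (lexx 0) Hp).1 | exact: Hd].
split => //; apply: (line_integral_eq BM); apply/(bn_cvgP BM) => e e0.
have k0 : 0 < `|k| + 1 by have := normr_ge0 k; lra.
have [d /= d0 Hd] := cI _ (divr_gt0 e0 k0); exists d => //= p Hp.
have [h1 ->] := Sr _ _ _ (lexx 0) Hp; rewrite -phiB //.
apply: le_lt_trans (phib _ _) _; first by apply: SD => //; exact: SN.
have := Hd p Hp; rewrite /= ltr_pdivlMr // => h.
apply: le_lt_trans h; rewrite mulrC ler_wpM2l ?(bn_ge0 BN) //.
by have := ler_norm k; lra.
Qed.

(** * Cauchy's formula on star-shaped domains *)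

Definition ncont (R : realType) (V : preTopologicalLmodType R[i]) (N : V -> R)
    (F : (R[i] : numFieldType)^o -> V) (z : R[i]) : Prop :=
  forall e : R, 0 < e -> exists2 r : R, 0 < r &
    forall w, nc (w - z) < r -> N (F w - F z) < e.

Section Curves.
Variable R : realType.
Local Notation C := ((R[i] : numFieldType)^o).
Local Notation ncC := (@Normc.normc R : C -> R).
Implicit Types (g : R -> C).

Lemma closed_rectifiable_dominated g : closed_rectifiable g ->
  exists v, dominated g v.
Proof.
move=> [_ _ bR bI].
pose V (f : R -> R) x := fine (total_variation 0 x f).
have key (f : R -> R) x y : bounded_variation 0 1 f -> 0 <= x -> x <= y -> y <= 1 ->
    `|f y - f x| <= V f y - V f x.
  move=> bf x0 xy y1.
  have y0 := le_trans x0 xy.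
  have b0y := bounded_variationl y0 y1 bf.
  have b0x := bounded_variationl x0 xy b0y.
  have bxy := bounded_variationr x0 xy b0y.
  rewrite /V (total_variationD f x0 xy) fineD; last 2 first.
  - exact/bounded_variationP.
  - exact/bounded_variationP.
  rewrite addrAC subrr add0r -lee_fin fineK ?total_variation_ge //.
  exact/bounded_variationP.
exists (fun x => V (fun t => complex.Re (g t)) x + V (fun t => complex.Im (g t)) x).
move=> x y x0 xy y1; apply: le_trans (nc_le _) _.
have h1 := key _ x y bR x0 xy y1; have h2 := key _ x y bI x0 xy y1.
rewrite ReD ReN ImD ImN; move: h1 h2; lra.
Qed.

Lemma closed_rectifiable_continuous g : closed_rectifiable g -> continuous01 ncC g.
Proof.
move=> [/subspace_continuousP cg _ _ _] t e t01 e0.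
have t01' : `[0, 1]%classic t by rewrite /= in_itv.
have /(bn_cvgP (complex_banach R))/(_ _ e0) := cg t t01'.
rewrite near_withinE => /nbhs_ballP [r /= r0 H]; exists r => // s s01 st.
rewrite ncB; apply: H; last by rewrite /= in_itv.
by rewrite /ball /= distrC.
Qed.

Lemma continuous01_comp (V : preTopologicalLmodType R[i]) (N : V -> R) F g :
  continuous01 ncC g -> (forall t, 0 <= t <= 1 -> ncont N F (g t)) ->
  continuous01 N (F \o g).
Proof.
move=> cg cF t e t01 e0; have [r r0 Hr] := cF t t01 e e0.
have [s s0 Hs] := cg t r t01 r0; exists s => // u u01 /(Hs _ u01); exact: Hr.
Qed.


(** The compactness of the curve. *)
Lemma bounded_away g : continuous01 ncC g -> (forall t, 0 <= t <= 1 -> g t != 0) ->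
  exists2 c : R, 0 < c & forall t, 0 <= t <= 1 -> c <= nc (g t).
Proof.
move=> cg g0; pose P x := exists2 c : R, 0 < c & forall t, x <= t <= 1 -> c <= nc (g t).
apply: (@real_induction R P); last first.
  exists (nc (g 1)); first by rewrite nc_gt0 g0 // ler01 lexx.
  by move=> t /andP[h1 h2]; rewrite (_ : t = 1) //; apply/eqP; rewrite eq_le h2.
move=> t t01; have n0 : 0 < nc (g t) by rewrite nc_gt0 g0.
have n2 : 0 < nc (g t) / 2 by rewrite divr_gt0.
have [r r0 Hr] := cg t _ t01 n2; exists r => // x y x0 xt ty y1 xr yr [c c0 Hc].
exists (Num.min c (nc (g t) / 2)); first by rewrite lt_min c0.
move=> s /andP[xs s1]; rewrite ge_min.
have [ys|sy] := leP y s; first by rewrite Hc // ys.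
apply/orP; right.
have h1 : nc (g s - g t) < nc (g t) / 2.
  apply: Hr; first by apply/andP; split; lra.
  by rewrite ltr_norml; apply/andP; split; lra.
have := ncD (g s) (g t - g s); rewrite addrC subrK ncB; lra.
Qed.

Lemma slit_segment (l z : R[i]) (s : R) : 0 < complex.Re l -> complex.Im l = 0 ->
  slit z -> 0 <= s <= 1 -> slit (l + s%:C * (z - l)).
Proof.
case: l z => [a b] [x y] /= a0 -> sz /andP[s0 s1]; rewrite /slit /=.
rewrite !mul0r !subr0 !addr0 add0r => -[h1 /eqP]; rewrite mulf_eq0 => /orP[/eqP h|/eqP y0].
  by move: h1; rewrite h mul0r addr0 leNgt a0.
apply: sz => /=; split => //; rewrite leNgt; apply/negP => x0.
have [s00|sn0] := eqVneq s 0; first by move: h1; rewrite s00 mul0r addr0 leNgt a0.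
have sp : 0 < s by rewrite lt_def sn0.
nra.
Qed.

(** The mean value inequality; subtracting the constant [k] from the derivative
    makes it bound second-order remainders as well. *)
Lemma cdiff_mvt (f f1 : R[i] -> R[i]) (a h k : R[i]) (M : R) :
  (forall s : R, 0 <= s <= 1 -> cdiff f (a + s%:C * h) (f1 (a + s%:C * h))) ->
  (forall s : R, 0 <= s <= 1 -> nc (f1 (a + s%:C * h) - k) <= M) ->
  nc (f (a + h) - f a - k * h) <= M * nc h.
Proof.
move=> df HM; pose phi (s : R) := f (a + s%:C * h) - k * (s%:C * h).
have M0 : 0 <= M.
  by apply: le_trans (nc_ge0 _) (HM 0 _); rewrite lexx ler01.
have h0 := nc_ge0 h.
apply/ler_addgt0Pr => e0 e00.
pose e := e0 / (nc h + 1).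
have e1 : 0 < e by rewrite divr_gt0 //; lra.
have eh : e * nc h <= e0 by rewrite /e mulrAC ler_pdivrMr; nra.
pose P x := nc (phi 1 - phi x) <= (M + e) * nc h * (1 - x).
suff : P 0.
  rewrite /P /phi !mul0r mulr0 !mul1r addr0 !subr0 mulr1.
  rewrite (_ : f (a + h) - k * h - f a = f (a + h) - f a - k * h); last by ring.
  move=> H; apply: (le_trans H); rewrite mulrDl; lra.
apply: (@real_induction R P); last by rewrite /P !subrr nc0 mulr0.
move=> t t01; have [r r0 Hr] := df t t01 e e1.
have k0 : 0 < nc h + 1 by lra.
exists (r / (nc h + 1)); first by rewrite divr_gt0.
have step x : `|x - t| < r / (nc h + 1) ->
    nc (phi x - phi t) <= (M + e) * nc h * `|x - t|.
  move=> xt.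
  have E : a + x%:C * h - (a + t%:C * h) = (x - t)%:C * h.
    by rewrite realcB; ring.
  have := Hr (a + x%:C * h); rewrite E ncM ncR => /(_ _) H.
  have {}H : nc (f (a + x%:C * h) - f (a + t%:C * h) - f1 (a + t%:C * h) * ((x - t)%:C * h))
      <= e * (`|x - t| * nc h).
    apply: H; rewrite ltr_pdivlMr // in xt.
    by apply: le_lt_trans xt; rewrite ler_wpM2l //; lra.
  have -> : phi x - phi t =
      (f (a + x%:C * h) - f (a + t%:C * h) - f1 (a + t%:C * h) * ((x - t)%:C * h))
      + (f1 (a + t%:C * h) - k) * ((x - t)%:C * h).
    by rewrite /phi realcB; ring.
  apply: le_trans (ncD _ _) _.
  have := ler_wpM2r (mulr_ge0 (normr_ge0 (x - t)) h0) (HM t t01).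
  by rewrite (ncM (f1 _ - k)) ncM ncR; move: H; lra.
move=> x y x0 xt ty y1 xr yr Py; rewrite /P.
have h1 : nc (phi y - phi t) <= (M + e) * nc h * (y - t).
  by rewrite -[y - t]ger0_norm ?subr_ge0 //; apply: step; rewrite ger0_norm; lra.
have h2 : nc (phi x - phi t) <= (M + e) * nc h * (t - x).
  rewrite -[t - x]ger0_norm ?subr_ge0 // distrC; apply: step.
  by rewrite distrC ger0_norm; lra.
have -> : phi 1 - phi x = (phi 1 - phi y) + ((phi y - phi t) - (phi x - phi t)) by ring.
apply: le_trans (ncD _ _) _.
have := ncD (phi y - phi t) (- (phi x - phi t)); rewrite ncN.
move: Py h1 h2; rewrite /P.
have -> : (M + e) * nc h * (1 - x) = (M + e) * nc h * (1 - y) +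
  ((M + e) * nc h * (y - t) + (M + e) * nc h * (t - x)) by ring.
lra.
Qed.

Lemma line_integral_primitive g (Q q : R[i] -> R[i]) : closed_rectifiable g ->
  (forall t, 0 <= t <= 1 -> cdiff Q (g t) (q (g t))) ->
  (forall t, 0 <= t <= 1 -> ncont ncC (q : C -> C) (g t)) ->
  line_integral g (q : C -> C) = 0.
Proof.
move=> rg dQ cq; have cg := closed_rectifiable_continuous rg.
have [v gv] := closed_rectifiable_dominated rg.
have [_ g01 _ _] := rg.
rewrite (line_integral_ftc (complex_banach R) (H := Q \o g) gv) //=.
- by rewrite g01 subrr.
- exact: continuous01_comp.
move=> e t e0 t01; have [r r0 Hr] := dQ t t01 e e0.
have [s s0 Hs] := cg t r t01 r0; exists s => // x y x0 xt ty y1 xs ys.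
have y01 : 0 <= y <= 1 by rewrite y1 (le_trans x0) // (le_trans xt).
have x01 : 0 <= x <= 1 by rewrite x0 (le_trans xt) // (le_trans ty).
have h1 : nc (g y - g t) < r by apply: Hs => //; rewrite ger0_norm; lra.
have h2 : nc (g x - g t) < r by apply: Hs => //; rewrite distrC ger0_norm; lra.
have := Hr _ h1; have := Hr _ h2; move=> k2 k1.
have b1 : nc (g y - g t) <= v y - v t by apply: gv => //; lra.
have b2 : nc (g x - g t) <= v t - v x by rewrite ncB; apply: gv => //; lra.
set d := q (g t) in k1 k2 *.
have -> : Q (g y) - Q (g x) - (g y - g x : R[i]) *: (d : C) =
   (Q (g y) - Q (g t) - d * (g y - g t)) - (Q (g x) - Q (g t) - d * (g x - g t)).
  rewrite [_ *: _](_ : _ = (g y - g x) * d) //; ring.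
apply: le_trans (ncD _ _) _; rewrite ncN.
apply: (le_trans (lerD k1 k2)); rewrite -mulrDr ler_wpM2l ?(ltW e0) //; lra.
Qed.

Lemma cdiff_ncont (f : R[i] -> R[i]) z d : cdiff f z d -> ncont ncC (f : C -> C) z.
Proof. exact: cdiff_continuous. Qed.

(** Over a subdivision, increments of second order add up to a multiple of the
    mesh. *)
Lemma constant01 (phi : R -> R[i]) (K : R) :
  (forall s s', 0 <= s -> s < s' -> s' <= 1 -> nc (phi s' - phi s) <= K * (s' - s) ^+ 2) ->
  phi 1 = phi 0.
Proof.
move=> HK; apply/eqP; rewrite -subr_eq0; apply/eqP/Normc.eq0_normc/eqP.
rewrite eq_le nc_ge0 andbT; apply/ler_addgt0Pr => e e0; rewrite add0r.
have K0 : 0 < `|K| + 1 by have := normr_ge0 K; lra.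
pose P x := nc (phi 1 - phi x) <= e * (1 - x).
suff : P 0 by rewrite /P subr0 mulr1.
apply: (@real_induction R P); last by rewrite /P !subrr nc0 mulr0.
move=> t _; exists (e / 2 / (`|K| + 1)); first by rewrite !divr_gt0.
move=> x y x0 xt ty y1 xr yr Py.
have [xy|yx] := ltP x y; last first.
  by rewrite (_ : x = y) //; apply/eqP; rewrite eq_le yx (le_trans xt).
have := HK x y x0 xy y1 => h.
have h2 : K * (y - x) ^+ 2 <= e * (y - x).
  rewrite expr2 mulrA ler_wpM2r ?subr_ge0 ?(ltW xy) //.
  have : (y - x) * (`|K| + 1) <= e.
    by rewrite -ler_pdivlMr //; lra.
  have := ler_norm K; nra.
rewrite /P (_ : phi 1 - phi x = (phi 1 - phi y) + (phi y - phi x)); last by ring.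
apply: le_trans (ncD _ _) _; move: Py; rewrite /P; lra.
Qed.

(** The integral of [f (l + s (z - l)) / (z - l)] does not depend on [s]: its
    derivative in [s] is the integral of [f1 (l + s (z - l))], which has the
    primitive [f (l + s (z - l)) / s].  Between [s = 0] and [s = 1] this moves
    from [f l] times the winding integral to the Cauchy integral of [f]. *)
Lemma cauchy_star g (f f1 : R[i] -> R[i]) (l : R[i]) (M : R) :
  closed_rectifiable g -> (forall t, 0 <= t <= 1 -> g t != l) ->
  (forall t s, 0 <= t <= 1 -> 0 <= s <= 1 ->
     cdiff f (l + s%:C * (g t - l)) (f1 (l + s%:C * (g t - l)))) ->
  (forall t s, 0 <= t <= 1 -> 0 <= s <= 1 ->
     ncont ncC (f1 : C -> C) (l + s%:C * (g t - l))) ->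
  (forall t s s', 0 <= t <= 1 -> 0 <= s <= 1 -> 0 <= s' <= 1 ->
     nc (f1 (l + s'%:C * (g t - l)) - f1 (l + s%:C * (g t - l))) <= M * `|s' - s|) ->
  line_integral g (fun z : C => (f z / (z - l)) : C) =
  f l * line_integral g (fun z : C => ((z - l)^-1) : C).
Proof.
move=> rg gl df cf1 HM; have cg := closed_rectifiable_continuous rg.
have [v gv] := closed_rectifiable_dominated rg.
have BC := complex_banach R.
have gl' t : 0 <= t <= 1 -> g t - l != 0 by move=> t01; rewrite subr_eq0 gl.
have cinv : continuous01 ncC ((fun z : C => (z - l)^-1 : C) \o g).
  by apply: continuous01_comp => // t t01; apply: cdiff_ncont (cdiff_inv_shift (gl' _ t01)).
have daff (s : R) z : cdiff (fun w : R[i] => l + s%:C * (w - l)) z s%:C.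
  move=> e /(cdiff_affine s%:C (l - s%:C * l) z) [r r0 k]; exists r => // w /k.
  by congr (nc _ <= _); ring.
pose F (s : R) (z : C) : C := f (l + s%:C * (z - l)) / (z - l).
have cfs (s : R) : 0 <= s <= 1 ->
    continuous01 ncC ((fun z : C => f (l + s%:C * (z - l)) : C) \o g).
  move=> s01; apply: continuous01_comp => // t t01.
  have h := df t s t01 s01.
  by apply: (@cdiff_ncont (fun z => f (l + s%:C * (z - l)))); apply: (cdiff_comp (daff s _) h).
have cF (s : R) : 0 <= s <= 1 -> continuous01 ncC (F s \o g).
  by move=> s01; exact: (continuous01M BC (cfs s s01) cinv).
have cf1s (s : R) : 0 <= s <= 1 ->
    forall t, 0 <= t <= 1 -> ncont ncC (fun z : C => f1 (l + s%:C * (z - l)) : C) (g t).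
  move=> s01 t t01 e e0; have [r r0 Hr] := cf1 t s t01 s01 e e0.
  have [r' r'0 Hr'] := cdiff_continuous (daff s (g t)) r0.
  by exists r' => // w /Hr' /Hr.
have I0 (s : R) : 0 <= s <= 1 -> 0 < s ->
    line_integral g (fun z : C => f1 (l + s%:C * (z - l)) : C) = 0.
  move=> s01 s0.
  apply: (@line_integral_primitive g (fun z => s%:C^-1 * f (l + s%:C * (z - l)))
           (fun z => f1 (l + s%:C * (z - l)))) => //; last exact: cf1s.
  move=> t t01; have h := cdiffZ s%:C^-1 (cdiff_comp (daff s _) (df t s t01 s01)).
  have sC : s%:C != 0 :> R[i] by rewrite -nc_gt0 ncR gtr0_norm.
  by move: h; rewrite mulrC mulfK.
have F0 : line_integral g (F 0) = f l * line_integral g (fun z : C => ((z - l)^-1) : C).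
  rewrite -[RHS]/((f l : R[i]) *: (line_integral g (fun z : C => ((z - l)^-1) : C) : C)).
  rewrite -(line_integralZ BC (f l) gv cinv); congr (line_integral g _).
  by apply/funext => z; rewrite /F mul0r addr0.
have F1 : line_integral g (F 1) = line_integral g (fun z : C => (f z / (z - l)) : C).
  by congr (line_integral g _); apply/funext => z; rewrite /F mul1r addrC subrK.
rewrite -F0 -F1.
have v0 := dominated_mono gv (lexx 0) ler01 (lexx 1).
apply: (@constant01 (fun s => line_integral g (F s)) (M * (v 1 - v 0))).
move=> s s' s0 ss s1.
have s01 : 0 <= s <= 1 by rewrite s0 (le_trans (ltW ss)).
have s01' : 0 <= s' <= 1 by rewrite s1 (le_trans s0 (ltW ss)).
have sp : 0 < s' := le_lt_trans s0 ss.
(* [G] has integral 0, so subtracting it from the difference of [F s] and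
   [F s'] leaves an integrand of second order in [s - s'] *)
pose G (z : C) : C := ((s - s')%:C) *: (f1 (l + s'%:C * (z - l)) : C).
have cG0 : continuous01 ncC ((fun z : C => f1 (l + s'%:C * (z - l)) : C) \o g).
  by apply: continuous01_comp => //; exact: cf1s.
have cG : continuous01 ncC (G \o g) by apply: (continuous01Z BC (s - s')%:C cG0).
have G0 : line_integral g G = 0 by rewrite (line_integralZ BC _ gv cG0) I0 // scaler0.
pose D (z : C) : C := F s z + (-1 : R[i]) *: (F s' z + G z).
have cFG : continuous01 ncC ((fun z => F s' z + G z) \o g).
  by apply: (continuous01D BC (cF _ s01') cG).
have cN : continuous01 ncC ((fun z => (-1 : R[i]) *: (F s' z + G z)) \o g).
  exact: (continuous01Z BC (-1) cFG).
have ED : line_integral g D = line_integral g (F s) - line_integral g (F s').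
  rewrite (line_integralD BC gv (cF _ s01) cN) (line_integralZ BC (-1) gv cFG).
  by rewrite (line_integralD BC gv (cF _ s01') cG) G0 addr0 scaleN1r.
rewrite ncB -ED.
have -> : M * (v 1 - v 0) * (s' - s) ^+ 2 = M * (s' - s) ^+ 2 * (v 1 - v 0) by ring.
apply: (line_integral_le BC gv).
  exact: (continuous01D BC (cF _ s01) cN).
move=> t t01; have gt0 := gl' t t01.
have -> : D (g t) = (f (l + s%:C * (g t - l)) - f (l + s'%:C * (g t - l))
    - f1 (l + s'%:C * (g t - l)) * ((s - s')%:C * (g t - l))) / (g t - l) :> R[i].
  rewrite /D /F /G -[X in _ + X]/((-1) * (_ + (s - s')%:C * _)); field.
  by rewrite gt0.
rewrite ncM ncV ler_pdivrMr ?nc_gt0 //.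
have E : l + s%:C * (g t - l) = (l + s'%:C * (g t - l)) + (s - s')%:C * (g t - l).
  by rewrite realcB; ring.
rewrite E.
have Eu (u : R) : l + s'%:C * (g t - l) + u%:C * ((s - s')%:C * (g t - l)) =
    l + (s' + u * (s - s'))%:C * (g t - l).
  by rewrite (realcD s') (realcM u) realcB; ring.
have u01 u : 0 <= u <= 1 -> 0 <= s' + u * (s - s') <= 1.
  by move=> /andP[u0 u1]; apply/andP; split; nra.
have M0 : 0 <= M * `|s - s'| by apply: le_trans (HM t s' s t01 s01' s01); exact: nc_ge0.
apply: le_trans (@cdiff_mvt f f1 _ _ _ (M * `|s - s'|) _ _) _.
- by move=> u uu; rewrite Eu; apply: df => //; exact: u01.
- move=> u uu; rewrite Eu.
  apply: le_trans (HM t s' _ t01 s01' (u01 u uu)) _.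
  rewrite addrC addKr normrM; move: uu => /andP[u0 u1]; rewrite (ger0_norm u0).
  by rewrite mulrCA; nra.
rewrite ncM ncR distrC (gtr0_norm (_ : 0 < s' - s)) ?subr_gt0 //.
by rewrite expr2 !mulrA.
Qed.

Lemma cauchy_exp g (l : R[i]) : closed_rectifiable g ->
  (forall t, 0 <= t <= 1 -> g t != l) ->
  line_integral g (fun z : C => (cexp z / (z - l)) : C) =
  cexp l * line_integral g (fun z : C => ((z - l)^-1) : C).
Proof.
move=> rg gl; have [v gv] := closed_rectifiable_dominated rg.
have v0 := dominated_mono gv (lexx 0) ler01 (lexx 1).
pose B := nc (g 0 - l) + (v 1 - v 0).
have HB t : 0 <= t <= 1 -> nc (g t - l) <= B.
  move=> /andP[t0 t1]; apply: le_trans (nc_tri _ (g 0) _) _.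
  have := gv 0 t (lexx 0) t0 t1; have := dominated_mono gv t0 t1 (lexx 1).
  rewrite /B; lra.
have B0 : 0 <= B by apply: le_trans (nc_ge0 _) (HB 0 _); rewrite lexx ler01.
pose E := expR (nc l + B).
have HE t (s : R) : 0 <= t <= 1 -> 0 <= s <= 1 -> nc (cexp (l + s%:C * (g t - l))) <= E.
  move=> t01 /andP[s0 s1]; rewrite nc_cexp ler_expR.
  apply: le_trans (ler_norm _) (le_trans (Re_le_nc _) _).
  apply: le_trans (ncD _ _) _; rewrite ncM ncR ger0_norm // lerD2l.
  by have := HB t t01; have := nc_ge0 (g t - l); nra.
(* [E] bounds the exponential on the segments from [l] to the curve, and [B]
   their lengths *)
apply: (@cauchy_star g (@cexp R) (@cexp R) l (E * B)) => //.
- by move=> t s _ _; exact: cdiff_cexp.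
- by move=> t s _ _; apply: cdiff_ncont (cdiff_cexp _).
move=> t s s' t01 s01 s01'.
have E1 : l + s'%:C * (g t - l) = l + s%:C * (g t - l) + (s' - s)%:C * (g t - l).
  by rewrite realcB; ring.
have Eu (u : R) : l + s%:C * (g t - l) + u%:C * ((s' - s)%:C * (g t - l)) =
    l + (s + u * (s' - s))%:C * (g t - l).
  by rewrite (realcD s) (realcM u) realcB; ring.
have u01 u : 0 <= u <= 1 -> 0 <= s + u * (s' - s) <= 1.
  move: s01 s01' => /andP[? ?] /andP[? ?] /andP[u0 u1]; apply/andP; split; nra.
have := @cdiff_mvt (@cexp R) (@cexp R) (l + s%:C * (g t - l)) ((s' - s)%:C * (g t - l)) 0 E.
rewrite mul0r subr0 -E1 => h.
apply: le_trans (h _ _) _.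
- by move=> u _; exact: cdiff_cexp.
- by move=> u uu; rewrite subr0 Eu; apply: HE => //; exact: u01.
rewrite ncM ncR -mulrA ler_wpM2l ?expR_ge0 // mulrC ler_wpM2r //; exact: HB.
Qed.

Lemma cauchy_log g (l : R[i]) : closed_rectifiable g ->
  0 < complex.Re l -> complex.Im l = 0 ->
  (forall t, 0 <= t <= 1 -> slit (g t)) ->
  (forall t, 0 <= t <= 1 -> g t != l) ->
  line_integral g (fun z : C => (clog z / (z - l)) : C) =
  clog l * line_integral g (fun z : C => ((z - l)^-1) : C).
Proof.
move=> rg l0 l1 gs gl; have [v gv] := closed_rectifiable_dominated rg.
have cg := closed_rectifiable_continuous rg.
have v0 := dominated_mono gv (lexx 0) ler01 (lexx 1).
pose B := nc (g 0 - l) + (v 1 - v 0).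
have HB t : 0 <= t <= 1 -> nc (g t - l) <= B.
  move=> /andP[t0 t1]; apply: le_trans (nc_tri _ (g 0) _) _.
  have := gv 0 t (lexx 0) t0 t1; have := dominated_mono gv t0 t1 (lexx 1).
  rewrite /B; lra.
have ss t (s : R) : 0 <= t <= 1 -> 0 <= s <= 1 -> slit (l + s%:C * (g t - l)).
  by move=> t01 s01; apply: slit_segment => //; exact: gs.
(* the segments from [l] to the curve stay away from the origin *)
have [c c0 Hc] : exists2 c : R, 0 < c & forall t (s : R), 0 <= t <= 1 -> 0 <= s <= 1 ->
    c <= nc (l + s%:C * (g t - l)).
  pose P x := exists2 c : R, 0 < c & forall t (s : R), x <= t <= 1 -> 0 <= s <= 1 ->
    c <= nc (l + s%:C * (g t - l)).
  have fixed t : 0 <= t <= 1 -> exists2 c : R, 0 < c & forall s : R, 0 <= s <= 1 ->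
      c <= nc (l + s%:C * (g t - l)).
    move=> t01.
    apply: (@bounded_away (fun s : R => l + s%:C * (g t - l))); last first.
      by move=> s s01; exact: slit_neq0 (ss _ _ t01 s01).
    move=> s e s01 e0; have n0 := nc_ge0 (g t - l).
    exists (e / (nc (g t - l) + 1)); first by rewrite divr_gt0 //; lra.
    move=> u u01; rewrite ltr_pdivlMr; last by lra.
    have -> : l + u%:C * (g t - l) - (l + s%:C * (g t - l)) = (u - s)%:C * (g t - l) :> R[i].
      by rewrite realcB; ring.
    rewrite ncM ncR => h; apply: le_lt_trans h.
    by rewrite ler_wpM2l //; lra.
  apply: (@real_induction R P); last first.
    have [|c c0 H] := fixed 1; first by rewrite ler01 lexx.
    exists c => // t s /andP[h1 h2].
    by rewrite (_ : t = 1) //; [exact: H | apply/eqP; rewrite eq_le h2].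
  move=> t t01; have [c c0 H] := fixed t t01.
  have c2 : 0 < c / 2 by rewrite divr_gt0.
  have [r r0 Hr] := cg t _ t01 c2; exists r => // x y x0 xt ty y1 xr yr [c' c'0 H'].
  exists (Num.min c' (c / 2)); first by rewrite lt_min c'0.
  move=> u s /andP[xu u1] s01; rewrite ge_min.
  have [yu|uy] := leP y u; first by rewrite H' // yu.
  apply/orP; right.
  have h1 : nc (g u - g t) < c / 2.
    apply: Hr; first by apply/andP; split; lra.
    by rewrite ltr_norml; apply/andP; split; lra.
  have := H s s01.
  have := ncD (l + s%:C * (g u - l)) (s%:C * (g t - g u)).
  rewrite (_ : _ + s%:C * (g t - g u) = l + s%:C * (g t - l)); last by ring.
  rewrite (ncM _ (g t - g u)) ncR (ncB (g t)); move: s01 => /andP[s0 s1].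
  rewrite (ger0_norm s0); have := nc_ge0 (g u - g t); nra.
have dl (z : R[i]) : slit z -> cdiff (@clog R) z z^-1 := @cdiff_clog R z.
apply: (@cauchy_star g (@clog R) (fun z => z^-1) l (B / c ^+ 2)) => //.
- by move=> t s t01 s01; apply: dl; exact: ss.
- move=> t s t01 s01; apply: cdiff_ncont (cdiff_inv _).
  exact: slit_neq0 (ss _ _ t01 s01).
move=> t s s' t01 s01 s01'.
have a0 := Hc t s t01 s01; have b0 := Hc t s' t01 s01'.
have a1 := slit_neq0 (ss t s t01 s01); have b1 := slit_neq0 (ss t s' t01 s01').
set a := l + s%:C * (g t - l) in a0 a1 *; set b := l + s'%:C * (g t - l) in b0 b1 *.
have -> : b^-1 - a^-1 = (a - b) / (a * b) by field; rewrite b1 a1.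
have -> : a - b = (s - s')%:C * (g t - l) by rewrite /a /b realcB; ring.
rewrite ncM ncV !ncM ncR ler_pdivrMr; last by rewrite mulr_gt0; lra.
rewrite distrC (_ : B / c ^+ 2 * `|s' - s| * (nc a * nc b)
  = `|s' - s| * (B * ((nc a * nc b) / c ^+ 2))); last by ring.
rewrite ler_wpM2l //; apply: le_trans (HB t t01) _.
have B0 : 0 <= B := le_trans (nc_ge0 _) (HB t t01).
rewrite ler_peMr // ler_pdivlMr ?exprn_gt0 // mul1r expr2; nra.
Qed.

End Curves.

(** * Banach algebras: inverses near the identity and resolvents *)

Section Inverses.
Variable B : nzRingType.
Implicit Types x y z : B.

Lemma is_inverse_unique x y z : is_inverse x y -> is_inverse x z -> y = z.
Proof. by move=> [_ yx] [xz _]; rewrite -[y]mulr1 -xz mulrA yx mul1r. Qed.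

Lemma inverse_eq x y : is_inverse x y -> inverse x = y.
Proof.
move=> h; have hJ := xgetPex 0 (ex_intro [set y | is_inverse x y] y h).
exact: is_inverse_unique hJ h.
Qed.

Lemma inverseP x : (exists y, is_inverse x y) -> is_inverse x (inverse x).
Proof. by move=> [y h]; rewrite (inverse_eq h). Qed.

Lemma is_inverseM x x' y y' : is_inverse x y -> is_inverse x' y' ->
  is_inverse (x * x') (y' * y).
Proof.
move=> [h1 h2] [h3 h4]; split.
  by rewrite mulrA -(mulrA x) h3 mulr1.
by rewrite mulrA -(mulrA y') h2 mulr1.
Qed.

End Inverses.

Record banach_alg_norm (R : realType) (B : topStarAlgType R) (N : B -> R) : Prop :=
  BanachAlgNorm {
  ban : banach_norm N;
  banM : forall x y, N (x * y) <= N x * N y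
}.

Section BanachAlgebra.
Variables (R : realType) (B : topStarAlgType R) (N : B -> R).
Hypothesis BA : banach_alg_norm N.
Let BN : banach_norm N := ban BA.
Implicit Types a x y : B.

Lemma ban_expr a i : N (a ^+ i) <= (1 + N 1) * N a ^+ i.
Proof.
have n0 := bn_ge0 BN a; have n1 := bn_ge0 BN 1.
elim: i => [|i IH]; first by rewrite !expr0 mulr1; lra.
rewrite !exprS mulrCA; apply: le_trans (banM BA _ _) _.
by rewrite ler_wpM2l.
Qed.

Lemma ban_cvg0 a : N a < 1 -> forall e : R, 0 < e -> exists M : nat,
  forall n, (M <= n)%N -> N a ^+ n < e.
Proof.
move=> a1 e e0; have n0 := bn_ge0 BN a.
have : `|N a| < 1 by rewrite ger0_norm.
move=> /cvg_expr /cvgr0_norm_lt /(_ e e0) [M _ HM]; exists M => n /HM /=.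
by rewrite ger0_norm // exprn_ge0.
Qed.

(** The inverse is the sum of the Neumann series. *)
Lemma neumann a : N a < 1 -> exists b, is_inverse (1 - a) b.
Proof.
move=> a1; have n0 := bn_ge0 BN a; have n1 := bn_ge0 BN 1.
have d0 : 0 < 1 - N a by lra.
pose u n := \sum_(i < n) a ^+ i.
have uE n : (1 - a) * u n = 1 - a ^+ n.
  rewrite /u mulr_sumr; elim: n => [|n IH]; first by rewrite big_ord0 expr0 subrr.
  by rewrite big_ord_recr /= IH mulrBl mul1r -exprS addrA subrK.
have uE' n : u n * (1 - a) = 1 - a ^+ n.
  rewrite /u mulr_suml; elim: n => [|n IH]; first by rewrite big_ord0 expr0 subrr.
  by rewrite big_ord_recr /= IH mulrBr mulr1 -exprSr addrA subrK.
have step q k : N (u (q + k)%N - u q) <= (1 + N 1) / (1 - N a) * (N a ^+ q - N a ^+ (q + k)).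
  elim: k => [|k IH]; first by rewrite addn0 !subrr (bn0 BN) mulr0.
  have -> : u (q + k.+1)%N - u q = (u (q + k)%N - u q) + a ^+ (q + k).
    by rewrite addnS /u big_ord_recr /= addrAC.
  apply: le_trans (bnD BN _ _) _.
  apply: le_trans (lerD IH (ban_expr _ _)) _.
  rewrite addnS exprS le_eqVlt; apply/orP; left; apply/eqP; field; lra.
have K0 : 0 < (1 + N 1) / (1 - N a) by rewrite divr_gt0 //; lra.
have [e e0|l Hl] := bn_complete BN (u := u).
  have [M HM] := ban_cvg0 a1 (divr_gt0 e0 K0).
  have bound q k : (M <= q)%N -> N (u (q + k)%N - u q) < e.
    move=> /HM h; apply: le_lt_trans (step q k) _.
    rewrite ltr_pdivlMr // in h; have := exprn_ge0 (q + k) n0.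
    move: h; set K := _ / _ in K0 *; nra.
  exists M => p q Mp Mq; have [pq|qp] := leqP p q.
    by rewrite -(subnKC pq) (bnB BN); exact: bound.
  by rewrite -(subnKC (ltnW qp)); exact: bound.
move/(bn_cvgP BN): Hl => Hl.
have zero x (c : R) : (forall n, N x <= c * N (l - u n) + N (a ^+ n)) -> 0 <= c -> x = 0.
  move=> Hx c0; apply: (bn_eq0 BN); apply/eqP; rewrite eq_le (bn_ge0 BN) andbT.
  apply/ler_addgt0Pr => e e0; rewrite add0r.
  have c1 : 0 < 2 * (c + 1) by lra.
  have [M1 _ HM1] := Hl _ (divr_gt0 e0 c1).
  have c2 : 0 < 2 * (1 + N 1) by lra.
  have [M2 HM2] := ban_cvg0 a1 (divr_gt0 e0 c2).
  pose n := maxn M1 M2; apply: le_trans (Hx n) _.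
  have h1 := HM1 n (leq_maxl _ _); have h2 := HM2 n (leq_maxr _ _).
  rewrite /= ltr_pdivlMr // in h1; rewrite ltr_pdivlMr // in h2.
  have := ban_expr a n; have := bn_ge0 BN (l - u n); nra.
exists l; split; apply/eqP; rewrite -subr_eq0; apply/eqP.
  apply: (zero _ (N (1 - a))); last exact: (bn_ge0 BN).
  move=> n; have -> : (1 - a) * l - 1 = (1 - a) * (l - u n) + - a ^+ n.
    by rewrite mulrBr uE -addrA -opprD subrK.
  by apply: le_trans (bnD BN _ _) _; rewrite (bnN BN) lerD2r (banM BA).
apply: (zero _ (N (1 - a))); last exact: (bn_ge0 BN).
move=> n; have -> : l * (1 - a) - 1 = (l - u n) * (1 - a) + - a ^+ n.
  by rewrite mulrBl uE' -addrA -opprD subrK.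
by apply: le_trans (bnD BN _ _) _; rewrite (bnN BN) lerD2r mulrC (banM BA).
Qed.

Lemma spectrum_bounded a (z : R[i]) : spectrum a z -> nc z <= N a.
Proof.
move=> sz; rewrite leNgt; apply/negP => az; apply: sz.
have n0 := bn_ge0 BN a.
have z0 : z != 0 by rewrite -nc_gt0; lra.
have [|b hb] := @neumann (z^-1 *: a).
  by rewrite (bnZ BN) ncV mulrC ltr_pdivrMr ?mul1r //; lra.
exists (z^-1 *: b).
have E : z%:A - a = z *: (1 - z^-1 *: a) by rewrite scalerBr scalerA mulfV // scale1r.
rewrite E; case: hb => h1 h2; split.
  by rewrite -scalerAl -scalerAr h1 scalerA mulfV // scale1r.
by rewrite -scalerAl -scalerAr h2 scalerA mulVf // scale1r.
Qed.

(** The Neumann series for [1 - z *: k], which is [z%:A - a] up to the factor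
    [- a]. *)
Lemma spectrum_away0 a k (z : R[i]) : is_inverse a k -> spectrum a z ->
  1 <= nc z * N k.
Proof.
move=> hk sz; rewrite leNgt; apply/negP => zk; apply: sz.
have [|b hb] := @neumann (z *: k); first by rewrite (bnZ BN).
have hn : is_inverse (- a) (- k) by case: hk => h1 h2; split; rewrite mulrNN.
exists (b * - k); have := is_inverseM hn hb.
rewrite (_ : - a * (1 - z *: k) = z%:A - a) //.
by case: hk => h1 _; rewrite mulrBr mulr1 mulNr opprK -scalerAr h1 addrC.
Qed.

(** From the resolvent identity, once the Neumann series has bounded the
    resolvents near [z]. *)
Lemma resolvent_continuous a (z : R[i]) : ~ spectrum a z ->
  ncont N (fun w => inverse ((w : R[i])%:A - a)) z.
Proof.
move=> /contrapT [y hy] e e0; pose f (w : R[i]) : B := inverse (w%:A - a).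
have n0 := bn_ge0 BN y.
have fz : f z = y := inverse_eq hy.
have c0 : 0 < 2 * N y + 1 by lra.
have c1 : 0 < 2 * N y ^+ 2 + 1 by have := sqr_ge0 (N y); lra.
exists (Num.min (2 * N y + 1)^-1 (e / (2 * N y ^+ 2 + 1))).
  by rewrite lt_min invr_gt0 c0 divr_gt0.
move=> w; rewrite lt_min => /andP[h1 h2].
rewrite -[inverse _]/(f w) -[X in _ - X]/(f z) fz.
have w0 := nc_ge0 (w - z).
rewrite -div1r ltr_pdivlMr // in h1; rewrite ltr_pdivlMr // in h2.
have ywz : N ((z - w) *: y) < 1 by rewrite (bnZ BN) ncB; nra.
have [b hb] := neumann ywz.
have hw : is_inverse (w%:A - a) (f w).
  apply: inverseP; exists (b * y); have := is_inverseM hy hb.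
  rewrite (_ : (z%:A - a) * (1 - (z - w) *: y) = w%:A - a) //.
  case: hy => h3 _; rewrite mulrBr mulr1 -scalerAr h3 scalerBl opprB.
  by rewrite addrC subrKA.
have E : f w - y = (z - w) *: (f w * y).
  have -> : f w - y = f w * ((z%:A - a) - (w%:A - a)) * y.
    by rewrite mulrBr mulrBl -mulrA hy.1 mulr1 hw.2 mul1r.
  rewrite opprB addrA subrK -scalerBl.
  by rewrite -scalerAr mulr1 scalerAl.
have E1 : N (f w - y) <= nc (w - z) * (N (f w) * N y).
  by rewrite E (bnZ BN) ncB ler_wpM2l // (banM BA).
have E2 := bn_sub_le BN (f w) y.
have m0 := bn_ge0 BN (f w).
have E3 : N (f w) <= 2 * N y by nra.
apply: le_lt_trans E1 _; apply: le_lt_trans h2.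
by rewrite ler_wpM2l //; nra.
Qed.

End BanachAlgebra.

(** * The norms of a C*-algebra and of its matrix algebras *)

Section Norms.
Variables (R : realType) (A : cstarAlgType R).

Lemma cnorm_banach : banach_alg_norm (@cnorm R A).
Proof.
split; last exact: cnormM.
split; [exact: cnorm_eq0 | exact: cnormD | exact: cnormZ | exact: cnorm_nbhs |].
exact: cnorm_complete.
Qed.

Variable n : nat.

(** Equivalent to the C*-norm of the matrix algebra; spectra, resolvents and
    integrals only depend on the norm up to equivalence. *)
Definition mxnorm (a : cmx A n.+1) : R := \sum_i \sum_j cnorm (a i j).

Let BA := ban cnorm_banach.

Lemma mxnorm_ge_entry (a : cmx A n.+1) i j : cnorm (a i j) <= mxnorm a.
Proof.
rewrite /mxnorm (bigD1 i) //= (bigD1 j) //= -addrA lerDl.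
by rewrite addr_ge0 // sumr_ge0 // => k _; rewrite ?sumr_ge0 // => *; exact: (bn_ge0 BA).
Qed.

Lemma mxnorm_lt (a : cmx A n.+1) (e : R) : 0 < e ->
  (forall i j, cnorm (a i j) < e / (n.+1 * n.+1)%:R) -> mxnorm a < e.
Proof.
move=> e0 H; pose d := e / (n.+1 * n.+1)%:R.
have -> : e = \sum_(i < n.+1) \sum_(j < n.+1) d.
  rewrite !sumr_const !card_ord -mulrnA -mulr_natr /d divfK //.
apply: ltr_sum => [|i _]; first by apply/hasP; exists ord0; rewrite ?mem_index_enum.
apply: ltr_sum => [|j _]; first by apply/hasP; exists ord0; rewrite ?mem_index_enum.
exact: H.
Qed.

Lemma mxnorm_banach : banach_alg_norm mxnorm.
Proof.
have bA := BA.
split; last first.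
  move=> a b; rewrite /mxnorm mulr_suml; apply: ler_sum => i _.
  apply: (@le_trans _ _ (\sum_j \sum_k cnorm (a i k) * cnorm (b k j))).
    apply: ler_sum => j _; rewrite mxE; apply: le_trans (bn_sum BA _ _) _.
    by apply: ler_sum => k _; exact: cnormM.
  rewrite exchange_big /= mulr_suml; apply: ler_sum => k _.
  rewrite -mulr_sumr ler_wpM2l ?(bn_ge0 BA) //.
  rewrite [leRHS](bigD1 k) //= lerDl sumr_ge0 // => l _.
  by rewrite sumr_ge0 // => *; exact: (bn_ge0 BA).
have N0 (a : cmx A n.+1) : mxnorm a = 0 -> a = 0.
  move=> a0; apply/matrixP => i j; rewrite mxE; apply: cnorm_eq0; apply/eqP.
  by rewrite eq_le (bn_ge0 BA) andbT -a0 mxnorm_ge_entry.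
split.
- exact: N0.
- move=> a b; rewrite /mxnorm -big_split /=; apply: ler_sum => i _.
  rewrite -big_split /=; apply: ler_sum => j _; rewrite mxE; exact: cnormD.
- move=> z a; rewrite /mxnorm mulr_sumr; apply: eq_bigr => i _.
  by rewrite mulr_sumr; apply: eq_bigr => j _; rewrite mxE cnormZ.
- move=> a; apply/seteqP; split => P.
    move=> [Q HQ QP]; pose HQ' i j := HQ i j.
    have /choice [f Hf] : forall ij : 'I_n.+1 * 'I_n.+1, exists e : R, 0 < e /\
        [set y | cnorm (a ij.1 ij.2 - y) < e] `<=` Q ij.1 ij.2.
      move=> [i j]; have := HQ i j; rewrite cnorm_nbhs => -[e /= e0 eQ].
      by exists e.
    pose e := \big[Num.min/1]_(ij : 'I_n.+1 * 'I_n.+1) f ij.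
    have e0 : 0 < e.
      by apply: lt_bigmin => // ij _; have [] := Hf ij.
    exists e => //= b ab; apply: QP => i j.
    have [_] := Hf (i, j); apply => /=.
    have : cnorm ((a - b) i j) < e := le_lt_trans (mxnorm_ge_entry _ _ _) ab.
    rewrite !mxE => /lt_le_trans; apply; exact: bigmin_le_cond.
  move=> [e /= e0 HP]; pose d := e / (n.+1 * n.+1)%:R.
  have d0 : 0 < d by rewrite divr_gt0 // ltr0n muln_gt0.
  exists (fun i j => [set y | cnorm (a i j - y) < d]).
    by move=> i j; rewrite cnorm_nbhs; exists d.
  move=> b Hb; apply: HP => /=; apply: mxnorm_lt => // i j.
  by rewrite !mxE; exact: Hb.
move=> u Hu.
have /choice [l Hl] : forall ij : 'I_n.+1 * 'I_n.+1, exists l : A,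
    (fun k => u k ij.1 ij.2) @ \oo --> l.
  move=> [i j]; apply: cnorm_complete => e /Hu [M HM]; exists M => p q Mp Mq.
  apply: le_lt_trans (HM p q Mp Mq).
  by have := mxnorm_ge_entry (u p - u q) i j; rewrite !mxE.
exists (\matrix_(i, j) l (i, j)) => P [Q HQ QP].
suff : \forall k \near \oo, P (u k) by [].
have H : \forall k \near \oo, forall ij : 'I_n.+1 * 'I_n.+1, Q ij.1 ij.2 (u k ij.1 ij.2).
  apply: filter_forall => -[i j]; apply: (Hl (i, j)).
  by have := HQ i j; rewrite mxE.
by apply: filterS H => k Hk; apply: QP => i j; exact: (Hk (i, j)).
Qed.

End Norms.

(** * The decay of powers of a quasi-nilpotent element *)

(** The compactness of discs, through the square that contains the disc. *)
Lemma locally_bounded_disc (R : realType) (f : R[i] -> R) :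
  (forall z, exists2 r : R, 0 < r & exists M : R, forall w, nc (w - z) < r -> f w <= M) ->
  forall rho : R, exists M : R, forall w, nc w <= rho -> f w <= M.
Proof.
move=> H rho; pose I := `[- rho, rho]%classic : set R.
have cI : compact I by exact: segment_compact.
have /compact_near_coveringP NC : compact (I `*` I) := compact_setX cI cI.
have [|M [_ HM]] := @NC R (pinfty_nbhs R) (fun M x => f (x.1 +i* x.2) <= M) _.
  move=> [a b] _; have [r r0 [M HM]] := H (a +i* b).
  have r2 : 0 < r / 2 by rewrite divr_gt0.
  exists (ball (a, b) (r / 2), [set M' | M <= M']) => /=.
    split; first exact: nbhsx_ballx.
    exists M; split => //; first exact: num_real.
    by move=> M' /ltW.
  move=> [[x y] M'] /= [[/= h1 h2] MM']; apply: le_trans MM'; apply: HM.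
  apply: le_lt_trans (nc_le _) _; rewrite ReD ReN ImD ImN /=.
  by rewrite /ball /= distrC in h1; rewrite /ball /= distrC in h2; lra.
exists (M + 1) => w wr; have := HM (M + 1); rewrite ltrDl ltr01 => /(_ isT).
move=> /(_ (complex.Re w, complex.Im w)) /=.
have -> : complex.Re w +i* complex.Im w = w by case: (w).
apply; split; rewrite /I /= in_itv /= -ler_norml.
  exact: le_trans (Re_le_nc w) wr.
exact: le_trans (Im_le_nc w) wr.
Qed.

Section Rickart.
Variables (R : realType) (T : topStarAlgType R) (W : set T) (p : T -> R).
Hypotheses (W1 : W 1) (WD : forall x y, W x -> W y -> W (x + y))
  (WZ : forall (z : R[i]) x, W x -> W (z *: x))
  (WM : forall x y, W x -> W y -> W (x * y))
  (WC : forall x y, W x -> W y -> x * y = y * x)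
  (p_ge0 : forall x, W x -> 0 <= p x)
  (pD : forall x y, W x -> W y -> p (x + y) <= p x + p y)
  (pZ : forall (z : R[i]) x, W x -> p (z *: x) <= nc z * p x)
  (pM : forall x y, W x -> W y -> p (x * y) <= p x * p y).

Let WN x : W x -> W (- x). Proof. by move=> /(WZ (-1)); rewrite scaleN1r. Qed.
Let WB x y : W x -> W y -> W (x - y).
Proof. by move=> Wx Wy; apply: WD => //; exact: WN. Qed.
Let WX x n : W x -> W (x ^+ n).
Proof. by move=> Wx; elim: n => [|n IH]; rewrite ?expr0 // exprS; exact: WM. Qed.
Let pN x : W x -> p (- x) <= p x.
Proof. by move=> /(pZ (-1)); rewrite scaleN1r ncN Normc.normc1 mul1r. Qed.
Let pB x y : W x -> W y -> p (x - y) <= p x + p y.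
Proof.
move=> Wx Wy; apply: le_trans (pD Wx (WN Wy)) _; rewrite lerD2l; exact: pN.
Qed.

(* all identities hold modulo the null space of the seminorm [p] *)
Let right_inv (a y : T) := W y /\ p (a * y - 1) <= 0.

Let resolvent_diff x (l m : R[i]) y z : W x -> right_inv (1 - l *: x) y ->
  right_inv (1 - m *: x) z -> p (y - z) <= nc (l - m) * (p y * p x * p z).
Proof.
move=> Wx [Wy hy] [Wz hz].
have Wl : W (1 - l *: x) by apply: WB => //; exact: WZ.
have Wm : W (1 - m *: x) by apply: WB => //; exact: WZ.
have E : y - z = ((1 - l *: x) * y - 1) * z - y * ((1 - m *: x) * z - 1)
    + (l - m) *: (y * x * z).
  have -> : (l - m) *: (y * x * z) = y * ((1 - m *: x) * z) - (1 - l *: x) * y * z.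
    have E1 : (1 - m *: x) - (1 - l *: x) = (l - m) *: x.
      by rewrite opprB addrC subrKA -scalerBl.
    by rewrite (WC Wl Wy) mulrA -mulrBl -mulrBr E1 -scalerAr scalerAl.
  by rewrite mulrBl mulrBr mulr1 mul1r opprB -[RHS]addrA subrKA addrC subrKA.
have Wxz : W (y * x * z) by do 2!apply: WM => //.
have W2 : W (((1 - l *: x) * y - 1) * z) by apply: WM => //; apply: WB => //; exact: WM.
have W3 : W (y * ((1 - m *: x) * z - 1)) by apply: WM => //; apply: WB => //; exact: WM.
rewrite E; apply: le_trans (pD (WB W2 W3) (WZ _ Wxz)) _.
have y0 := p_ge0 Wy; have z0 := p_ge0 Wz; have x0 := p_ge0 Wx.
have h1 : p (((1 - l *: x) * y - 1) * z) <= 0.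
  by apply: le_trans (pM _ _) _ => //; [apply: WB => //; exact: WM | rewrite mulr_le0_ge0].
have h2 : p (y * ((1 - m *: x) * z - 1)) <= 0.
  by apply: le_trans (pM _ _) _ => //; [apply: WB => //; exact: WM | rewrite mulr_ge0_le0].
have h3 := pB W2 W3; have h4 := pZ (l - m) Wxz.
have h5 : p (y * x * z) <= p y * p x * p z.
  apply: le_trans (pM (WM Wy Wx) Wz) _; apply: ler_wpM2r => //; exact: pM.
have := ler_wpM2l (nc_ge0 (l - m)) h5; lra.
Qed.

Let right_inv_bounded x (Rf : R[i] -> T) : W x ->
  (forall l, right_inv (1 - l *: x) (Rf l)) ->
  forall rho : R, exists M, forall l, nc l <= rho -> p (Rf l) <= M.
Proof.
move=> Wx HR; apply: locally_bounded_disc => z.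
have Wz := (HR z).1; have z0 := p_ge0 Wz; have x0 := p_ge0 Wx.
have c0 : 0 < 2 * (p x * p (Rf z)) + 1 by have := mulr_ge0 x0 z0; lra.
exists (2 * (p x * p (Rf z)) + 1)^-1; first by rewrite invr_gt0.
exists (2 * p (Rf z)) => w; rewrite -div1r ltr_pdivlMr // => h.
have Ww := (HR w).1; have w0 := p_ge0 Ww.
have := resolvent_diff Wx (HR w) (HR z).
have : p (Rf w) <= p (Rf z) + p (Rf w - Rf z).
  by have := pD Wz (WB Ww Wz); rewrite addrC subrK addrC.
rewrite (_ : nc (w - z) * (p (Rf w) * p x * p (Rf z)) =
   p (Rf w) * (nc (w - z) * (p x * p (Rf z)))); last by ring.
have n0 := nc_ge0 (w - z).
have m0 := mulr_ge0 x0 z0.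
set a := p x * p (Rf z) in h c0 m0 *.
have : nc (w - z) * a <= 2^-1 by lra.
nra.
Qed.

(** Averaging the resolvents at the two square roots of a number gives a
    resolvent of [x ^+ 2]; iterating, the inverses of [1 - c x ^+ (2 ^ k)] are
    as uniformly continuous in the radius as those of [1 - c x]. *)
Let averaged_resolvents x (rho C : R) :
  (forall l m, nc l <= rho -> nc m <= rho -> exists y z,
     [/\ right_inv (1 - l *: x) y, right_inv (1 - m *: x) z &
         p (y - z) <= C * nc (l - m)]) -> W x ->
  forall k (s s' : R) (u : R[i]), 0 <= s <= rho -> 0 <= s' <= rho -> nc u = 1 ->
  exists y z, [/\ right_inv (1 - (s%:C ^+ (2 ^ k) * u) *: x ^+ (2 ^ k)) y,
    right_inv (1 - (s'%:C ^+ (2 ^ k) * u) *: x ^+ (2 ^ k)) z &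
    p (y - z) <= C * `|s - s'|].
Proof.
move=> Hx Wx k s s' u /andP[s0 s1] /andP[s0' s1'].
elim: k u => [|k IH] u u1.
  have [||y [z [hy hz hyz]]] := Hx (s%:C * u) (s'%:C * u).
  - by rewrite ncM u1 mulr1 ncR ger0_norm.
  - by rewrite ncM u1 mulr1 ncR ger0_norm.
  exists y, z; rewrite !expn0 !expr1; split => //.
  by move: hyz; rewrite -mulrBl -realcB ncM u1 mulr1 ncR.
pose w := sqrtc u; have w2 : w ^+ 2 = u := sqr_sqrtc u.
have w1 : nc w = 1.
  have /eqP : nc w ^+ 2 = 1 by rewrite -ncX w2.
  rewrite sqrf_eq1 => /orP[/eqP //|/eqP h].
  by have := nc_ge0 w; rewrite h oppr_ge0 ler10.
have [y1 [z1 [hy1 hz1 h1]]] := IH w w1.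
have [|y2 [z2 [hy2 hz2 h2]]] := IH (- w); first by rewrite ncN.
pose X := x ^+ (2 ^ k); have WX' : W X by exact: WX.
have half (c : R[i]) a b : right_inv (1 - (c * w) *: X) a ->
    right_inv (1 - (c * - w) *: X) b ->
    right_inv (1 - (c ^+ 2 * u) *: X ^+ 2) (2^-1 *: (a + b)).
  move=> [Wa ha] [Wb hb]; split; first by apply: WZ; exact: WD.
  have Wt : W ((c * w) *: X) by exact: WZ.
  set t := (c * w) *: X in ha Wt *.
  have tN : (c * - w) *: X = - t by rewrite mulrN scaleNr.
  rewrite tN opprK in hb.
  have -> : (c ^+ 2 * u) *: X ^+ 2 = t * t.
    have -> : t * t = (c * w * (c * w)) *: (X * X).
      by rewrite /t -scalerAl -scalerAr scalerA.
    by rewrite -w2 (expr2 X); congr (_ *: _); ring.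
  have Wp : W (1 + t) by exact: WD.
  have Wm : W (1 - t) by exact: WB.
  have E : (1 - t * t) * (2^-1 *: (a + b)) - 1 =
      2^-1 *: ((1 + t) * ((1 - t) * a - 1) + (1 - t) * ((1 + t) * b - 1)).
    have f1 : (1 + t) * (1 - t) = 1 - t * t.
      by rewrite mulrBr mulr1 mulrDl mul1r opprD addrA addrK.
    have f2 : (1 - t) * (1 + t) = 1 - t * t by rewrite (WC Wm Wp) f1.
    rewrite !mulrBr !mulrA f1 f2 !mulr1 addrACA -mulrDr -opprD.
    have -> : 1 + t + (1 - t) = (2 : R[i]) *: 1.
      by rewrite addrACA subrr addr0 -[in RHS](natr1 1) scalerDl scale1r.
    by rewrite scalerBr scalerA mulVf ?pnatr_eq0 // scale1r scalerAr.
  have W2 : W ((1 - t) * a - 1) by apply: WB => //; exact: WM.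
  have W3 : W ((1 + t) * b - 1) by apply: WB => //; exact: WM.
  rewrite E; apply: le_trans (pZ _ _) _; first by apply: WD; exact: WM.
  apply: mulr_ge0_le0; first exact: nc_ge0.
  apply: le_trans (pD _ _) _; [exact: WM | exact: WM |].
  rewrite -[leRHS]addr0; apply: lerD; (apply: le_trans (pM _ _) _ => //);
    by apply: mulr_ge0_le0 => //; exact: p_ge0.
exists (2^-1 *: (y1 + y2)), (2^-1 *: (z1 + z2)).
rewrite !expnSr !exprM; split; [exact: half | exact: half |].
have Wy1 := hy1.1; have Wy2 := hy2.1; have Wz1 := hz1.1; have Wz2 := hz2.1.
rewrite -scalerBr opprD addrACA.
apply: le_trans (pZ _ _) _; first by apply: WD; exact: WB.
have := pD (WB Wy1 Wz1) (WB Wy2 Wz2).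
have -> : nc (2^-1 : R[i]) = 2^-1.
  have -> : 2^-1 = (2^-1)%:C :> R[i].
    by apply: (@mulfI _ 2); rewrite ?pnatr_eq0 // mulfV ?pnatr_eq0 //
       -[2 in RHS]/(2%:R) -(rmorph_nat (real_complex R)) -rmorphM /= mulfV ?pnatr_eq0.
  by rewrite ncR ger0_norm // invr_ge0.
lra.
Qed.

Let small x (s : R) := exists K : nat, forall k, (K <= k)%N ->
  s ^+ (2 ^ k) * p (x ^+ (2 ^ k)) <= 1.

(** If the inverse of [1 - c x ^+ (2 ^ k)] is close to 1 at radius [s1], by
    uniform continuity it is still close to 1 at radius [s2], which may be a
    little larger; then [c x ^+ (2 ^ k)] is small there too. *)
Let small_step x (rho C s s1 s2 : R) : W x ->
  (forall k (s s' : R) (u : R[i]), 0 <= s <= rho -> 0 <= s' <= rho -> nc u = 1 ->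
  exists y z, [/\ right_inv (1 - (s%:C ^+ (2 ^ k) * u) *: x ^+ (2 ^ k)) y,
    right_inv (1 - (s'%:C ^+ (2 ^ k) * u) *: x ^+ (2 ^ k)) z &
    p (y - z) <= C * `|s - s'|]) ->
  small x s -> 0 <= s1 -> s1 < s \/ s1 = 0 -> s1 <= rho -> 0 <= s2 <= rho ->
  C * `|s1 - s2| <= 8^-1 -> small x s2.
Proof.
move=> Wx Hav [K HK] s10 s1s s1r s2r Cs.
have q0 := p_ge0 W1.
(* below a good radius the powers tend to 0 *)
have [K' HK'] : exists K' : nat, forall k, (K' <= k)%N ->
    s1 ^+ (2 ^ k) * p (x ^+ (2 ^ k)) <= (8 * (p 1 + 1))^-1.
  have e0 : 0 < (8 * (p 1 + 1))^-1 by rewrite invr_gt0 mulr_gt0 //; lra.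
  case: s1s => [s1s|->]; last first.
    by exists 0%N => k _; rewrite expr0n expn_eq0 /= mul0r ltW.
  have s0 : 0 < s by exact: le_lt_trans s1s.
  have q1 : `|s1 / s| < 1.
    rewrite ger0_norm; last by rewrite divr_ge0 // ltW.
    by rewrite ltr_pdivrMr ?mul1r.
  move: q1 => /cvg_expr /cvgr0_norm_lt /(_ _ e0) [M _ HM].
  exists (maxn K M) => k; rewrite geq_max => /andP[/HK h1 Mk].
  have h2 := HM (2 ^ k)%N (leq_trans Mk (ltnW (ltn_expl _ (ltnSn 1)))).
  rewrite /= ger0_norm in h2; last by rewrite exprn_ge0 // divr_ge0 // ltW.
  have pk := p_ge0 (WX (2 ^ k) Wx).
  have -> : s1 ^+ (2 ^ k) = (s1 / s) ^+ (2 ^ k) * s ^+ (2 ^ k).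
    by rewrite -exprMn divfK // gt_eqF.
  rewrite -mulrA; apply: le_trans (ltW h2).
  by rewrite ler_piMr // exprn_ge0 // divr_ge0 // ltW.
exists K' => k /HK' hk.
have [|y [z [hy hz hyz]]] := Hav k s1 s2 1 _ s2r (Normc.normc1 R).
  by rewrite s10.
have Wy := hy.1; have Wz := hz.1; rewrite !mulr1 in hy hz.
have WXk : W (x ^+ (2 ^ k)) by exact: WX.
have pk := p_ge0 WXk.
pose a1 := s1%:C ^+ (2 ^ k) *: x ^+ (2 ^ k).
pose a2 := s2%:C ^+ (2 ^ k) *: x ^+ (2 ^ k).
have Wa1 : W a1 by exact: WZ.
have Wa2 : W a2 by exact: WZ.
have one (a b : T) : W a -> right_inv (1 - a) b ->
    p (b - 1) <= p a * p b /\ p a <= p (b - 1) + p a * p (b - 1).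
  move=> Wa [Wb hb]; have Wab := WM Wa Wb.
  have Wb1 : W (b - 1) by exact: WB.
  have Wr : W ((1 - a) * b - 1) by apply: WB => //; apply: WM => //; exact: WB.
  split.
    have -> : b - 1 = ((1 - a) * b - 1) + a * b.
      by rewrite mulrBl mul1r addrAC subrK.
    by apply: le_trans (pD Wr Wab) _; have := pM Wa Wb; lra.
  have E : a = (b - 1) - ((1 - a) * b - 1) - a * (b - 1).
    have E0 : (1 - a) * b - 1 = (b - 1) - a * b by rewrite mulrBl mul1r addrAC.
    rewrite E0 mulrBr mulr1 [X in _ = X - _](_ : _ = a * b); last first.
      by rewrite opprB addrC subrK.
    by rewrite opprB addrC subrK.
  have Wa3 : W (a * (b - 1)) by exact: WM.
  have := pB (WB Wb1 Wr) Wa3; rewrite -E.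
  have := pB Wb1 Wr; have := pM Wa Wb1; lra.
have [h1 _] := one a1 y Wa1 hy; have [_ h2] := one a2 z Wa2 hz.
have pa1 : p a1 <= (8 * (p 1 + 1))^-1.
  apply: le_trans (pZ _ WXk) _; rewrite ncX ncR ger0_norm //.
have Wy1 : W (y - 1) by exact: WB.
have Wz1 : W (z - 1) by exact: WB.
have a10 := p_ge0 Wa1; have a20 := p_ge0 Wa2.
have y10 := p_ge0 Wy1; have z10 := p_ge0 Wz1.
have h3 : p y <= p (y - 1) + p 1 by have := pD Wy1 W1; rewrite subrK.
have h4 : p a1 * (8 * (p 1 + 1)) <= 1.
  by rewrite -ler_pdivlMr ?div1r // mulr_gt0 //; lra.
have aq : 0 <= p a1 * p 1 by exact: mulr_ge0.
have k1 : p a1 <= 8^-1 by lra.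
have k2 := ler_wpM2l a10 h3.
have k3 := ler_wpM2r y10 k1.
have h5 : p (y - 1) <= 7^-1 by lra.
have h6 : p (z - 1) <= 7^-1 + 8^-1.
  have -> : z - 1 = (y - 1) - (y - z) by rewrite opprB [RHS]addrC subrKA.
  have := pB Wy1 (WB Wy Wz); lra.
have k4 := ler_wpM2l a20 h6.
have h7 : p a2 <= 1 by lra.
have [s20|s2n0] := eqVneq s2 0.
  by rewrite s20 expr0n expn_eq0 /= mul0r.
have s2p : 0 < s2 by rewrite lt_def s2n0; case/andP: s2r.
have c0 : s2%:C ^+ (2 ^ k) != 0 :> R[i].
  by rewrite expf_neq0 // -nc_gt0 ncR gtr0_norm.
have := pZ (s2%:C ^+ (2 ^ k))^-1 Wa2; rewrite scalerA mulVf // scale1r.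
rewrite ncV ncX ncR gtr0_norm // => h8.
rewrite mulrC -ler_pdivlMr ?exprn_gt0 // div1r; apply: le_trans h8 _.
by rewrite ler_piMr // invr_ge0 exprn_ge0 // ltW.
Qed.

(** If all [1 - l x] are invertible, modulo the null space of the seminorm,
    then the powers of [x] decay faster than any geometric sequence.  This is
    the part of the spectral radius formula that needs no complex analysis. *)
Lemma powers_decay x : W x ->
  (forall l : R[i], exists2 y, W y & p ((1 - l *: x) * y - 1) <= 0) ->
  forall rho : R, 0 <= rho -> exists K : nat, forall k, (K <= k)%N ->
    rho ^+ (2 ^ k) * p (x ^+ (2 ^ k)) <= 1.
Proof.
move=> Wx Hx rho r0.
have /choice [Rf HR] : forall l : R[i], exists y, right_inv (1 - l *: x) y.
  by move=> l; have [y h1 h2] := Hx l; exists y.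
have [M HM] := right_inv_bounded Wx HR rho.
have M0 : 0 <= M by apply: le_trans (p_ge0 (HR 0).1) (HM 0 _); rewrite nc0.
have x0 := p_ge0 Wx.
pose C := M ^+ 2 * p x.
have C0 : 0 <= C by rewrite mulr_ge0 // sqr_ge0.
have Hres l m : nc l <= rho -> nc m <= rho -> exists y z,
    [/\ right_inv (1 - l *: x) y, right_inv (1 - m *: x) z &
         p (y - z) <= C * nc (l - m)].
  move=> hl hm; exists (Rf l), (Rf m); split => //.
  apply: le_trans (resolvent_diff Wx (HR l) (HR m)) _.
  rewrite [leRHS]mulrC ler_wpM2l ?nc_ge0 //.
  have a0 := p_ge0 (HR l).1; have b0 := p_ge0 (HR m).1.
  by rewrite /C expr2 mulrAC ler_wpM2r // ler_pM ?HM.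
have step := fun s s1 s2 => @small_step x rho C s s1 s2 Wx (averaged_resolvents Hres Wx).
(* [J] steps of length [d] lead from 0 to [rho]; at each of them [small_step]
   compares radii [2 * d] apart, whence the factor 16 = 2 * 8 *)
pose J := (Num.truncn (16 * C * rho)).+1.
have J0 : 0 < J%:R :> R by rewrite ltr0n.
have HJ : 16 * C * rho <= J%:R by apply: ltW; exact: truncnS_gt.
pose d := rho / J%:R; have d0 : 0 <= d by rewrite divr_ge0 // ltW.
have dr : J%:R * d = rho by rewrite /d mulrC divfK // gt_eqF.
have Cd : C * (2 * d) <= 8^-1.
  rewrite -(ler_pM2l J0) (_ : J%:R * (C * (2 * d)) = 2 * C * (J%:R * d)); last by ring.
  rewrite dr; lra.
have le_rho j : (j <= J)%N -> 0 <= j%:R * d <= rho.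
  move=> jJ; rewrite mulr_ge0 //= -dr ler_wpM2r // ler_nat //.
suff H j : (j <= J)%N -> small x (j%:R * d) by have := H J (leqnn J); rewrite dr.
elim: j => [|j IH] jJ.
  by exists 0%N => k _; rewrite mul0r expr0n expn_eq0 /= mul0r.
have Hj := IH (ltnW jJ).
apply: (step (j%:R * d) (j.-1%:R * d)) => //.
- by rewrite mulr_ge0.
- case: (j) => [|i]; first by right; rewrite mul0r.
  have [->|dn] := eqVneq d 0; first by right; rewrite mulr0.
  by left; rewrite /= ltr_pM2r ?ltr_nat // lt_def dn.
- have /le_rho /andP[] // : (j.-1 <= J)%N by rewrite (leq_trans (leq_pred _)) // ltnW.
- exact: le_rho.
rewrite -mulrBl normrM (ger0_norm d0).
apply: le_trans Cd; apply: ler_wpM2l => //; apply: ler_wpM2r => //.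
rewrite distrC ger0_norm; last by rewrite subr_ge0 ler_nat (leq_trans (leq_pred _)).
by case: (j) => [|i] /=; rewrite -?natr1; lra.
Qed.

End Rickart.

(** * Characters of a commutative Banach algebra *)

Section Ideals.
Variables (R : realType) (T : topStarAlgType R) (N : T -> R).
Hypothesis BA : banach_alg_norm N.
Let BN : banach_norm N := ban BA.

(** Commutative subalgebras that contain the inverses of their elements, as
    bicommutants do. *)
Record full_commutative (S : set T) : Prop := FullCommutative {
  fc1 : S 1;
  fcD : forall x y, S x -> S y -> S (x + y);
  fcZ : forall (z : R[i]) x, S x -> S (z *: x);
  fcM : forall x y, S x -> S y -> S (x * y);
  fcC : forall x y, S x -> S y -> x * y = y * x;
  fcV : forall x y, S x -> is_inverse x y -> S y
}.

Record character (S : set T) (chi : T -> R[i]) : Prop := Character {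
  chi1 : chi 1 = 1;
  chiD : forall x y, S x -> S y -> chi (x + y) = chi x + chi y;
  chiZ : forall (z : R[i]) x, S x -> chi (z *: x) = z * chi x;
  chiM : forall x y, S x -> S y -> chi (x * y) = chi x * chi y;
  chi_le : forall x, S x -> nc (chi x) <= N x
}.

Variable S : set T.
Hypothesis FS : full_commutative S.

Lemma fc0 : S 0.
Proof. by have := fcZ FS 0 (fc1 FS); rewrite scale0r. Qed.

Lemma fcN x : S x -> S (- x).
Proof. by move=> /(fcZ FS (-1)); rewrite scaleN1r. Qed.

Lemma fcB x y : S x -> S y -> S (x - y).
Proof. by move=> Sx Sy; apply: (fcD FS) => //; exact: fcN. Qed.

Lemma fcX x n : S x -> S (x ^+ n).
Proof.
by move=> Sx; elim: n => [|n IH]; rewrite ?expr0 ?exprS; [exact: fc1 | exact: fcM].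
Qed.

Record proper_ideal (J : set T) : Prop := ProperIdeal {
  piS : forall x, J x -> S x;
  piD : forall x y, J x -> J y -> J (x + y);
  piM : forall x y, J x -> S y -> J (x * y);
  pi1 : ~ J 1
}.

Section MaximalIdeal.
Variable J : set T.
Hypotheses (PJ : proper_ideal J) (J0 : J 0)
  (Jmax : forall b, S b -> ~ J b -> exists2 y, S y & J (b * y - 1)).

Let JM x y : S x -> J y -> J (x * y).
Proof. by move=> Sx Jy; rewrite (fcC FS) //; [exact: (piM PJ) | exact: (piS PJ)]. Qed.
Let JZ (z : R[i]) x : J x -> J (z *: x).
Proof.
by move=> Jx; rewrite -[x]mulr1 scalerAr; apply: (piM PJ) => //; exact: (fcZ FS _ (fc1 FS)).
Qed.
Let JN x : J x -> J (- x).
Proof. by move=> /(JZ (-1)); rewrite scaleN1r. Qed.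
Let JB x y : J x -> J y -> J (x - y).
Proof. by move=> Jx Jy; apply: (piD PJ) => //; exact: JN. Qed.

(** Elements near 1 are invertible, so a proper ideal stays away from 1. *)
Lemma near1_not_in_ideal j : J j -> 1 <= N (1 - j).
Proof.
move=> Jj; rewrite leNgt; apply/negP => /(neumann BA) [b].
rewrite opprB addrC subrK => hb.
apply: (pi1 PJ); rewrite -hb.1; apply: (piM PJ) => //.
exact: (fcV FS (piS PJ Jj) hb).
Qed.

(** The seminorm of the quotient by [J]. *)
Let q x : R := inf [set N (x - j) | j in J].

Let q_has_inf x : has_inf [set N (x - j) | j in J].
Proof.
split; first by exists (N (x - 0)); exists 0.
by exists 0 => _ [j _ <-]; exact: (bn_ge0 BN).
Qed.

Let q_le x j : J j -> q x <= N (x - j).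
Proof. by move=> Jj; apply: ge_inf; [exact: (q_has_inf x).2 | exists j]. Qed.

Let q_ge0 x : 0 <= q x.
Proof.
apply: lb_le_inf; first exact: (q_has_inf x).1.
by move=> _ [j _ <-]; exact: (bn_ge0 BN).
Qed.

Let q_adh x (e : R) : 0 < e -> exists2 j, J j & N (x - j) < q x + e.
Proof.
by move=> e0; have [_ [j Jj <-] h] := inf_adherent e0 (q_has_inf x); exists j.
Qed.

Let q_J j : J j -> q j <= 0.
Proof. by move=> Jj; have := q_le j Jj; rewrite subrr (bn0 BN). Qed.

Let qD x y : q (x + y) <= q x + q y.
Proof.
apply/ler_addgt0Pr => e e0; have e2 : 0 < e / 2 by rewrite divr_gt0.
have [j Jj hj] := q_adh x e2; have [k Jk hk] := q_adh y e2.
apply: le_trans (q_le _ (piD PJ Jj Jk)) _; rewrite opprD addrACA.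
by apply: le_trans (bnD BN _ _) _; lra.
Qed.

Let qZ (z : R[i]) x : q (z *: x) <= nc z * q x.
Proof.
apply/ler_addgt0Pr => e e0; have n0 := nc_ge0 z.
have c0 : 0 < nc z + 1 by lra.
have [j Jj hj] := q_adh x (divr_gt0 e0 c0).
apply: le_trans (q_le _ (JZ z Jj)) _; rewrite -scalerBr (bnZ BN).
apply: le_trans (ler_wpM2l n0 (ltW hj)) _; rewrite mulrDr lerD2l.
by rewrite mulrCA ler_piMr ?(ltW e0) // ler_pdivrMr // mul1r; lra.
Qed.

Let qM x y : S x -> S y -> q (x * y) <= q x * q y.
Proof.
move=> Sx Sy; apply/ler_addgt0Pr => e e0.
have x0 := q_ge0 x; have y0 := q_ge0 y.
have c0 : 0 < q x + q y + 1 by lra.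
pose d := Num.min 1 (e / (q x + q y + 1)).
have d0 : 0 < d by rewrite lt_min ltr01 divr_gt0.
have d1 : d <= 1 by rewrite ge_min lexx.
have d2 : d * (q x + q y + 1) <= e by rewrite -ler_pdivlMr // ge_min lexx orbT.
have [j Jj hj] := q_adh x d0; have [k Jk hk] := q_adh y d0.
have E : x * y - (j * y + (x - j) * k) = (x - j) * (y - k).
  by rewrite mulrBr opprD addrA -mulrBl.
apply: le_trans (q_le _ (_ : J (j * y + (x - j) * k))) _.
  apply: (piD PJ); first exact: (piM PJ).
  by apply: JM => //; apply: fcB => //; exact: (piS PJ).
rewrite E; apply: le_trans (banM BA _ _) _.
have := bn_ge0 BN (x - j); have := bn_ge0 BN (y - k) => a0 b0.
apply: le_trans (ler_pM b0 a0 (ltW hj) (ltW hk)) _; nra.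
Qed.

(** Gelfand-Mazur: in the quotient by a maximal ideal, if no [b - l] vanished
    then all of them would be invertible, so the powers of the invertible
    element [b] would decay faster than those of its inverse can grow. *)
Lemma gelfand_mazur b : S b -> exists l : R[i], J (b - l%:A).
Proof.
move=> Sb; apply: contrapT => hb.
have SA (l : R[i]) : S l%:A by exact: (fcZ FS _ (fc1 FS)).
have inv (l : R[i]) : exists2 y, S y & J ((b - l%:A) * y - 1).
  by apply: Jmax; [exact: fcB | move=> h; apply: hb; exists l].
have decay := @powers_decay R T S q (fc1 FS) (fcD FS) (fcZ FS) (fcM FS) (fcC FS)
  (fun x _ => q_ge0 x) (fun x y _ _ => qD x y) (fun z x _ => qZ z x) qM b Sb.
have [y Sy Jy] := inv 0; rewrite scale0r subr0 in Jy.
have q1 : 1 <= q 1.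
  apply: lb_le_inf; first exact: (q_has_inf 1).1.
  by move=> _ [j Jj <-]; exact: near1_not_in_ideal.
have y0 := q_ge0 y.
have [||K HK] := decay _ (2 * (q y + 1)).
- move=> l; have [->|l0] := eqVneq l 0.
    by exists 1; [exact: fc1 | rewrite scale0r subr0 mulr1 subrr; exact: q_J].
  have [z Sz Jz] := inv l^-1; exists (- (l^-1 *: z)); first exact/fcN/(fcZ FS).
  rewrite [X in q X](_ : _ = (b - l^-1%:A) * z - 1); first exact: q_J.
  congr (_ - _); rewrite mulrN -mulNr opprB -scalerAr scalerAl scalerBr.
  by rewrite scalerA mulVf // scale1r.
- by rewrite mulr_ge0 //; lra.
have powJ n : J ((b * y) ^+ n - 1).
  elim: n => [|n IH]; first by rewrite expr0 subrr.
  have -> : (b * y) ^+ n.+1 - 1 = (b * y) * ((b * y) ^+ n - 1) + (b * y - 1).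
    by rewrite exprS mulrBr mulr1 subrKA.
  by apply: (piD PJ) => //; apply: JM => //; exact: (fcM FS).
have n1 : (0 < 2 ^ K)%N by rewrite expn_gt0.
have := HK K (leqnn K); move: n1; set n := (2 ^ K)%N => n1 h.
have cby : GRing.comm b y by exact: (fcC FS).
have h1 : q 1 <= q (b ^+ n) * q (y ^+ n).
  apply: le_trans (qM (fcX n Sb) (fcX n Sy)); rewrite -exprMn_comm //.
  have -> : 1 = (b * y) ^+ n - ((b * y) ^+ n - 1) by rewrite opprB addrC subrK.
  apply: le_trans (qD _ _) _; rewrite gerDl; exact/q_J/JN.
have h2 m : q (y ^+ m) <= q 1 * q y ^+ m.
  elim: m => [|m IH]; first by rewrite !expr0 mulr1.
  rewrite !exprS mulrCA; apply: le_trans (qM Sy (fcX m Sy)) _; exact: ler_wpM2l.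
have b0 := q_ge0 (b ^+ n).
have h3 : 1 <= q (b ^+ n) * q y ^+ n.
  have := ler_wpM2l b0 (h2 n) => h3.
  have := le_trans h1 h3; rewrite mulrCA -[leLHS]mulr1 ler_pM2l //; lra.
have h4 : q y ^+ n <= (q y + 1) ^+ n by rewrite lerXn2r ?nnegrE //; lra.
have h5 : 2 <= 2 ^+ n :> R by apply: ler_eXnr => //; rewrite ler1n.
rewrite exprMn -mulrA in h.
have h6 : 1 <= (q y + 1) ^+ n * q (b ^+ n).
  by apply: le_trans h3 _; rewrite mulrC ler_wpM2r.
nra.
Qed.

Lemma ideal_value_unique b (l m : R[i]) : J (b - l%:A) -> J (b - m%:A) -> l = m.
Proof.
move=> hl hm; apply: contrapT => /eqP lm; apply: (pi1 PJ).
have E : (b - m%:A) - (b - l%:A) = (l - m)%:A by rewrite opprB addrC subrKA -scalerBl.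
have := JZ (l - m)^-1 (JB hm hl); rewrite E scalerA.
by rewrite mulVf ?subr_eq0 // scale1r.
Qed.

(** The character sends [b] to the only [l] with [b - l%:A] in the ideal.  It is
    contractive because [1 - b / chi b] lies in the ideal, hence is not
    invertible, when [chi b] does not vanish. *)
Lemma ideal_character : exists2 chi, character S chi & forall x, J x -> chi x = 0.
Proof.
pose chi b : R[i] := xget 0 [set l | J (b - l%:A)].
have chiJ b : S b -> J (b - (chi b)%:A).
  by move=> /gelfand_mazur [l hl]; exact: (xgetPex 0 (ex_intro [set l | J (b - l%:A)] l hl)).
have chiE b l : S b -> J (b - l%:A) -> chi b = l.
  by move=> /chiJ h1 h2; exact: ideal_value_unique h1 h2.
exists chi; last first.
  by move=> x Jx; apply: chiE; [exact: (piS PJ) | rewrite scale0r subr0].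
split.
- by apply: chiE; [exact: fc1 | rewrite scale1r subrr].
- move=> x y Sx Sy; apply: chiE; first exact: (fcD FS).
  by rewrite scalerDl opprD addrACA; apply: (piD PJ); exact: chiJ.
- move=> z x Sx; apply: chiE; first exact: (fcZ FS).
  by rewrite -scalerA -scalerBr; apply: JZ; exact: chiJ.
- move=> x y Sx Sy; apply: chiE; first exact: (fcM FS).
  have -> : x * y - (chi x * chi y)%:A =
      (x - (chi x)%:A) * y + chi x *: (y - (chi y)%:A).
    by rewrite mulrBl -scalerAl mul1r scalerBr scalerA subrKA.
  by apply: (piD PJ); [apply: (piM PJ) => //; exact: chiJ | apply: JZ; exact: chiJ].
move=> x Sx; rewrite leNgt; apply/negP => h.
have n0 := bn_ge0 BN x.
have c0 : chi x != 0 by rewrite -nc_gt0; lra.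
have := JZ (- (chi x)^-1) (chiJ x Sx).
rewrite scalerBr scalerA mulNr mulVf // scaleN1r opprK addrC => hJ.
have := near1_not_in_ideal hJ; rewrite opprD addrA subrr add0r (bnN BN) (bnZ BN).
rewrite ncN ncV mulrC ler_pdivlMr ?mul1r; lra.
Qed.

End MaximalIdeal.

(** Zorn's lemma extends the ideal [I] of the multiples of [x] to a maximal one.
    It is applied to the sets [J] whose union with [I] is a proper ideal, so that
    the empty chain is no exception. *)
Lemma exists_character x : S x -> ~ (exists y, is_inverse x y) ->
  exists2 chi, character S chi & chi x = 0.
Proof.
move=> Sx hx; pose I := [set y | exists2 s, S s & y = x * s].
have PI : proper_ideal I.
  split.
  - by move=> _ [s Ss ->]; exact: (fcM FS).
  - move=> _ _ [s Ss ->] [t St ->]; exists (s + t); first exact: (fcD FS).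
    by rewrite mulrDr.
  - by move=> _ y [s Ss ->] Sy; exists (s * y); [exact: (fcM FS) | rewrite mulrA].
  - by move=> [s Ss h]; apply: hx; exists s; split => //; rewrite (fcC FS).
pose P (J : set T) := proper_ideal (J `|` I).
have [|J [PJ Jmax]] := @Zorn_bigcup T P.
  move=> F FP Ftot; rewrite /P.
  have key y z : (\bigcup_(X in F) X `|` I) y -> (\bigcup_(X in F) X `|` I) z ->
      exists2 X, (X = set0 \/ F X) & (X `|` I) y /\ (X `|` I) z.
    move=> [[X FX Xy]|Iy] [[Y FY Yz]|Iz].
    - have [XY|YX] := Ftot X Y FX FY.
        by exists Y; [right | split; left => //; exact: XY].
      by exists X; [right | split; left => //; exact: YX].
    - by exists X; [right | split; [left | right]].
    - by exists Y; [right | split; [right | left]].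
    - by exists set0; [left | split; right].
  have PX X : X = set0 \/ F X -> proper_ideal (X `|` I).
    by case=> [->|/FP //]; rewrite set0U.
  have up X y : X = set0 \/ F X -> (X `|` I) y -> (\bigcup_(X in F) X `|` I) y.
    by move=> [->|FX] [Xy|Iy] //; [right | left; exists X | right].
  split.
  - by move=> y Hy; have [X /PX PX' [Xy _]] := key y y Hy Hy; exact: (piS PX').
  - move=> y z Hy Hz; have [X hX [Xy Xz]] := key y z Hy Hz.
    by apply: (up X) => //; exact: (piD (PX X hX)).
  - move=> y z Hy Sz; have [X hX [Xy _]] := key y y Hy Hy.
    by apply: (up X) => //; exact: (piM (PX X hX)).
  - by move=> H1; have [X hX [X1 _]] := key 1 1 H1 H1; exact: (pi1 (PX X hX) X1).
pose K := J `|` I.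
have KI y : I y -> K y by right.
have K0 : K 0 by apply: KI; exists 0; [exact: fc0 | rewrite mulr0].
have [] := @ideal_character K PJ K0; last first.
  move=> chi hchi h; exists chi => //; apply/h/KI.
  by exists 1; [exact: fc1 | rewrite mulr1].
move=> b Sb Kb; apply: contrapT => hb.
pose L := [set z | exists2 k, K k & exists2 s, S s & z = k + b * s].
have KL k : K k -> L k.
  by move=> Kk; exists k => //; exists 0; [exact: fc0 | rewrite mulr0 addr0].
have LI : L `|` I = L.
  by apply/seteqP; split => z; [case=> // /KI/KL | left].
have Lb : L b.
  by exists 0 => //; exists 1; [exact: fc1 | rewrite mulr1 add0r].
apply: (Jmax L).
  split; first by move=> z Jz; apply: KL; left.
  by move=> /(_ b Lb) Jb; apply: Kb; left.
rewrite /P LI; split.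
- move=> _ [k Kk [s Ss ->]]; apply: (fcD FS); first exact: (piS PJ).
  exact: (fcM FS).
- move=> _ _ [k Kk [s Ss ->]] [k' Kk' [s' Ss' ->]].
  exists (k + k'); first exact: (piD PJ).
  by exists (s + s'); [exact: (fcD FS) | rewrite mulrDr addrACA].
- move=> _ y [k Kk [s Ss ->]] Sy; exists (k * y); first exact: (piM PJ).
  by exists (s * y); [exact: (fcM FS) | rewrite mulrDl mulrA].
move=> [k Kk [s Ss h]]; apply: hb; exists s => //.
have -> : b * s - 1 = (-1 : R[i]) *: k.
  by rewrite h scaleN1r opprD addrCA subrr addr0.
rewrite -[k]mulr1 scalerAr; apply: (piM PJ) => //; exact: (fcZ FS _ (fc1 FS)).
Qed.

End Ideals.

(** A C*-algebra is semisimple: the spectral radius of the self-adjoint element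
    [star x * x], here given by the powers of exponents [2 ^ k], is its norm. *)
Lemma cstar_semisimple (R : realType) (A : cstarAlgType R) (S : set A) (x : A) :
  full_commutative S -> (forall y, S y -> S (star y)) -> S x ->
  (forall chi, character (@cnorm R A) S chi -> chi x = 0) -> x = 0.
Proof.
move=> FS Sstar Sx Hx; have BA := cnorm_banach A; have BN := ban BA.
pose y := star x * x.
have Sy : S y by apply: (fcM FS) => //; exact: Sstar.
have ys : star y = y by rewrite /y starM starK.
have inv (l : R[i]) : exists2 z, S z & cnorm ((1 - l *: y) * z - 1) <= 0.
  have Sl : S (1 - l *: y) by apply: (fcB FS); [exact: fc1 | exact: (fcZ FS)].
  have [[z hz]|nz] := pselect (exists z, is_inverse (1 - l *: y) z).
    by exists z; [exact: (fcV FS Sl hz) | rewrite hz.1 subrr (bn0 BN)].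
  have [chi hchi] := exists_character BA FS Sl nz.
  rewrite (chiD hchi (fc1 FS) (fcN FS (fcZ FS l Sy))) -scaleNr (chiZ hchi) //.
  rewrite (chiM hchi (Sstar _ Sx) Sx) (Hx _ hchi) !mulr0 addr0 (chi1 hchi).
  by move/eqP; rewrite oner_eq0.
have decay := @powers_decay R A S (@cnorm R A) (fc1 FS) (fcD FS) (fcZ FS) (fcM FS)
  (fcC FS) (fun x _ => bn_ge0 BN x) (fun x y _ _ => bnD BN x y)
  (fun z x _ => eq_ind_r (fun r => r <= _) (lexx _) (bnZ BN z x))
  (fun x y _ _ => banM BA x y) y Sy inv.
have pow k : cnorm (y ^+ (2 ^ k)) = cnorm y ^+ (2 ^ k).
  elim: k => [|k IH]; first by rewrite expn0 !expr1.
  have sX n : star (y ^+ n) = y ^+ n.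
    elim: n => [|n IHn]; last by rewrite [in LHS]exprS starM IHn ys -exprSr.
    have := starM (star (1 : A)) 1; rewrite mulr1 starK => h.
    by rewrite expr0; move: h; rewrite mulr1.
  by rewrite expnSr exprM expr2 -{1}sX cnorm_star_mul IH -exprM.
have y0 : cnorm y = 0.
  apply/eqP; rewrite eq_le (bn_ge0 BN) andbT leNgt; apply/negP => yp.
  have [|K HK] := decay (2 / cnorm y); first by rewrite divr_ge0 // ltW.
  have := HK K (leqnn K); rewrite pow -exprMn divfK ?gt_eqF //.
  have n1 : (0 < 2 ^ K)%N by rewrite expn_gt0.
  have h5 : 2 <= 2 ^+ (2 ^ K) :> R by apply: ler_eXnr => //; rewrite ler1n.
  lra.
apply: (bn_eq0 BN); apply/eqP; rewrite -sqrf_eq0 -cnorm_star_mul; exact/eqP.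
Qed.

(** * Circles, and the existence of the functional calculus *)

Section Holomorphy.
Variable R : realType.
Local Notation C := ((R[i] : numFieldType)^o).

Lemma cdiff_derivable (f : C -> C) (z d : R[i]) : cdiff f z d -> derivable f z 1.
Proof.
move=> df; apply/cvg_ex; exists (d : C).
apply/(bn_cvgP (complex_banach R)) => e e0.
have e2 : 0 < e / 2 by rewrite divr_gt0.
have [r r0 H] := df _ e2.
rewrite near_withinE; apply/nbhs_ballP; exists r%:C => /=; first by rewrite ltcR.
move=> h; rewrite /ball /= sub0r norm_nc ltcR ncN => hr h0.
have hn : 0 < nc h by rewrite nc_gt0.
have E : (h : C) *: (1 : C) + z - z = h :> R[i].
  by rewrite addrK [LHS]mulr1.
have := H (h *: (1 : C) + z); rewrite E => /(_ hr) k.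
have -> : d - h^-1 *: (f (h *: (1 : C) + z) - f z) =
   - (h^-1 * (f (h *: (1 : C) + z) - f z - d * h)) :> R[i].
  rewrite [_ *: (_ - _)](_ : _ = h^-1 * (f (h *: (1 : C) + z) - f z)) //.
  by field.
rewrite ncN ncM ncV mulrC ltr_pdivrMr //; apply: le_lt_trans k _.
by rewrite ltr_pM2r //; lra.
Qed.

Lemma derivable_ncont (f : C -> C) (z : R[i]) : derivable f z 1 ->
  ncont (@Normc.normc R : C -> R) f z.
Proof.
move=> /derivable1_diffP /differentiable_continuous cf e e0.
have /(bn_cvgP (complex_banach R))/(_ _ e0) := cf.
move=> /nbhs_ballP [[r r'] /=]; rewrite ltcE /= => /andP[/eqP -> r0] H.
exists r => // w h; rewrite ncB; apply: H.
by rewrite /ball /= norm_nc ltcR ncB.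
Qed.

Lemma open_nc (U : set C) (z : R[i]) : open U -> U z ->
  exists2 r : R, 0 < r & forall w, nc (w - z) < r -> U w.
Proof.
move=> oU Uz; have /nbhs_ballP [[r r'] /=] := open_nbhs_nbhs (conj oU Uz).
rewrite ltcE /= => /andP[/eqP -> r0] H; exists r => // w h; apply: H.
by rewrite /ball /= norm_nc ltcR ncB.
Qed.

(** The principal logarithm jumps by at least pi across the negative reals. *)
Lemma holomorphic_clog_slit (U : set C) (z : R[i]) : holomorphic U (@clog R) ->
  U z -> slit z.
Proof.
move=> [oU dU] Uz [z1 z2].
have [r r0 Hr] := open_nc oU Uz.
pose a := complex.Re z - r / 2.
have a0 : a < 0 by rewrite /a; lra.
have Uw : U (a +i* 0).
  apply: Hr; apply: le_lt_trans (nc_le _) _.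
  rewrite ReD ReN ImD ImN z2 /= subrr normr0 addr0 /a addrAC subrr add0r normrN.
  by rewrite gtr0_norm; lra.
have [s s0 Hs] := derivable_ncont (dU _ Uw) ltr01.
pose b := - (s / 2).
have b0 : b < 0 by rewrite /b; lra.
have : nc (clog (a +i* b) - clog (a +i* 0)) < 1.
  apply: Hs; apply: le_lt_trans (nc_le _) _.
  by rewrite ReD ReN ImD ImN /= subrr normr0 subr0 add0r /b normrN gtr0_norm; lra.
move=> /(le_lt_trans (Im_le_nc _)); rewrite ImD ImN /= lexx leNgt b0 /=.
rewrite expr0n addr0 sqrtr_sqr (ltr0_norm a0) invrN mulrN divff ?lt_eqF // acosN1.
have n0 : 0 < nc (a +i* b).
  by rewrite nc_gt0; apply/eqP => -[h _]; rewrite h ltxx in a0.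
have /acos_ge0 : -1 <= a / Num.sqrt (a ^+ 2 + b ^+ 2) <= 1.
  rewrite -ler_norml normrM normfV [in X in _ / X]gtr0_norm // ler_pdivrMr // mul1r.
  exact: (Re_le_nc (a +i* b)).
have := pi_ge2 R; set p := pi; set c := acos _ => h1 h2.
by rewrite -opprD normrN ger0_norm; lra.
Qed.

End Holomorphy.

Section Circle.
Variable R : realType.
Local Notation C := ((R[i] : numFieldType)^o).
Local Notation ncC := (@Normc.normc R : C -> R).
Variables (c r : R).
Hypothesis r0 : 0 < r.

Definition circle : R -> C := fun t =>
  c%:C + r%:C * cexp (0 +i* (2 * pi * t)).

Local Arguments circle : simpl never.

Lemma circle_Re t : complex.Re (circle t) = c + r * cos (2 * pi * t).
Proof. by rewrite /circle /= expR0 !mul0r mul1r !subr0. Qed.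

Lemma circle_Im t : complex.Im (circle t) = r * sin (2 * pi * t).
Proof. by rewrite /circle /= expR0 !mul0r mul1r addr0 add0r. Qed.

Lemma circle_sub t : circle t - c%:C = r%:C * cexp (0 +i* (2 * pi * t)) :> R[i].
Proof. by rewrite /circle addrC addKr. Qed.

Lemma nc_circle t : nc (circle t - c%:C) = r.
Proof. by rewrite circle_sub ncM nc_cexp ncR expR0 mulr1 gtr0_norm. Qed.

Let pi0 : 0 < pi :> R := pi_gt0 R.

Lemma cos_lipschitz (x y : R) : `|cos y - cos x| <= `|y - x|.
Proof.
wlog xy : x y / x < y.
  move=> H; case: (ltgtP x y) => [|yx|->]; first exact: H.
    by rewrite distrC (distrC y); exact: H.
  by rewrite !subrr normr0.
have [|z _ ->] := @MVT R (@cos R) (fun x => - sin x) x y xy.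
  by apply: continuous_subspaceT => z; apply: continuous_cos.
by rewrite normrM ler_piMl // normrN sin_max.
Qed.

Lemma sin_lipschitz (x y : R) : `|sin y - sin x| <= `|y - x|.
Proof.
rewrite -!cosBpihalf; apply: le_trans (cos_lipschitz _ _) _.
by rewrite opprB addrA subrK.
Qed.

Let L := 4 * pi * r.
Let L0 : 0 < L. Proof. by rewrite !mulr_gt0. Qed.

Let circle_Re_lip x y : x <= y ->
  `|complex.Re (circle y) - complex.Re (circle x)| <= 2 * pi * r * (y - x).
Proof.
move=> xy; rewrite !circle_Re opprD addrACA subrr add0r -mulrBr normrM (gtr0_norm r0).
have := cos_lipschitz (2 * pi * x) (2 * pi * y).
rewrite -mulrBr normrM (ger0_norm (_ : 0 <= y - x)) ?subr_ge0 //.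
rewrite (gtr0_norm (_ : 0 < 2 * pi)) ?mulr_gt0 // => h.
have -> : 2 * pi * r * (y - x) = r * (2 * pi * (y - x)) by ring.
by rewrite ler_wpM2l ?(ltW r0).
Qed.

Let circle_Im_lip x y : x <= y ->
  `|complex.Im (circle y) - complex.Im (circle x)| <= 2 * pi * r * (y - x).
Proof.
move=> xy; rewrite !circle_Im -mulrBr normrM (gtr0_norm r0).
have := sin_lipschitz (2 * pi * x) (2 * pi * y).
rewrite -mulrBr normrM (ger0_norm (_ : 0 <= y - x)) ?subr_ge0 //.
rewrite (gtr0_norm (_ : 0 < 2 * pi)) ?mulr_gt0 // => h.
have -> : 2 * pi * r * (y - x) = r * (2 * pi * (y - x)) by ring.
by rewrite ler_wpM2l ?(ltW r0).
Qed.

Let circle_dominated : dominated circle (fun t => L * t).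
Proof.
move=> x y x0 xy y1; apply: le_trans (nc_le _) _.
have h1 := circle_Re_lip xy; have h2 := circle_Im_lip xy.
by rewrite ReD ReN ImD ImN /L; move: h1 h2; lra.
Qed.

Lemma lipschitz_bounded_variation (f : R -> R) (K : R) : 0 <= K ->
  (forall x y, x <= y -> `|f y - f x| <= K * (y - x)) -> bounded_variation 0 1 f.
Proof.
move=> K0 Hf.
have -> : f = (fun t => f t + K * t) \+ (\- (fun t => K * t)).
  by apply/funext => t /=; rewrite addrK.
apply: bounded_variationD => //.
  apply: nondecreasing_bounded_variation => x y _ _ xy.
  by have := Hf x y xy; rewrite ler_norml => /andP[]; lra.
apply: bounded_variationN; apply: nondecreasing_bounded_variation => x y _ _ xy.
exact: ler_wpM2l.
Qed.

Lemma circle_rectifiable : closed_rectifiable circle.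
Proof.
have k0 : 0 <= 2 * pi * r by rewrite ltW // !mulr_gt0.
split.
- apply/subspace_continuousP => x; rewrite /= in_itv /= => x01.
  apply/(bn_cvgP (complex_banach R)) => e e0; rewrite near_withinE.
  apply/nbhs_ballP; exists (e / (L + 1)) => /=; first by rewrite divr_gt0 // addr_gt0.
  move=> y yb y01'; have y01 : 0 <= y <= 1 by move: y01'; rewrite /= in_itv.
  have h : `|x - y| * (L + 1) < e by rewrite -ltr_pdivlMr ?addr_gt0.
  suff : nc (circle x - circle y) < e by [].
  apply: le_lt_trans h.
  move: x01 y01 => /andP[x0 x1] /andP[y0 y1].
  have H (a b : R) : 0 <= a -> a <= b -> b <= 1 -> nc (circle b - circle a) <= `|b - a| * (L + 1).
    move=> a0 ab b1; apply: le_trans (circle_dominated a0 ab b1) _.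
    by rewrite -mulrBr mulrC ger0_norm ?subr_ge0 // ler_wpM2l ?subr_ge0 // lerDl.
  have [xy|/ltW yx] := leP x y; last exact: H.
  by rewrite ncB distrC; exact: H.
- by apply: complex_ext; rewrite ?circle_Re ?circle_Im mulr0 mulr1
    ?cos0 ?sin0 (mulr_natl pi 2) ?cos2pi ?sin2pi.
- by apply: (lipschitz_bounded_variation k0) => x y; exact: circle_Re_lip.
- by apply: (lipschitz_bounded_variation k0) => x y; exact: circle_Im_lip.
Qed.

Let circle_neq t w : nc (w - c%:C) < r -> circle t - w != 0.
Proof.
move=> h; apply/eqP => /subr0_eq E; move: h.
by rewrite -E nc_circle ltxx.
Qed.

(** The primitive of [1 / (z - c)] along the parametrized circle is [2 pi i t]. *)
Lemma circle_integral_center :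
  line_integral circle (fun z : C => (z - c%:C)^-1 : C) = two_pi_i R.
Proof.
have c0 : nc (c%:C - c%:C : R[i]) < r by rewrite subrr nc0.
pose H (t : R) : C := 0 +i* (2 * pi * t).
rewrite (line_integral_ftc (complex_banach R) (H := H) circle_dominated).
- rewrite /H mulr0 mulr1; apply: complex_ext; rewrite /= ?subr0 //.
- apply: continuous01_comp; first exact: closed_rectifiable_continuous circle_rectifiable.
  move=> t _; apply: (@cdiff_ncont _ (fun z : R[i] => (z - c%:C)^-1)).
  by apply: cdiff_inv_shift; exact: circle_neq.
move=> e t e0 t01.
pose d := Num.min (4 * pi)^-1 (e * L / (40 * pi ^+ 2)).
have d0 : 0 < d.
  by rewrite lt_min invr_gt0 mulr_gt0 //= divr_gt0 ?mulr_gt0 // exprn_gt0.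
exists d => // x y x0 xt ty y1 xd yd.
have dE (s : R) : `|s| < d -> nc (cexp (H s) - 1 - H s) <= e * L * `|s|.
  rewrite lt_min => /andP[s1 s2].
  have nH : nc (H s) = 2 * pi * `|s|.
    by rewrite /H /= expr0n add0r sqrtr_sqr normrM gtr0_norm // mulr_gt0.
  rewrite -div1r ltr_pdivlMr ?mulr_gt0 // in s1.
  rewrite ltr_pdivlMr ?mulr_gt0 ?exprn_gt0 // in s2.
  apply: le_trans (cexp_sub1_le _) _; rewrite nH; first by lra.
  have := normr_ge0 s; set u := `|s| in s1 s2 *.
  rewrite (_ : 10 * (2 * pi * u) ^+ 2 = u * (40 * pi ^+ 2) * u); last by ring.
  by move=> u0; rewrite ler_wpM2r // ltW.
have HD (s : R) : cexp (H (t + s)) = cexp (H t) * cexp (H s) :> R[i].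
  by rewrite -cexpD; congr cexp; apply: complex_ext; rewrite /= ?addr0 // mulrDr.
have E : H y - H x - (circle y - circle x : R[i]) *: ((circle t - c%:C)^-1 : C) =
   (cexp (H (x - t)) - 1 - H (x - t)) - (cexp (H (y - t)) - 1 - H (y - t)) :> R[i].
  rewrite [_ *: _](_ : _ = (circle y - circle x) * (circle t - c%:C)^-1 :> R[i]) //.
  have -> : circle y - circle x = (circle y - c%:C) - (circle x - c%:C) :> R[i] by ring.
  rewrite !circle_sub -!/(H _).
  have cx : cexp (H x) = cexp (H t) * cexp (H (x - t)) :> R[i].
    by rewrite -HD; congr (cexp (H _)); ring.
  have cy : cexp (H y) = cexp (H t) * cexp (H (y - t)) :> R[i].
    by rewrite -HD; congr (cexp (H _)); ring.
  have HB (s : R) : H (s - t) = H s - H t :> R[i].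
    by apply: complex_ext; rewrite /= ?subr0 // mulrBr.
  have rC : r%:C != 0 :> R[i] by rewrite -nc_gt0 ncR gtr0_norm.
  rewrite cx cy !HB; field.
  by rewrite cexp_neq0 rC.
rewrite E; apply: le_trans (ncD _ _) _; rewrite ncN.
have h1 : nc (cexp (H (x - t)) - 1 - H (x - t)) <= e * L * (t - x).
  by rewrite -(ger0_norm (_ : 0 <= t - x)) ?subr_ge0 // distrC dE // distrC ger0_norm; lra.
have h2 : nc (cexp (H (y - t)) - 1 - H (y - t)) <= e * L * (y - t).
  have -> : e * L * (y - t) = e * L * `|y - t| by rewrite ger0_norm ?subr_ge0.
  by apply: dE; rewrite ger0_norm; lra.
apply: (le_trans (lerD h1 h2)).
by rewrite le_eqVlt; apply/orP; left; apply/eqP; ring.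
Qed.

(** Moving the pole off the center changes the integrand by the derivative of
    the logarithm of [(z - w) / (z - c)], which has positive real part on the
    circle. *)
Lemma circle_integral w : nc (w - c%:C) < r ->
  line_integral circle (fun z : C => (z - w)^-1 : C) = two_pi_i R.
Proof.
move=> wr; have BC := complex_banach R.
have rg := circle_rectifiable; have cg := closed_rectifiable_continuous rg.
have c0 : nc (c%:C - c%:C : R[i]) < r by rewrite subrr nc0.
have cinv u : nc (u - c%:C) < r -> forall t, ncont ncC (fun z : C => (z - u)^-1 : C) (circle t).
  move=> h t; apply: (@cdiff_ncont _ (fun z : R[i] => (z - u)^-1)).
  by apply: cdiff_inv_shift; exact: circle_neq.
have cI u : nc (u - c%:C) < r -> continuous01 ncC ((fun z : C => (z - u)^-1 : C) \o circle).
  by move=> h; apply: continuous01_comp => // t _; exact: cinv.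
pose q (z : R[i]) : R[i] := (z - w)^-1 + (-1) * (z - c%:C)^-1.
pose Q (z : R[i]) : R[i] := clog (1 - (w - c%:C) * (z - c%:C)^-1).
have dQ t : cdiff Q (circle t) (q (circle t)).
  have zc := circle_neq t c0; have zw := circle_neq t wr.
  have d1 := cdiff_comp (cdiff_inv_shift zc) (cdiff_affine (- (w - c%:C)) 1 _).
  have s1 : slit (- (w - c%:C) * (circle t - c%:C)^-1 + 1).
    apply: slit_Re; rewrite ReD /=.
    have : nc (- (w - c%:C) * (circle t - c%:C)^-1) < 1.
      by rewrite ncM ncN ncV nc_circle ltr_pdivrMr // mul1r.
    by move=> /(le_lt_trans (Re_le_nc _)); rewrite ltr_norml => /andP[]; lra.
  have := cdiff_comp d1 (cdiff_clog s1).
  have E0 : - (w - c%:C) * (circle t - c%:C)^-1 + 1 = (circle t - w) / (circle t - c%:C) :> R[i].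
    by field.
  have -> : (- (w - c%:C) * (circle t - c%:C)^-1 + 1)^-1 *
      (- (w - c%:C) * - (circle t - c%:C)^-2) = q (circle t) :> R[i].
    by rewrite E0 /q; field; rewrite zc zw.
  move=> h e /h [s s0 k]; exists s => // z /k /=.
  by rewrite /Q [1 - _]addrC [1 - (_ / (circle t - _))]addrC !mulNr.
have I0 : line_integral circle (q : C -> C) = 0.
  apply: (line_integral_primitive (Q := Q) rg) => t _; first exact: dQ.
  have dq := cdiffD (cdiff_inv_shift (circle_neq t wr))
    (cdiffZ (-1) (cdiff_inv_shift (circle_neq t c0))).
  exact: (cdiff_ncont dq).
have cZ := continuous01Z BC (-1) (cI _ c0).
move: I0; rewrite (_ : (q : C -> C) =
    (fun z => (fun z : C => (z - w)^-1 : C) z + (fun z : C => (-1 : R[i]) *: ((z - c%:C)^-1 : C)) z)) //.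
rewrite (line_integralD BC circle_dominated (cI w wr) cZ).
rewrite (line_integralZ BC (-1) circle_dominated (cI _ c0)) scaleN1r.
by rewrite circle_integral_center => /subr0_eq.
Qed.

(** A point to the left of a circle in the right half-plane is not encircled:
    there the logarithm of [z - w] is a primitive. *)
Lemma circle_integral_outside w : r < c -> complex.Re w <= 0 ->
  line_integral circle (fun z : C => (z - w)^-1 : C) = 0.
Proof.
move=> rc w0; have sl t : slit (circle t - w).
  apply: slit_Re; rewrite ReD ReN circle_Re.
  have := cos_geN1 (2 * pi * t); move=> h.
  have := ler_wpM2l (ltW r0) h; lra.
have zw t := slit_neq0 (sl t).
apply: (line_integral_primitive (Q := fun z => clog (z - w))) => [|t _|t _].
- exact: circle_rectifiable.
- by have := cdiff_comp (cdiff_shift w (circle t)) (cdiff_clog (sl t)); rewrite mulr1.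
- exact: (cdiff_ncont (cdiff_inv_shift (zw t))).
Qed.

End Circle.

Section Existence.
Variables (R : realType) (B : topStarAlgType R) (N : B -> R).
Hypothesis BA : banach_alg_norm N.
Local Notation C := ((R[i] : numFieldType)^o).

Lemma two_pi_i_neq0 : two_pi_i R != 0.
Proof.
apply/eqP => -[/eqP]; rewrite mulf_eq0 pnatr_eq0 /= => /eqP p0.
by have := pi_gt0 R; rewrite p0 ltxx.
Qed.

Let one_circle (c r : R) : 'I_1 -> R -> C := fun _ => circle c r.

Let winding_circle (c r : R) w : 0 < r -> nc (w - c%:C) < r ->
  winding_number (one_circle c r) w = 1.
Proof.
move=> r0 h; rewrite /winding_number /contour_integral big_ord1 /one_circle.
by rewrite circle_integral // mulVf // two_pi_i_neq0.
Qed.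

(** A large circle encloses the spectrum. *)
Lemma hfc_exists_exp (a : B) : exists b, is_hfc (@cexp R) a b.
Proof.
pose r := N a + 1; have r0 : 0 < r by have := bn_ge0 (ban BA) a; rewrite /r; lra.
eexists; exists setT, 1%N, (one_circle 0 r).
split; [by [] | | | reflexivity].
  split; first exact: openT.
  by move=> z _; exact: cdiff_derivable (cdiff_cexp z).
have inside w : spectrum a w -> nc (w - 0%:C) < r.
  move=> /(spectrum_bounded BA) h; rewrite (_ : w - 0%:C = w) ?/r; last by rewrite subr0.
  lra.
split.
- by move=> i; exact: circle_rectifiable.
- move=> i t t01; split => // /inside.
  by rewrite nc_circle // ltxx.
- by move=> w /inside h; exact: winding_circle.
- by move=> w /(_ I).
Qed.

(** The spectrum is compact in the positive half-line, so a circle in the right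
    half-plane encloses it. *)
Lemma hfc_exists_log (a k : B) : is_inverse a k ->
  spectrum a `<=` [set z | 0 <= (z : R[i])] -> exists b, is_hfc (@clog R) a b.
Proof.
move=> ak spos.
have n0 := bn_ge0 (ban BA) a; have k0 := bn_ge0 (ban BA) k.
(* the spectrum lies between [d] and [N a]; the circle of center [M] and radius
   [r] meets the real axis at [d / 2] and to the right of [N a] *)
pose d := (N k + 1)^-1; have d0 : 0 < d by rewrite invr_gt0; lra.
pose M := N a + d; have M0 : 0 < M by rewrite /M; lra.
pose r := M - d / 2; have r0 : 0 < r by rewrite /r /M; lra.
have rM : r < M by rewrite /r; lra.
have inside w : spectrum a w -> nc (w - M%:C) < r.
  move=> sw; have := spos w sw; have := spectrum_bounded BA sw.
  have := spectrum_away0 BA ak sw.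
  case: w {sw} => x y /=; rewrite lecE /= => h1 h2 /andP[/eqP y0 x0].
  move: h1 h2; rewrite y0 !expr0n /= subr0 !addr0 !sqrtr_sqr ger0_norm // => h1 h2.
  have dx : d <= x.
    rewrite /d -div1r ler_pdivrMr; last by lra.
    by have := mulr_ge0 x0 k0; lra.
  by rewrite expr0n addr0 sqrtr_sqr ltr_norml /r /M; apply/andP; split; lra.
eexists; exists [set z | 0 < complex.Re z], 1%N, (one_circle M r).
split; [| | | reflexivity].
- move=> w sw; have := inside w sw => /(le_lt_trans (Re_le_nc _)).
  by rewrite ReD ReN ltr_norml /= => /andP[]; lra.
- split; last by move=> z /slit_Re sz; exact: cdiff_derivable (cdiff_clog sz).
  rewrite openE => z /= z0; apply/nbhs_ballP; exists (complex.Re z)%:C; first by rewrite /= ltcR.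
  move=> w; rewrite /ball /= norm_nc ltcR => /(le_lt_trans (Re_le_nc _)).
  by rewrite ReD ReN ltr_norml => /andP[]; lra.
split.
- by move=> i; exact: circle_rectifiable.
- move=> i t t01; split => [|/inside]; last by rewrite nc_circle // ltxx.
  suff : 0 < complex.Re (circle M r t) by [].
  rewrite circle_Re.
  by have := ler_wpM2l (ltW r0) (cos_geN1 (2 * pi * t)); lra.
- by move=> w /inside h; exact: winding_circle.
- move=> w /negP; rewrite -leNgt => w0.
  rewrite /winding_number /contour_integral big_ord1 /one_circle.
  by rewrite circle_integral_outside // mulr0.
Qed.

End Existence.

(** * Matrices of scalars *)

Section ScalarMatrices.
Variables (F : fieldType) (n : nat).

(** The inverse of a triangular matrix is triangular, so only one term of each
    diagonal coefficient of the product survives. *)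
Lemma trig_inverse_diag (T K : 'M[F]_n.+1) : is_trig_mx T -> T *m K = 1%:M ->
  forall i, K i i = (T i i)^-1.
Proof.
move=> /is_trig_mxP trT TK.
have detT : \prod_i T i i != 0.
  have trT' : is_trig_mx T by apply/is_trig_mxP.
  rewrite -(det_trig trT'); apply/eqP => h; have /eqP := congr1 determinant TK.
  by rewrite det_mulmx h mul0r det1 eq_sym oner_eq0.
have Tii i : T i i != 0.
  by apply: contraNneq detT => h; rewrite (bigD1 i) //= h mul0r.
have expand (i j : 'I_n.+1) : \sum_k T i k * K k j = (i == j)%:R.
  by move/matrixP: TK => /(_ i j); rewrite !mxE.
have low (i j : 'I_n.+1) : (forall k : 'I_n.+1, (k < i)%N -> K k j = 0) ->
    \sum_k T i k * K k j = T i i * K i j.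
  move=> h; rewrite (bigD1 i) //= big1 ?addr0 // => k ki.
  have [ik|ki'] := ltnP i k; first by rewrite trT ?mul0r.
  by rewrite h ?mulr0 // ltn_neqAle ki' andbT.
have up m : forall i j : 'I_n.+1, (i < m)%N -> (i < j)%N -> K i j = 0.
  elim: m => // m IH i j im ij; apply: (mulfI (Tii i)); rewrite mulr0 -low.
    by rewrite expand; case: eqP ij => // ->; rewrite ltnn.
  move=> k ki; apply: IH; last exact: ltn_trans ij.
  exact: leq_trans ki _.
move=> i; apply: (mulfI (Tii i)); rewrite divff // -low.
  by rewrite expand eqxx.
by move=> k ki; exact: (up i).
Qed.

End ScalarMatrices.

(** The eigenvalues with multiplicity, as the diagonal of a Schur form. *)
Lemma eigenvalues_exist (R : realType) (n : nat) (H : 'M[R[i]]_n.+1) :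
  exists l : 'I_n.+1 -> R[i],
  [/\ \det H = \prod_i l i,
      forall i K, ((l i)%:M - H) *m K <> 1%:M
    & forall z K, (z%:M - H) *m K = 1%:M -> \tr K = \sum_i (z - l i)^-1].
Proof.
have [P Pu trig] := @Schur _ n.+1 H (ltn0Sn n).
have Punit := unitarymx_unit Pu.
have [T TE] : exists T, T = P *m H *m invmx P by eexists.
have trT : is_trig_mx T by move: trig; rewrite /similar_to conjumx // TE.
have shift z : P *m (z%:M - H) *m invmx P = z%:M - T.
  by rewrite TE mulmxBr mulmxBl mul_mx_scalar -scalemxAl mulmxV // scalemx1.
have detE z : \det (z%:M - T) = \prod_i (z - T i i).
  rewrite det_trig; last first.
    apply/is_trig_mxP => i j ij; rewrite !mxE (is_trig_mxP trT) // subr0.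
    by case: eqP ij => [->|_]; rewrite ?ltnn.
  by apply: eq_bigr => i _; rewrite !mxE eqxx.
have conj_inv z K : (z%:M - H) *m K = 1%:M ->
    (z%:M - T) *m (P *m K *m invmx P) = 1%:M.
  move=> h; rewrite -shift -!mulmxA (mulmxA (invmx P)) mulVmx // mul1mx.
  by rewrite (mulmxA _ K) h mul1mx mulmxV.
exists (fun i => T i i); split.
- by rewrite -det_trig // TE !det_mulmx mulrAC -det_mulmx mulmxV // det1 mul1r.
- move=> i K /conj_inv /(congr1 determinant) /eqP.
  by rewrite det_mulmx detE (bigD1 i) //= subrr !mul0r det1 eq_sym oner_eq0.
move=> z K /conj_inv h.
have -> : \tr K = \tr (P *m K *m invmx P).
  by rewrite -mulmxA mxtrace_mulC -mulmxA mulVmx // mulmx1.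
apply: eq_bigr => i _; rewrite (trig_inverse_diag _ h).
  by rewrite !mxE eqxx.
apply/is_trig_mxP => j k jk; rewrite !mxE (is_trig_mxP trT) // subr0.
by case: eqP jk => [->|_]; rewrite ?ltnn.
Qed.

(** * Linear images of the functional calculus *)

Section HfcImage.
Variables (R : realType) (B : topStarAlgType R) (N : B -> R).
Hypothesis BA : banach_alg_norm N.
Local Notation C := ((R[i] : numFieldType)^o).
Local Notation ncC := (@Normc.normc R : C -> R).

(** A bounded linear map [phi] commutes with the contour integral.  When it sends
    the resolvents to sums of simple fractions with poles [l i] in the spectrum,
    Cauchy's formula and the winding number 1 around the [l i] compute the image
    of the functional calculus. *)
Lemma hfc_image (f : C -> C) (a b : B) (S : set B) (phi : B -> R[i]) (n : nat)
    (l : 'I_n -> R[i]) :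
  S 0 -> (forall x y, S x -> S y -> S (x + y)) ->
  (forall (c : R[i]) x, S x -> S (c *: x)) ->
  (forall x y, S x -> S y -> phi (x + y) = phi x + phi y) ->
  (forall (c : R[i]) x, S x -> phi (c *: x) = c * phi x) ->
  (forall x, S x -> nc (phi x) <= N x) ->
  (forall x, (forall e : R, 0 < e -> exists2 y, S y & N (x - y) < e) -> S x) ->
  (forall i, spectrum a (l i)) ->
  (forall z y, is_inverse (z%:A - a) y -> S y /\ phi y = \sum_i (z - l i)^-1) ->
  (forall U, holomorphic U f -> forall g, closed_rectifiable g ->
     (forall t, 0 <= t <= 1 -> (U `\` spectrum a) (g t)) ->
     forall i, line_integral g (fun z : C => (f z / (z - l i)) : C) =
       f (l i) * line_integral g (fun z : C => ((z - l i)^-1) : C)) ->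
  is_hfc f a b -> S b /\ phi b = \sum_i f (l i).
Proof.
move=> S0 SD SZ phiD phiZ phib Scl lsp res cauchy.
move=> [U [k [G [spU hol [rG inG w1 _] ->]]]].
have BC := complex_banach R; have BN := ban BA.
pose F (z : C) : B := (f z : R[i]) *: inverse ((z : R[i])%:A - a).
have piece i : S (line_integral (G i) F) /\ phi (line_integral (G i) F) =
    \sum_j f (l j) * line_integral (G i) (fun z : C => ((z - l j)^-1) : C).
  have rg := rG i; set g := G i in rg *.
  have cg := closed_rectifiable_continuous rg.
  have [v gv] := closed_rectifiable_dominated rg.
  have nsp t : 0 <= t <= 1 -> ~ spectrum a (g t) by move=> /(inG i t) [].
  have cf : continuous01 ncC (f \o g).
    apply: continuous01_comp => // t t01; apply: derivable_ncont.
    by apply: hol.2; have [] := inG i t t01.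
  have cR : continuous01 N ((fun z : C => inverse ((z : R[i])%:A - a)) \o g).
    by apply: continuous01_comp => // t t01; apply: (resolvent_continuous BA); exact: nsp.
  have cF : continuous01 N (F \o g) by exact: (continuous01M BN cf cR).
  have resg t : 0 <= t <= 1 -> S (inverse ((g t : R[i])%:A - a)) /\
      phi (inverse ((g t : R[i])%:A - a)) = \sum_j (g t - l j)^-1.
    by move=> t01; apply: res; apply: inverseP; exact: contrapT (nsp t t01).
  have SF t : 0 <= t <= 1 -> S (F (g t)) by move=> /resg [h _]; exact: SZ.
  have phib' x : S x -> ncC (phi x) <= 1 * N x by rewrite mul1r; exact: phib.
  have [SI] := @line_integral_map R B C N ncC BN BC S phi 1 g F v
    S0 SD SZ phiD phiZ phib' Scl gv cF SF.
  move=> <-; split => //.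
  have gl j t : 0 <= t <= 1 -> g t - l j != 0.
    move=> t01; rewrite subr_eq0; apply/eqP => E; apply: (nsp t t01).
    by rewrite E; exact: lsp.
  have cq j : continuous01 ncC ((fun z : C => (f z / (z - l j)) : C) \o g).
    apply: (continuous01M BC cf (L := (fun z : C => ((z - l j)^-1) : C) \o g)).
    apply: continuous01_comp => // t t01.
    apply: (@cdiff_ncont _ (fun z : R[i] => (z - l j)^-1)).
    exact: cdiff_inv_shift (gl j t t01).
  pose Q (s : seq 'I_n) (z : C) : C := \sum_(j <- s) f z / (z - l j).
  have QE s : continuous01 ncC (Q s \o g) /\ line_integral g (Q s) =
      \sum_(j <- s) f (l j) * line_integral g (fun z : C => ((z - l j)^-1) : C).
    elim: s => [|j s [cs IH]].
      have Q0 : Q [::] = fun=> 0 by apply/funext => z; rewrite /Q big_nil.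
      rewrite big_nil Q0 (line_integral0 BC); split => // t e _ e0.
      by exists 1 => // u _ _; rewrite -[ncC _]/(ncC (0 - 0)) subrr (bn0 BC).
    have Qj : Q (j :: s) = fun z => (f z / (z - l j) : C) + Q s z.
      by apply/funext => z; rewrite /Q big_cons.
    rewrite Qj big_cons; split; first exact: (continuous01D BC (cq j) cs).
    rewrite (line_integralD BC gv (cq j) cs) IH; congr (_ + _).
    by apply: (cauchy U hol g rg) => t t01; exact: inG.
  have [cs <-] := QE (index_enum 'I_n).
  apply/esym; apply: (line_integral_ext BC gv cs) => t t01 /=.
  have [h1 h2] := resg t t01.
  by rewrite /F phiZ // h2 mulr_sumr.
have SI : S (contour_integral G F) /\ phi (contour_integral G F) =
    \sum_i phi (line_integral (G i) F).
  rewrite /contour_integral.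
  elim: (index_enum _) => [|i s [h1 h2]].
    by rewrite !big_nil; split => //; have := phiZ 0 0 S0; rewrite scale0r mul0r.
  by rewrite !big_cons; have [h3 _] := piece i; split; [exact: SD | rewrite phiD ?h2].
case: SI => SI phiI; split; first exact: SZ.
rewrite phiZ // phiI (eq_bigr _ (fun i _ => (piece i).2)) exchange_big /= mulr_sumr.
apply: eq_bigr => j _; rewrite -mulr_sumr mulrCA.
rewrite [X in _ * X](_ : _ = winding_number G (l j)) //.
by rewrite w1 ?mulr1 //; exact: lsp.
Qed.

End HfcImage.

(** * Bicommutants and the determinant *)

Section Determinant.
Variables (R : realType) (A : cstarAlgType R).
Local Notation C := ((R[i] : numFieldType)^o).
Let BA := cnorm_banach A.
Let BN := ban BA.

Definition commutant (E : set A) : set A := [set x | forall y, E y -> x * y = y * x].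

Lemma commutantV E x y : commutant E x -> is_inverse x y -> commutant E y.
Proof.
move=> Ex [xy yx] z Ez.
by rewrite -[RHS]mul1r -yx -mulrA (mulrA x) Ex // -!mulrA xy mulr1.
Qed.

Lemma bicommutant_full (E : set A) : (forall x y, E x -> E y -> x * y = y * x) ->
  full_commutative (commutant (commutant E)).
Proof.
move=> EC; have sub x : E x -> commutant E x by move=> Ex y Ey; exact: EC.
split.
- by move=> y _; rewrite mul1r mulr1.
- by move=> x y hx hy z hz; rewrite mulrDl mulrDr hx ?hy.
- by move=> c x hx z hz; rewrite -scalerAl -scalerAr hx.
- by move=> x y hx hy z hz; rewrite -mulrA hy // mulrA hx // mulrA.
- by move=> x y hx hy; apply: hx => z Ez; apply: hy; exact: sub.
- by move=> x y; exact: commutantV.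
Qed.

Lemma commutant_star E : (forall x, E x -> E (star x)) ->
  forall x, commutant E x -> commutant E (star x).
Proof.
move=> Es x hx y Ey; rewrite -[y]starK -!starM hx //.
exact: Es.
Qed.

Lemma commutant_closed E (x : A) :
  (forall e : R, 0 < e -> exists2 y, commutant E y & cnorm (x - y) < e) ->
  commutant E x.
Proof.
move=> Hx z Ez; apply/eqP; rewrite -subr_eq0; apply/eqP/(bn_eq0 BN)/eqP.
rewrite eq_le (bn_ge0 BN) andbT; apply/ler_addgt0Pr => e e0; rewrite add0r.
have z0 := bn_ge0 BN z.
have c0 : 0 < 2 * cnorm z + 1 by lra.
have [y hy h] := Hx _ (divr_gt0 e0 c0).
have -> : x * z - z * x = (x - y) * z - z * (x - y).
  by rewrite mulrBl mulrBr (hy z Ez) opprB addrA subrK.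
apply: le_trans (bnD BN _ _) _; rewrite (bnN BN).
have h1 := banM BA (x - y) z; have h2 := banM BA z (x - y).
rewrite ltr_pdivlMr // in h; have := bn_ge0 BN (x - y); lra.
Qed.

Section Character.
Variables (S : set A) (chi : A -> R[i]).
Hypotheses (FS : full_commutative S) (Hchi : character (@cnorm R A) S chi).

Lemma fc_sum (I : Type) (s : seq I) (F : I -> A) :
  (forall i, S (F i)) -> S (\sum_(i <- s) F i).
Proof. by move=> SF; elim/big_ind: _ => //; [exact: fc0 | exact: fcD]. Qed.

Lemma fc_prod (I : Type) (s : seq I) (F : I -> A) :
  (forall i, S (F i)) -> S (\prod_(i <- s) F i).
Proof. by move=> SF; elim/big_ind: _ => //; [exact: fc1 | exact: fcM]. Qed.

Lemma chi0 : chi 0 = 0.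
Proof. by have := chiZ Hchi 0 (fc1 FS); rewrite scale0r mul0r. Qed.

Lemma chi_sum (I : Type) (s : seq I) (F : I -> A) :
  (forall i, S (F i)) -> chi (\sum_(i <- s) F i) = \sum_(i <- s) chi (F i).
Proof.
move=> SF; elim: s => [|i s IH]; first by rewrite !big_nil chi0.
by rewrite !big_cons (chiD Hchi) ?IH //; exact: fc_sum.
Qed.

Lemma chi_prod (I : Type) (s : seq I) (F : I -> A) :
  (forall i, S (F i)) -> chi (\prod_(i <- s) F i) = \prod_(i <- s) chi (F i).
Proof.
move=> SF; elim: s => [|i s IH]; first by rewrite !big_nil (chi1 Hchi).
by rewrite !big_cons (chiM Hchi) ?IH //; exact: fc_prod.
Qed.

Lemma fc_sign (b : bool) : S ((-1) ^+ b).
Proof. by apply: (fcX FS); apply: (fcN FS); exact: fc1. Qed.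

Lemma chi_sign (b : bool) : chi ((-1) ^+ b) = (-1) ^+ b.
Proof.
case: b; rewrite ?expr1 ?expr0 ?(chi1 Hchi) //.
by rewrite -scaleN1r (chiZ Hchi _ (fc1 FS)) (chi1 Hchi) mulr1.
Qed.

End Character.

Variables (m : nat) (h : cmx A m.+1).
Hypotheses (hpos : positive h) (hinv : exists k, is_inverse h k)
  (hsc : self_compatible h).

Let E : set A := [set x | exists i j, x = h i j].
Let S := commutant (commutant E).

Let E_comm x y : E x -> E y -> x * y = y * x.
Proof. by move=> [i [j ->]] [k [l ->]]. Qed.

Let FS : full_commutative S := bicommutant_full E_comm.

Let Sh i j : S (h i j).
Proof. by move=> y Ey; rewrite Ey //; exists i, j. Qed.

Let S_star x : S x -> S (star x).
Proof.
do 2!apply: commutant_star => //; move=> _ [i [j ->]]; exists j, i.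
by rewrite -[in RHS]hpos.1 mxE.
Qed.

(** The inverse of a matrix with entries in the bicommutant has its entries
    there: scalar matrices over the commutant commute with the former. *)
Let S_inverse (z : R[i]) (k : cmx A m.+1) : is_inverse (z%:A - h) k ->
  forall i j, S (k i j).
Proof.
move=> hk i j y hy.
pose D : cmx A m.+1 := \matrix_(p, q) (if p == q then y else 0).
have DM (b : cmx A m.+1) p q : (D * b) p q = y * b p q.
  rewrite mxE (bigD1 p) //= mxE eqxx big1 ?addr0 // => r rp.
  by rewrite mxE eq_sym (negbTE rp) mul0r.
have MD (b : cmx A m.+1) p q : (b * D) p q = b p q * y.
  rewrite mxE (bigD1 q) //= mxE eqxx big1 ?addr0 // => r rp.
  by rewrite mxE (negbTE rp) mulr0.
have comm : D * (z%:A - h) = (z%:A - h) * D.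
  rewrite mulrBr mulrBl -scalerAr -scalerAl mulr1 mul1r; congr (_ - _).
  by apply/matrixP => p q; rewrite DM MD hy //; exists p, q.
have : D * k = k * D.
  by rewrite -[LHS]mul1r -hk.2 -mulrA (mulrA _ D) -comm -mulrA hk.1 mulr1.
by move=> /matrixP /(_ i j); rewrite DM MD.
Qed.

Let BM := mxnorm_banach A m.

Let det_h := \sum_(s : 'S_m.+1) (-1) ^+ s * \prod_(i < m.+1) h i (s i).

Let L : cmx A m.+1 := hfc (@clog R) h.
Let t : A := \tr L.

Let L_hfc : is_hfc (@clog R) h L.
Proof.
have [k hk] := hinv; have [b hb] := hfc_exists_log BM hk hpos.2.
exact: (xgetPex 0 (ex_intro [set b | is_hfc (@clog R) h b] b hb)).
Qed.

Let d_hfc : is_hfc (@cexp R) t (hfc (@cexp R) t).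
Proof.
have [b hb] := hfc_exists_exp BA t.
exact: (xgetPex 0 (ex_intro [set b | is_hfc (@cexp R) t b] b hb)).
Qed.

(** The trace of [log h] is read through the linear map [phi] that sums the values
    of [chi] at the diagonal entries. *)
Let trace_log chi : character (@cnorm R A) S chi ->
  S t /\ exists l : 'I_m.+1 -> R[i], chi t = \sum_i clog (l i) /\
    chi det_h = \prod_i cexp (clog (l i)).
Proof.
move=> Hchi.
pose H : 'M[R[i]]_m.+1 := \matrix_(i, j) chi (h i j).
have [l [detH notinv trinv]] := eigenvalues_exist H.
pose SM : set (cmx A m.+1) := [set a | forall i j, S (a i j)].
pose phi (a : cmx A m.+1) : R[i] := \sum_i chi (a i i).
have SzA (z : R[i]) i j : S ((z%:A - h : cmx A m.+1) i j).
  rewrite !mxE; apply: (fcB FS) => //; apply: (fcZ FS).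
  by case: (i == j); [exact: (fc1 FS) | exact: (fc0 FS)].
have chizA (z : R[i]) i j : chi ((z%:A - h : cmx A m.+1) i j) = (z%:M - H) i j.
  rewrite !mxE -scaleN1r (chiD Hchi) ?(chiZ Hchi) //; last 3 first.
  - by case: (i == j); [exact: (fc1 FS) | exact: (fc0 FS)].
  - by apply: (fcZ FS); case: (i == j); [exact: (fc1 FS) | exact: (fc0 FS)].
  - exact: (fcZ FS).
  rewrite mulN1r; congr (_ - _).
  by case: (i == j); rewrite ?(chi1 Hchi) ?(chi0 FS Hchi) ?mulr1 ?mulr0.
have chi_inv (z : R[i]) (k : cmx A m.+1) : is_inverse (z%:A - h) k ->
    (z%:M - H) *m (\matrix_(i, j) chi (k i j)) = 1%:M.
  move=> hk; have Sk := S_inverse hk; apply/matrixP => i j; rewrite mxE.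
  have := congr1 (fun b : cmx A m.+1 => chi (b i j)) hk.1.
  rewrite /= !mxE (chi_sum FS Hchi); last first.
    by move=> p; apply: (fcM FS) => //; exact: SzA.
  move=> e; rewrite [LHS](_ : _ = \sum_p chi ((z%:A - h : cmx A m.+1) i p * k p j)).
    by rewrite e; case: (i == j); rewrite ?(chi1 Hchi) ?(chi0 FS Hchi).
  by apply: eq_bigr => p _; rewrite (chiM Hchi) // chizA [in RHS]mulrC mxE mulrC.
have lsp i : spectrum h (l i).
  by move=> [k /chi_inv hk]; exact: (notinv i _ hk).
have [k0 hk0] := hinv.
have lpos i : 0 < complex.Re (l i) /\ complex.Im (l i) = 0.
  have := hpos.2 _ (lsp i); have := spectrum_away0 BM hk0 (lsp i).
  case: (l i) => x y /=; rewrite lecE /= => h1 /andP[/eqP y0 x0]; split => //.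
  rewrite lt_def x0 andbT; apply/eqP => x00; move: h1.
  by rewrite y0 x00 expr0n addr0 sqrtr0 mul0r lt_geF.
have [SL phiL] : SM L /\ phi L = \sum_i clog (l i).
  apply: (@hfc_image R (cmx A m.+1) (@mxnorm R A m) BM (@clog R) h L SM phi m.+1 l);
    last exact: L_hfc.
  - by move=> i j; rewrite mxE; exact: (fc0 FS).
  - by move=> x y hx hy i j; rewrite mxE; exact: (fcD FS).
  - by move=> c x hx i j; rewrite mxE; exact: (fcZ FS).
  - move=> x y hx hy; rewrite /phi -big_split /=; apply: eq_bigr => i _.
    by rewrite mxE (chiD Hchi).
  - move=> c x hx; rewrite /phi mulr_sumr; apply: eq_bigr => i _.
    by rewrite mxE (chiZ Hchi).
  - move=> x hx; rewrite /phi; apply: le_trans (bn_sum (complex_banach R) _ _) _.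
    apply: ler_sum => i _; apply: le_trans (chi_le Hchi (hx i i)) _.
    by rewrite (bigD1 i) //= lerDl sumr_ge0 // => j _; exact: (bn_ge0 BN).
  - move=> x hx i j; apply: commutant_closed => e /hx [y hy xy].
    exists (y i j); first exact: hy.
    by apply: le_lt_trans xy; have := mxnorm_ge_entry (x - y) i j; rewrite !mxE.
  - exact: lsp.
  - move=> z y hy; split; first exact: S_inverse hy.
    by rewrite -(trinv _ _ (chi_inv _ _ hy)); apply: eq_bigr => i _; rewrite mxE.
  move=> U hol g rg gU i; have [l0 l1] := lpos i.
  apply: (cauchy_log rg l0 l1) => u /gU [Ug nsp].
    exact: holomorphic_clog_slit hol Ug.
  by apply: contra_not_neq nsp => ->; exact: lsp.
split; first by apply: fc_sum => // i; exact: SL.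
exists l; split; first by rewrite /t (chi_sum FS Hchi).
have Sprod (s : 'S_m.+1) : S (\prod_i h i (s i)) by exact: fc_prod.
rewrite (chi_sum FS Hchi); last by move=> s; apply: (fcM FS) => //; exact: fc_sign.
transitivity (\det H).
  apply: eq_bigr => s _; rewrite (chiM Hchi) //; last exact: fc_sign.
  rewrite (chi_sign FS Hchi) (chi_prod FS Hchi) //.
  by congr (_ * _); apply: eq_bigr => i _; rewrite mxE.
rewrite detH; apply: eq_bigr => i _; rewrite clogK //.
by apply: slit_neq0; apply: slit_Re; have [] := lpos i.
Qed.

(** Both sides lie in the bicommutant of the entries and have the same
    characters. *)
Lemma hfc_det_leibniz : hfc_det h = det_h.
Proof.
have Sdet : S det_h.
  by apply: fc_sum => // s; apply: (fcM FS); [exact: fc_sign | exact: fc_prod].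
have value chi : character (@cnorm R A) S chi -> S (hfc_det h) /\ chi (hfc_det h) = chi det_h.
  move=> Hchi; have [St [l [ht ->]]] := trace_log Hchi.
  have inv z y : is_inverse (z%:A - t) y -> S y /\ (z - chi t) * chi y = 1.
    have Sz : S (z%:A - t) by apply: (fcB FS) => //; exact: (fcZ FS _ (fc1 FS)).
    move=> hy; have Sy := fcV FS Sz hy; split => //.
    have <- : chi (z%:A - t) = z - chi t.
      rewrite -scaleN1r (chiD Hchi) ?(chiZ Hchi) ?(chi1 Hchi) ?mulr1 ?mulN1r //.
      - exact: (fc1 FS).
      - exact: (fcZ FS _ (fc1 FS)).
      - exact: (fcZ FS).
    by rewrite -(chiM Hchi) // hy.1 (chi1 Hchi).
  have tsp : spectrum t (chi t).
    by move=> [y /inv [_ /eqP]]; rewrite subrr mul0r eq_sym oner_eq0.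
  have [Sd ->] : S (hfc_det h) /\ chi (hfc_det h) = \sum_(i < 1) cexp (chi t).
    apply: (@hfc_image R A (@cnorm R A) BA (@cexp R) t (hfc_det h) S chi 1 (fun=> chi t));
      last exact: d_hfc.
    - exact: (fc0 FS).
    - exact: (fcD FS).
    - exact: (fcZ FS).
    - exact: (chiD Hchi).
    - exact: (chiZ Hchi).
    - exact: (chi_le Hchi).
    - by move=> x hx; exact: commutant_closed.
    - by [].
    - move=> z y /inv [Sy hy]; split => //; rewrite big_ord1.
      have zt : z - chi t != 0.
        by apply: contra_eq_neq hy => ->; rewrite mul0r eq_sym oner_eq0.
      by apply: (mulfI zt); rewrite hy mulfV.
    move=> U _ g rg gU _; apply: cauchy_exp => // u /gU [_ nsp].
    by apply: contra_not_neq nsp => ->.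
  by split => //; rewrite big_ord1 ht cexp_sum.
apply/eqP; rewrite -subr_eq0; apply/eqP.
have [Sd|nSd] := pselect (S (hfc_det h)).
  apply: (cstar_semisimple FS S_star); first exact: (fcB FS).
  move=> chi Hchi; have [_ E1] := value chi Hchi.
  rewrite -scaleN1r (chiD Hchi) ?(chiZ Hchi) ?E1 ?mulN1r ?subrr //.
  exact: (fcZ FS).
(* a character exists, since 0 is not invertible; it shows that [hfc_det h] lies
   in [S] *)
have [chi Hchi _] : exists2 chi, character (@cnorm R A) S chi & chi 0 = 0.
  apply: (exists_character BA FS (fc0 FS)) => -[y [/eqP]].
  by rewrite mul0r eq_sym oner_eq0.
by case: nSd; have [] := value chi Hchi.
Qed.

End Determinant.

Theorem corollary6p6 (R : realType) (A : cstarAlgType R) (calA : set A)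
    (calA_subalg : unital_star_subalgebra calA)
    (calA_hfc : hfc_closed calA)
    (M_calA_hfc : forall n : nat, hfc_closed (@mx_over R A calA n.+2))
    (m : nat) (h : cmx A m.+1)
    (h_pos : GLpos calA h) (h_sc : self_compatible h) :
  hfc_det h = \sum_(s : 'S_m.+1) (-1) ^+ s * \prod_(i < m.+1) h i (s i).
Proof.
have [_ hpos [k _ hk]] := h_pos.
by apply: hfc_det_leibniz => //; exists k.
Qed.
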